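(* The separation problem for $C_{\overline{D(\sigma)_{\rm SP}},\Pi}:=\operatorname{conv}\{\Pi(u):\ u\in\overline{D(\sigma)_{\rm SP}}\}\subseteq\mathbb{R}^M$ can be solved in polynomial time.
   Context: Let $T>0$, $\sigma>0$, $p\in[1,\infty)$, and let $$D(\sigma):=\{u\in BV(0,T):\ u(t)\in\{0,1\}\text{ for almost all }t\in(0,T),\ |u|_{BV(0,T)}\le\sigma\},$$ where $|u|_{BV(0,T)}$ denotes the total variation. Pointwise evaluation: every $u\in BV(0,T)$ has a unique right-continuous representative $\hat u$ on $(0,T)$; for $t\in(0,T)$, ''$u(t)=b$'' means $\hat u(t)=b$, and ''$u(0)=b$'' means $\lim_{t\searrow0}\hat u(t)=b$. Let fixings $(\tau_j,c_j)\in[0,T)\times\{0,1\}$, $j=1,\dots,N$, with $\tau_1<\cdots<\tau_N$ be given and set $$D(\sigma)_{\rm SP}:=\{u\in D(\sigma):\ u(\tau_j)=c_j\ \text{for all } j=1,\ldots,N\}.$$ $\overline{D(\sigma)_{\rm SP}}$ is its closure in $L^p(0,T)$. Let $I_i=(a_i,b_i)\subseteq(0,T)$, $i=1,\ldots,M$, be nonempty, pairwise disjoint open intervals with $\tau_j\notin I_i$ for all $i,j$, and let $\Pi$ be the local averaging operator $$\Pi(u)=\Big(\tfrac{1}{\lambda(I_i)}\int_{I_i}u(t)\,\mathrm{d}t\Big)_{i=1}^M\in\mathbb{R}^M,\qquad \lambda(I_i)=b_i-a_i.$$ The separation problem for a polytope $C\subseteq\mathbb{R}^M$ is: given $v\in\mathbb{R}^M$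 (rational, for complexity purposes), decide whether $v\in C$, and if not, return $a\in\mathbb{R}^M$ and $b\in\mathbb{R}$ with $a^\top w\le b$ for all $w\in C$ and $a^\top v>b$. Here the input consists of $v$, the intervals $I_1,\dots,I_M$, the fixings $(\tau_j,c_j)$, and $\sigma$ (all rational), and running time is measured with respect to the input size. *)

(* Defs.v *)
From HB Require Import structures.
From mathcomp Require Import all_boot all_order all_algebra.
From mathcomp Require Import all_classical all_reals all_analysis.

Set Implicit Arguments.
Unset Strict Implicit.
Unset Printing Implicit Defensive.
Import Order.TTheory GRing.Theory Num.Theory.
Import numFieldNormedType.Exports.

Local Open Scope classical_set_scope.
Local Open Scope ring_scope.

(* Polynomial time is taken on random access machines with integer registers  *)
(* and the logarithmic cost criterion of Aho, Hopcroft and Ullman (every      *)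
(* access or operation costs the bit length of the integers involved), with   *)
(* structured control flow in place of jumps. Because multiplication and      *)
(* division are charged for the length of their operands, this is             *)
(* polynomially equivalent to Turing machines.                                *)

(* The bit length of 0 is 1. *)
Definition bitlen (z : int) : nat := (trunc_log 2 `|z|%N).+1.

Inductive binop := OpAdd | OpSub | OpMul | OpDiv.

Inductive expr :=
| Cst of int
| Reg of expr (* content of the register whose address is computed *)
| Bin of binop & expr & expr.

Inductive cmd :=
| Skip
| Assign of expr & expr (* first the address of the register, then its value *)
| Write of expr (* append to the output *)
| Seq of cmd & cmd
| IfPos of expr & cmd & cmd
| WhilePos of expr & cmd.

Definition memory := int -> int.

(* Euclidean division; division by 0 returns 0. *)
Definition binop_val (o : binop) (x y : int) : int :=
  match o with
  | OpAdd => x + y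
  | OpSub => x - y
  | OpMul => x * y
  | OpDiv => (x %/ y)%Z
  end.

Fixpoint expr_val (m : memory) (e : expr) : int :=
  match e with
  | Cst z => z
  | Reg e1 => m (expr_val m e1)
  | Bin o e1 e2 => binop_val o (expr_val m e1) (expr_val m e2)
  end.

Fixpoint expr_cost (m : memory) (e : expr) : nat :=
  match e with
  | Cst z => bitlen z
  | Reg e1 =>
      expr_cost m e1 + bitlen (expr_val m e1) + bitlen (m (expr_val m e1))
  | Bin _ e1 e2 =>
      expr_cost m e1 + expr_cost m e2
      + bitlen (expr_val m e1) + bitlen (expr_val m e2)
  end%N.

Definition update (m : memory) (i z : int) : memory :=
  fun j => if j == i then z else m j.

Definition test_cost (m : memory) (e : expr) : nat :=
  (expr_cost m e + bitlen (expr_val m e))%N.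

(* [exec c m s m' s' t]: started with memory m and output s, the program c    *)
(* halts with memory m' and output s' at total cost t.                        *)
Inductive exec : cmd -> memory -> seq int -> memory -> seq int -> nat -> Prop :=
| exec_skip m s : exec Skip m s m s 1
| exec_assign e1 e2 m s :
    exec (Assign e1 e2) m s (update m (expr_val m e1) (expr_val m e2)) s
         (test_cost m e1 + test_cost m e2)
| exec_write e m s :
    exec (Write e) m s m (rcons s (expr_val m e)) (test_cost m e)
| exec_seq c1 c2 m1 s1 m2 s2 m3 s3 t1 t2 :
    exec c1 m1 s1 m2 s2 t1 -> exec c2 m2 s2 m3 s3 t2 ->
    exec (Seq c1 c2) m1 s1 m3 s3 (t1 + t2)
| exec_if_pos e c1 c2 m s m' s' t :
    0 < expr_val m e -> exec c1 m s m' s' t ->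
    exec (IfPos e c1 c2) m s m' s' (test_cost m e + t)
| exec_if_npos e c1 c2 m s m' s' t :
    expr_val m e <= 0 -> exec c2 m s m' s' t ->
    exec (IfPos e c1 c2) m s m' s' (test_cost m e + t)
| exec_while_pos e c m1 s1 m2 s2 m3 s3 t1 t2 :
    0 < expr_val m1 e -> exec c m1 s1 m2 s2 t1 ->
    exec (WhilePos e c) m2 s2 m3 s3 t2 ->
    exec (WhilePos e c) m1 s1 m3 s3 (test_cost m1 e + t1 + t2)
| exec_while_npos e c m s :
    expr_val m e <= 0 ->
    exec (WhilePos e c) m s m s (test_cost m e).

(* The input occupies registers 0, 1, ...; all other registers are 0. *)
Definition load (inp : seq int) : memory :=
  fun i => if i is Posz k then nth 0 inp k else 0.

Definition input_size (inp : seq int) : nat := (\sum_(z <- inp) bitlen z)%N.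

(* A single program answers every valid instance x, with input [enc x], in    *)
(* time bounded by a polynomial in the size of the input; the relation        *)
(* [answer x] describes the admissible outputs.                               *)
Definition solvable_in_polynomial_time (I : Type) (valid : I -> Prop)
    (enc : I -> seq int) (answer : I -> seq int -> Prop) : Prop :=
  exists (c : cmd) (q : {poly nat}), forall x : I, valid x ->
    exists (m : memory) (out : seq int) (t : nat),
      [/\ exec c (load (enc x)) [::] m out t,
          (t <= q.[input_size (enc x)])%N &
          answer x out].

(* Classes of functions on (0, T) modulo equality almost everywhere are       *)
(* represented by functions on R whose values outside (0, T) are irrelevant.  *)
Section bounded_variation_functions.
Context {R : realType}.
Local Notation mu := (@lebesgue_measure R).

Definition dom (T : R) : set R := `]0, T[%classic.

(* The continuously differentiable functions with compact support in (0, T)   *)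
(* and values in [-1, 1].                                                     *)
Definition test_function (T : R) (phi : R -> R) : Prop :=
  [/\ forall x, derivable phi x 1,
      continuous (derive1 phi),
      exists K : set R,
        [/\ compact K, K `<=` dom T & forall x, ~ K x -> phi x = 0] &
      forall x, `|phi x| <= 1].

Definition BV_seminorm (T : R) (u : R -> R) : \bar R :=
  ereal_sup [set (\int[mu]_(x in dom T) (u x * derive1 phi x)%:E)%E |
             phi in test_function T].

Definition BV (T : R) : set (R -> R) :=
  [set u | mu.-integrable (dom T) (EFin \o u) /\
           (BV_seminorm T u < +oo)%E].

Definition D (T sigma : R) : set (R -> R) :=
  [set u | [/\ BV T u,
               {ae mu, forall t, dom T t -> u t = 0 \/ u t = 1} &
               (BV_seminorm T u <= sigma%:E)%E]].

Definition right_continuous_representative (T : R) (u uh : R -> R) : Prop :=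
  {ae mu, forall t, dom T t -> uh t = u t} /\
  (forall t, dom T t -> uh x @[x --> t^'+] --> uh t).

(* The pointwise condition u(t) = b, for t in [0, T). *)
Definition has_value (T : R) (u : R -> R) (t b : R) : Prop :=
  exists uh : R -> R,
    right_continuous_representative T u uh /\
    (if t == 0 then uh x @[x --> 0^'+] --> b else uh t = b).

Definition D_SP (T sigma : R) (N : nat) (tau : 'I_N -> R) (c : 'I_N -> bool) :
    set (R -> R) :=
  [set u | D T sigma u /\ forall j, has_value T u (tau j) (c j)%:R].

Definition Lp_norm (T p : R) (u : R -> R) : \bar R :=
  'N[mu]_(p%:E)[(EFin \o u) \_ (dom T)]%E.

Definition Lp_closure (T p : R) (A : set (R -> R)) : set (R -> R) :=
  [set u | [/\ measurable_fun (dom T) u,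
               (Lp_norm T p u < +oo)%E &
               forall e : R, 0 < e ->
                 exists2 w, A w & (Lp_norm T p (u \- w)%R < e%:E)%E]].

Definition averages (M : nat) (a b : 'I_M -> R) (u : R -> R) : 'rV[R]_M :=
  \row_i ((b i - a i)^-1 * \int[mu]_(t in `]a i, b i[) u t).

Definition convex_hull (M : nat) (S : set 'rV[R]_M) : set 'rV[R]_M :=
  [set x | exists (n : nat) (l : 'I_n -> R) (y : 'I_n -> 'rV[R]_M),
     [/\ forall i, 0 <= l i, \sum_i l i = 1, forall i, S (y i) &
         x = \sum_i l i *: y i]].

Definition dot (M : nat) (x y : 'rV[R]_M) : R := \sum_i x 0 i * y 0 i.

End bounded_variation_functions.

Record instance := Instance {
  nint : nat;               (* the number M of intervals *)
  nfix : nat;               (* the number N of fixings *)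
  query : 'rV[rat]_nint;    (* the vector v to be separated *)
  lo : 'I_nint -> rat;
  hi : 'I_nint -> rat;
  tau : 'I_nfix -> rat;
  fixval : 'I_nfix -> bool;
  sigma : rat }.

Arguments query : clear implicits.
Arguments lo : clear implicits.
Arguments hi : clear implicits.
Arguments tau : clear implicits.
Arguments fixval : clear implicits.

Section instances.
Context {R : realType}.
Implicit Types (T p : R) (x : instance).

Definition avg_interval x (i : 'I_(nint x)) : set R :=
  `]ratr (lo x i), ratr (hi x i)[%classic.
Arguments avg_interval : clear implicits.

Definition valid T x : Prop :=
  0 < sigma x /\
  [/\ forall j, 0 <= (ratr (tau x j) : R) < T,
      forall j k : 'I_(nfix x), (j < k)%N -> tau x j < tau x k,
      forall i, avg_interval x i !=set0 /\ avg_interval x i `<=` dom T,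
      forall i k, i != k -> avg_interval x i `&` avg_interval x k = set0 &
      forall i j, ~ avg_interval x i (ratr (tau x j))].

Definition C_SP T p x : set 'rV[R]_(nint x) :=
  convex_hull
    [set averages (fun i => ratr (lo x i)) (fun i => ratr (hi x i)) u | u in
      Lp_closure T p
        (D_SP T (ratr (sigma x)) (fun j => ratr (tau x j)) (fixval x))].

End instances.

Arguments avg_interval {R} x i _.
Arguments C_SP {R} T p x _.

(* Rationals are encoded by numerator and denominator in lowest terms. *)
Definition enc_rat (r : rat) : seq int := [:: numq r; denq r].

Definition enc_instance (x : instance) : seq int :=
  [:: (nint x)%:Z; (nfix x)%:Z] ++ enc_rat (sigma x)
  ++ flatten [seq enc_rat (query x 0 i) | i <- enum 'I_(nint x)]
  ++ flatten [seq enc_rat (lo x i) ++ enc_rat (hi x i) | i <- enum 'I_(nint x)]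
  ++ flatten [seq enc_rat (tau x j) ++ [:: (fixval x j : nat)%:Z]
             | j <- enum 'I_(nfix x)].

(* The output is [1] for membership, and otherwise 0 followed by the entries  *)
(* of a and by b, each as a fraction that need not be in lowest terms.        *)
Definition separation_answer (R : realType) (M : nat) (C : set 'rV[R]_M)
    (v : 'rV[R]_M) (out : seq int) : Prop :=
  (C v /\ out = [:: 1]) \/
  (~ C v /\
   exists (an ad : 'I_M -> int) (bn bd : int),
     let a : 'rV[R]_M := \row_i ((an i)%:~R / (ad i)%:~R) in
     let b : R := bn%:~R / bd%:~R in
     [/\ (forall i, ad i != 0) /\ bd != 0,
         out = 0 :: flatten [seq [:: an i; ad i] | i <- enum 'I_M]
                 ++ [:: bn; bd],
         forall w, C w -> dot a w <= b &
         b < dot a v]).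

(* Main.v *)
(* Sort the items, i.e. intervals and fixings, along the line. The set C is the
   convex hull of the 0/1 vectors, indexed by the intervals, that extend by the
   fixed values to a sequence over all items with at most K = floor(sigma)
   switches. Indeed, given u in D_SP and a linear functional, each interval
   contains a Lebesgue point of u whose value is at least as good as the
   average; testing the variation against sums of C^1 bumps at these points
   and to the right of the fixings shows that the values switch at most K
   times. Conversely, a step function that jumps at the keys of the items has
   the right averages and is the limit of step functions in D_SP, in which the
   jump of an interval starting at a fixing is slightly delayed.

   A sequence y with entries in [0, 1] lies in the convex hull of the 0/1
   sequences with at most K switches that agree with y on its 0/1 entries if
   and only if its variation, closed up by |y_0 - y_n| for even K and by
   |1 - y_0 - y_n| for odd K, is at most K. This is necessary by parity of the
   number of switches, and sufficient by systematic sampling: with A - B = y,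
   A and B nondecreasing, and a uniform threshold theta, the 0/1 sequence
   floor(A + theta) - floor(B + theta) has mean y and at most K switches.
   Hence a violated bound of the unit box or a subgradient of the variation
   separates y; the latter is obtained by comparing the entries of y. *)
Require Import Defs.
From mathcomp Require Import all_boot all_order all_algebra.
From mathcomp Require Import all_classical all_reals all_analysis.
From mathcomp Require Import measurable_realfun zify lra.
Set Implicit Arguments.
Unset Strict Implicit.
Unset Printing Implicit Defensive.
Import Order.TTheory GRing.Theory Num.Theory.
Import numFieldNormedType.Exports.
Local Open Scope classical_set_scope.
Local Open Scope ring_scope.

(** * Test functions and variation *)

(** Neither closedness nor a facet description of C is needed. The geometry enters through two
    facts: an inequality valid for all [admissible] sequences holds on C ([C_SP_bound]), and every
    [admissible] sequence lies in C ([admissible_attained]). A negative answer thus takes one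
    inequality, a positive one an explicit convex combination. One number decides between them: in
    the coordinates 2y - 1 the closed variation is a seminorm up to a factor, because the reflection
    1 - y becomes a sign change. Its subgradient at the query therefore attains the closed variation
    there and stays below it elsewhere. The entries of this subgradient are integers of size at most
    2 (M + N), so no optimisation is involved, and the coordinates of the fixings, being constants,
    move to the right-hand side. The obstacle on the analytic side is an interval that starts at a
    fixing of the opposite value: no function of D_SP is constant with the other value on it, only a
    limit is. This dictates the order of items with equal keys. *)

Definition pospart (R : realType) (t : R) : R := Num.max t 0.

(** Squaring removes the kink: the difference quotient misses [2 * pospart t] by at most [|h|]. One
    continuous derivative is all that [test_function] asks for. *)
Lemma is_derive_sqr_pospart (R : realType) (t : R) :
  is_derive t 1 (fun x => pospart x ^+ 2) (2 * pospart t).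
Proof.
have cv : (h^-1 *: (pospart (h *: 1 + t) ^+ 2 - pospart t ^+ 2))
    @[h --> (0 : R)^'] --> 2 * pospart t.
  apply/cvgrPdist_le => e e0.
  near=> h.
  have h0 : h != 0 by near: h; exact: nbhs_dnbhs_neq.
  rewrite /GRing.scale /= mulr1.
  have he : `|h| <= e.
    near: h; apply: dnbhs0_le => //.
  apply: le_trans he.
  rewrite -(ler_pM2l (_ : 0 < `|h|)) ?normr_gt0// -normrM.
  have -> : h * (2 * pospart t - h^-1 * (pospart (h + t) ^+ 2 - pospart t ^+ 2)) =
     h * 2 * pospart t - (pospart (h + t) ^+ 2 - pospart t ^+ 2).
    by rewrite mulrBr !mulrA mulfV// mul1r.
  rewrite -expr2 real_normK ?num_real// ler_norml /pospart /Num.max.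
  by apply/andP; split; case: ifPn => ?; case: ifPn => ?; nra.
apply: DeriveDef.
- by apply/cvg_ex; exists (2 * pospart t).
- exact/cvg_lim.
Unshelve. all: by end_near. Qed.

Lemma continuous_pospart (R : realType) : continuous (@pospart R).
Proof.
move=> x; apply/cvgrPdist_le => e e0; near=> t.
apply: (@le_trans _ _ `|x - t|); last first.
  by near: t; apply: cvgr_dist_le e e0; exact: cvg_id.
rewrite /pospart /Num.max ler_norml; apply/andP.
by split; do 2 case: ifPn => ?; have := ler_norm (x - t); have := lerNnormlW (lexx `|x - t|); lra.
Unshelve. all: by end_near. Qed.

Section bumps.
Context {R : realType}.
Implicit Types c r t T : R.
Local Notation mu := (@lebesgue_measure R).

(* The quadratic spline rising from 0 at c - r to 1 at c + r. *)
Definition rise c r t : R :=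
  (2 * r ^+ 2)^-1 * (pospart (t - c + r) ^+ 2 - 2 * pospart (t - c) ^+ 2
                     + pospart (t - c - r) ^+ 2).

(** The derivative of [rise]: a hat of height [r^-1] on the interval from [c - r] to [c + r], of
    mass one, so that pairing [u] with it is a local weighted average. *)
Definition tent c r t : R :=
  (r ^+ 2)^-1 * (pospart (t - c + r) - 2 * pospart (t - c) + pospart (t - c - r)).

Lemma is_derive_rise c r t : r != 0 -> is_derive t 1 (rise c r) (tent c r t).
Proof.
move=> r0.
have aux (a : R) : is_derive t 1 (fun x => pospart (x + a) ^+ 2) (2 * pospart (t + a)).
  have Da : is_derive t 1 (fun x : R => x + a) 1.
    rewrite -[X in is_derive _ _ _ X]addr0; exact: is_deriveD.
  have := @is_derive1_comp _ _ (fun x : R => x + a) t _ _ (is_derive_sqr_pospart (t + a)) Da.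
  by rewrite /GRing.scale /= mulr1.
have h1 : is_derive t 1 (fun x : R => pospart (x - c + r) ^+ 2)
    (2 * pospart (t - c + r)).
  by have := aux (- c + r); rewrite addrA; under eq_fun do rewrite addrA.
have h3 : is_derive t 1 (fun x : R => pospart (x - c - r) ^+ 2)
    (2 * pospart (t - c - r)).
  by have := aux (- c - r); rewrite addrA; under eq_fun do rewrite addrA.
have h2 := aux (- c).
have := is_deriveZ (2 * r ^+ 2)^-1 (is_deriveD (is_deriveB h1 (is_deriveZ 2 h2)) h3).
rewrite /tent /GRing.scale /=.
by move=> H; apply: is_derive_eq; rewrite invfM; lra.
Qed.

Lemma continuous_tent c r : continuous (tent c r).
Proof.
have aux (a : R) : continuous (fun t : R => pospart (t + a)).
  move=> x; apply: (@continuous_comp _ _ _ (fun t => t + a) (@pospart R)).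
    by apply: cvgD; [exact: cvg_id|exact: cvg_cst].
  exact: continuous_pospart.
move=> x; apply: cvgM; first exact: cvg_cst.
have h1 := @aux (- c + r) x; have h2 := @aux (- c) x; have h3 := @aux (- c - r) x.
move: h1 h3; rewrite /continuous_at /=.
under eq_fun do rewrite addrA; rewrite addrA => h1.
under eq_fun do rewrite addrA; rewrite addrA => h3.
apply: cvgD => //; apply: cvgB => //.
by apply: cvgM => //; exact: cvg_cst.
Qed.

Lemma pospart_ge0 t : 0 <= t -> pospart t = t.
Proof. by move=> t0; rewrite /pospart max_l. Qed.

Lemma pospart_le0 t : t <= 0 -> pospart t = 0.
Proof. by move=> t0; rewrite /pospart max_r. Qed.

Lemma rise_left c r t : 0 < r -> t <= c - r -> rise c r t = 0.
Proof.
move=> r0 tc; rewrite /rise !pospart_le0; [|lra..].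
by lra.
Qed.

Lemma rise_right c r t : 0 < r -> c + r <= t -> rise c r t = 1.
Proof.
move=> r0 tc; rewrite /rise !pospart_ge0; [|lra..].
rewrite (_ : _ + _ = 2 * r ^+ 2); last by lra.
by rewrite mulVf// mulf_neq0// ?expf_neq0 ?gt_eqF.
Qed.

Lemma rise_itv c r t : 0 < r -> 0 <= rise c r t <= 1.
Proof.
move=> r0.
have [tl|tl] := leP t (c - r); first by rewrite rise_left ?lexx ?ler01.
have [tr|tr] := leP (c + r) t; first by rewrite rise_right ?lexx ?ler01.
have r2 : 0 < 2 * r ^+ 2 by rewrite mulr_gt0 ?exprn_gt0.
rewrite /rise mulrC ler_pdivlMr// ler_pdivrMr// mul0r mul1r.
rewrite (pospart_ge0 (t := t - c + r)) ?(pospart_le0 (t := t - c - r)); [|lra..].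
have rr := sqr_ge0 r; have [tc|tc] := leP c t.
  rewrite (pospart_ge0 (t := t - c)); last lra.
  have s0 : 0 <= t - c by lra.
  have sr : 0 <= r - (t - c) by lra.
  have h1 := mulr_ge0 s0 sr; have h2 := sqr_ge0 (r - (t - c)); have h3 := sqr_ge0 (t - c).
  by apply/andP; split; lra.
rewrite (pospart_le0 (t := t - c)); last lra.
have s0 : 0 <= c - t by lra.
have sr : 0 <= 2 * r - (c - t) by lra.
have h1 := mulr_ge0 s0 sr; have h2 := sqr_ge0 (t - c + r).
by apply/andP; split; lra.
Qed.

Lemma tent_out c r t : 0 < r -> t <= c - r \/ c + r <= t -> tent c r t = 0.
Proof.
move=> r0 [tc|tc]; rewrite /tent.
  by rewrite !pospart_le0; [|lra..]; lra.
by rewrite !pospart_ge0; [|lra..]; lra.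
Qed.

Lemma tent_ge0 c r t : 0 < r -> 0 <= tent c r t.
Proof.
move=> r0; rewrite /tent mulr_ge0 ?invr_ge0 ?sqr_ge0// /pospart /Num.max.
by do 3 case: ifPn => ?; lra.
Qed.

Lemma tent_le c r t : 0 < r -> tent c r t <= r^-1.
Proof.
move=> r0; rewrite /tent mulrC ler_pdivrMr ?exprn_gt0//.
rewrite expr2 mulrA mulVf ?gt_eqF// mul1r /pospart /Num.max.
by do 3 case: ifPn => ?; lra.
Qed.

(** The transition zones do not overlap, so at every point one of the two rises is already 1 or
    still 0. This order lets sums of differences telescope. *)
Lemma rise_anti c r c' r' t : 0 < r -> 0 < r' -> c + r <= c' - r' ->
  rise c' r' t <= rise c r t.
Proof.
move=> r0 r'0 cc; have [tl|tl] := leP (c + r) t.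
  by rewrite (rise_right r0 tl); case/andP: (rise_itv c' t r'0).
rewrite (rise_left r'0); last by lra.
by case/andP: (rise_itv c t r0).
Qed.

Lemma integral_tent T c r : 0 < r -> 0 < c - r -> c + r < T ->
  \int[mu]_(t in dom T) tent c r t = 1.
Proof.
move=> r0 cr crT; have T0 : 0 < T by lra.
have ct : continuous (tent c r) by exact: continuous_tent.
have dr (x : R) : is_derive x 1 (rise c r) (tent c r x).
  by apply: is_derive_rise; rewrite gt_eqF.
have mt : measurable_fun setT (tent c r) by exact: continuous_measurable_fun.
rewrite /Rintegral /dom.
have -> : (\int[mu]_(x in `]0%R, T[) (tent c r x)%:E
   = \int[mu]_(x in `[0%R, T]) (tent c r x)%:E)%E.
  symmetry; apply: integral_itv_bndoo.
  by apply/measurable_EFinP; exact: measurable_funTS.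
rewrite (@continuous_FTC2 _ (tent c r) (rise c r)) //.
- by rewrite (rise_right (t := T)) ?(rise_left (t := 0))//= ?subr0//; lra.
- exact: continuous_subspaceT.
- split.
  + by move=> x _; have [] := dr x.
  + apply: cvg_at_right_filter; apply: differentiable_continuous.
    by apply/derivable1_diffP; have [] := dr 0.
  + apply: cvg_at_left_filter; apply: differentiable_continuous.
    by apply/derivable1_diffP; have [] := dr T.
- by move=> x _; rewrite derive1E; apply: derive_val.
Qed.

End bumps.

Section variation_lower_bound.
Context {R : realType}.
Implicit Types (T t b : R) (u : R -> R).
Local Notation mu := (@lebesgue_measure R).

Lemma measurable_dom T : measurable (dom T).
Proof. exact: measurable_itv. Qed.

Lemma integrableM_continuous T u (g : R -> R) : continuous g ->
  mu.-integrable (dom T) (EFin \o u) ->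
  mu.-integrable (dom T) (fun x => (u x * g x)%:E).
Proof.
move=> cg iu.
have [M gM] : exists M : R, forall x, dom T x -> `|g x| <= M.
  have : compact (g @` `[0, T]).
    apply: continuous_compact; last exact: segment_compact.
    exact: continuous_subspaceT.
  move=> /compact_bounded [M [_ /(_ (M + 1))]].
  rewrite ltrDl ltr01 => /(_ isT) MB; exists (M + 1) => x xT.
  apply: MB; exists x => //; move: xT; rewrite /dom /= !in_itv /= => /andP[? ?].
  by rewrite !ltW.
have h := @integrableMr _ _ _ mu (dom T) (measurable_dom T) g (EFin \o u).
have {}h := h _ _ iu.
rewrite (_ : (fun x => _) = (EFin \o g) \* (EFin \o u))%E; last first.
  by apply/funext => x /=; rewrite mulrC EFinM.
apply: h.
  by apply: measurable_funTS; exact: continuous_measurable_fun.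
exists M; split; first exact: num_real.
by move=> y My x xT /=; apply: le_trans (gM _ xT) (ltW My).
Qed.

(** The tents need not be centred at [t]: centred ones serve Lebesgue points, and tents to the right
    of [t] serve right limits, including the one at 0. *)
Definition approximates T u t b : Prop := forall e : R, 0 < e ->
  exists c r, [/\ 0 < r, t - e < c - r /\ c + r < t + e, 0 < c - r /\ c + r < T &
    `|\int[mu]_(x in dom T) (u x * tent c r x) - b| <= e].

Lemma min_gap (n : nat) (q : nat -> R) : (forall p, (p < n)%N -> q p < q p.+1) ->
  exists2 d : R, 0 < d & forall p, (p < n)%N -> q p + d <= q p.+1.
Proof.
elim: n => [|n IH] hq; first by exists 1.
have [|d d0 hd] := IH; first by move=> p pn; apply: hq; rewrite ltnW.
have qn := hq n (ltnSn n).
exists (Num.min d (q n.+1 - q n)); first by rewrite lt_min d0 subr_gt0.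
move=> p; rewrite ltnS leq_eqVlt => /predU1P[->|/hd].
  have : Num.min d (q n.+1 - q n) <= q n.+1 - q n by rewrite ge_min lexx orbT.
  lra.
have : Num.min d (q n.+1 - q n) <= d by rewrite ge_min lexx.
lra.
Qed.

(** The supremum in [BV_seminorm] is tested with a function whose derivative is a signed sum of
    differences of tents near the points [q p]; its pairing with [u] is close to the sum of the
    jumps of [z]. *)
Lemma TV_bound T (sigma : R) u (n : nat) (q z : nat -> R) :
  mu.-integrable (dom T) (EFin \o u) -> (BV_seminorm T u <= sigma%:E)%E ->
  (forall p, (p <= n)%N -> approximates T u (q p) (z p)) ->
  (forall p, (p < n)%N -> q p < q p.+1) ->
  \sum_(p < n) `|z p.+1 - z p| <= sigma.
Proof.
move=> iu bu az hq; have [d d0 hd] := min_gap hq.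
apply/ler_addgt0Pr => e e0.
(* The first bound separates the supports of consecutive tents; the second keeps the total error,
   [2 * e'] for each of the [n] differences, below [e]. *)
pose e' := Num.min (d / 2) (e / (2 * n.+1%:R)).
have e'0 : 0 < e' by rewrite lt_min !divr_gt0// mulr_gt0// ltr0n.
have e'd : e' <= d / 2 by rewrite ge_min lexx.
have e'e : n%:R * (2 * e') <= e.
  have : e' <= e / (2 * n.+1%:R) by rewrite ge_min lexx orbT.
  rewrite ler_pdivlMr ?mulr_gt0 ?ltr0n// -natr1; nra.
have {az} /choice [cr hcr] p : exists cr : R * R, (p <= n)%N ->
  [/\ 0 < cr.2, q p - e' < cr.1 - cr.2 /\ cr.1 + cr.2 < q p + e',
      0 < cr.1 - cr.2 /\ cr.1 + cr.2 < T &
      `|\int[mu]_(x in dom T) (u x * tent cr.1 cr.2 x) - z p| <= e'].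
  have [pn|] := boolP (p <= n)%N; last by exists (0, 0).
  by have [c [r cr]] := az _ pn _ e'0; exists (c, r).
pose c p := (cr p).1; pose r p := (cr p).2.
pose s p := Num.sg (z p.+1 - z p).
pose y p := \int[mu]_(x in dom T) (u x * tent (c p) (r p) x).
(* Up to sign, each summand is a plateau of height one between two consecutive test points and
   vanishes outside, which gives compact support. *)
pose phi : R -> R := \sum_(p < n) s p \*: (rise (c p.+1) (r p.+1) - rise (c p) (r p)).
pose dphi : R -> R := fun t => \sum_(p < n) s p * (tent (c p.+1) (r p.+1) t - tent (c p) (r p) t).
have r0 p : (p <= n)%N -> 0 < r p by move=> /hcr[].
have phiE t : phi t = \sum_(p < n) s p * (rise (c p.+1) (r p.+1) t - rise (c p) (r p) t).
  by rewrite /phi fct_sumE.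
have Dphi t : is_derive t 1 phi (dphi t).
  apply: is_derive_sum => p; apply: is_deriveZ; apply: is_deriveB.
    by apply: is_derive_rise; rewrite gt_eqF// r0.
  by apply: is_derive_rise; rewrite gt_eqF// r0// ltnW.
have dphiE : derive1 phi = dphi.
  by apply/funext => t; rewrite derive1E; apply: derive_val.
have ordered p : (p < n)%N -> c p + r p <= c p.+1 - r p.+1.
  move=> pn; have [_ [_ h1] _ _] := hcr _ (ltnW pn).
  have [_ [h2 _] _ _] := hcr _ pn; have := hd _ pn; rewrite /c /r; lra.
have yz p : (p <= n)%N -> `|y p - z p| <= e' by move=> /hcr[].
have iy p : (p <= n)%N -> mu.-integrable (dom T) (fun x => (u x * tent (c p) (r p) x)%:E).
  by move=> _; apply: integrableM_continuous => //; exact: continuous_tent.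
have iphi : (\int[mu]_(x in dom T) (u x * derive1 phi x)%:E)%E =
    (\sum_(p < n) s p * (y p.+1 - y p))%:E.
  transitivity (\int[mu]_(x in dom T) (\sum_(p < n)
      ((s p)%:E * ((u x * tent (c p.+1) (r p.+1) x)%:E
                   - (u x * tent (c p) (r p) x)%:E)))%E)%E.
    apply: eq_integral => x _; rewrite dphiE /dphi mulr_sumr -sumEFin.
    by apply: eq_bigr => p _; rewrite -EFinB -EFinM; congr (_%:E); lra.
  rewrite (@integral_sum _ _ _ mu _ (measurable_dom T) _ (fun (p : 'I_n) x =>
    ((s p)%:E * ((u x * tent (c p.+1) (r p.+1) x)%:E
                   - (u x * tent (c p) (r p) x)%:E))%E)) => [|p]; last first.
    apply: integrableZl; first exact: measurable_dom.
    by apply: integrableB; [exact: measurable_dom|exact: iy|apply: iy; exact: ltnW].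
    rewrite -sumEFin; apply: eq_bigr => p _.
    rewrite integralZl; [|exact: measurable_dom|]; last first.
      by apply: integrableB; [exact: measurable_dom|exact: iy|apply: iy; exact: ltnW].
    rewrite integralB_EFin; [|exact: measurable_dom|exact: iy|by apply: iy; exact: ltnW].
    rewrite EFinM EFinB /y /Rintegral !fineK //.
      by apply: integrable_fin_num; [exact: measurable_dom|apply: iy; exact: ltnW].
    by apply: integrable_fin_num; [exact: measurable_dom|exact: iy].
have left p : (p <= n)%N -> c 0%N - r 0%N <= c p - r p.
  elim: p => // p IH pn; apply: le_trans (IH (ltnW pn)) _.
  by have := ordered _ pn; have := r0 _ (ltnW pn); lra.
have right p : (p <= n)%N -> c (n - p)%N + r (n - p)%N <= c n + r n.
  elim: p => [_|p IH pn]; first by rewrite subn0.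
  apply: le_trans (IH (ltnW pn)).
  have := ordered (n - p.+1)%N; rewrite -subSn// subSS => /(_ ltac:(lia)).
  by have := r0 (n - p)%N (leq_subr _ _); lra.
have {}right p : (p <= n)%N -> c p + r p <= c n + r n.
  by move=> pn; rewrite -(subKn pn); apply: right; exact: leq_subr.
have tphi : test_function T phi.
  split.
  - by move=> x; have [] := Dphi x.
  - rewrite dphiE (_ : dphi = \sum_(p < n) (fun t =>
       s p * (tent (c p.+1) (r p.+1) t - tent (c p) (r p) t))); last first.
      by apply/funext => t; rewrite fct_sumE.
    apply: (big_ind (fun f : R -> R => continuous f)) => [x|f g cf cg x|p _ x].
    + exact: cvg_cst.
    + by apply: cvgD; [exact: cf|exact: cg].
    + by apply: cvgM; [exact: cvg_cst|apply: cvgB; exact: continuous_tent].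
  - have [_ _ [c0 _] _] := hcr 0%N (leq0n n); have [_ _ [_ cn] _] := hcr n (leqnn n).
    exists [set` `[c 0%N - r 0%N, c n + r n]]; split.
    + exact: segment_compact.
    + move=> t; rewrite /dom /= !in_itv /= => /andP[h1 h2].
      by rewrite (lt_le_trans c0 h1) (le_lt_trans h2 cn).
    + move=> t; rewrite /= in_itv /= => /negP; rewrite negb_and -!ltNge => h.
      rewrite phiE big1// => p _; have p0 := r0 _ (ltn_ord p).
      have p1 := r0 _ (ltnW (ltn_ord p)).
      have [l1 l2] := (left _ (ltn_ord p), left _ (ltnW (ltn_ord p))).
      have [r1 r2] := (right _ (ltn_ord p), right _ (ltnW (ltn_ord p))).
      case/orP: h => h.
        by rewrite !rise_left ?subrr ?mulr0//; lra.
      by rewrite !rise_right ?subrr ?mulr0//; lra.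
  (* The rises decrease pointwise in [p], so the absolute values telescope to the first rise minus
     the last, which is at most 1. *)
  - move=> t; rewrite phiE; apply: le_trans (ler_norm_sum _ _ _) _.
    apply: (@le_trans _ _ (\sum_(p < n) (rise (c p) (r p) t - rise (c p.+1) (r p.+1) t))).
      apply: ler_sum => p _; rewrite normrM.
      have rr : rise (c p.+1) (r p.+1) t <= rise (c p) (r p) t.
        by apply: rise_anti; [apply: r0; exact: ltnW|exact: r0|exact: ordered].
      rewrite distrC (ger0_norm (x := _ - _)) ?subr_ge0//.
      by rewrite ler_piMl ?subr_ge0// normr_sg lern1 leq_b1.
    rewrite -(big_mkord xpredT (fun p => rise (c p) (r p) t - rise (c p.+1) (r p.+1) t)).
    under eq_bigr do rewrite -opprB.
    rewrite sumrN telescope_sumr// opprB.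
    have /andP[_ ?] := rise_itv (c 0%N) t (r0 _ (leq0n n)).
    have /andP[? _] := rise_itv (c n) t (r0 _ (leqnn n)).
    lra.
have : \sum_(p < n) s p * (y p.+1 - y p) <= sigma.
  rewrite -lee_fin -iphi; apply: le_trans bu.
  by apply: ereal_sup_ubound; exists phi.
move=> hy; apply: (@le_trans _ _ (\sum_(p < n) s p * (y p.+1 - y p) + n%:R * (2 * e'))).
  rewrite mulr_natl -[n in _ *+ n]card_ord -sumr_const -big_split/=.
  apply: ler_sum => p _; rewrite -[X in X <= _]mulr1.
  rewrite normrEsg mulr1 -/(s p) -lerBlDl -mulrBr.
  apply: le_trans (ler_norm _) _; rewrite normrM.
  have s1 : `|s p| <= 1 by rewrite normr_sg lern1 leq_b1.
  apply: le_trans (ler_wpM2r (normr_ge0 _) s1) _; rewrite mul1r.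
  have := yz _ (ltn_ord p); have := yz _ (ltnW (ltn_ord p)).
  by rewrite !ler_norml => /andP[? ?] /andP[? ?]; apply/andP; split; lra.
lra.
Qed.

End variation_lower_bound.

(** * Tent averages at Lebesgue points and at right limits *)

Section local_averages.
Context {R : realType}.
Implicit Types (T t b c r : R) (u : R -> R).
Local Notation mu := (@lebesgue_measure R).

Lemma lebesgue_aeS (P Q : R -> Prop) : (forall x, P x -> Q x) ->
  {ae mu, forall x, P x} -> {ae mu, forall x, Q x}.
Proof. by move=> PQ; apply: (@filterS _ _ (ae_filter_ringOfSetsType mu)). Qed.

Lemma lebesgue_aeI (P Q : R -> Prop) : {ae mu, forall x, P x} ->
  {ae mu, forall x, Q x} -> {ae mu, forall x, P x /\ Q x}.
Proof. by move=> hP hQ; apply: (@filterI _ _ (ae_filter_ringOfSetsType mu)). Qed.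

Lemma measure_dom_lty T : (mu (dom T) < +oo)%E.
Proof.
by rewrite /dom lebesgue_measure_itv /=; case: ifP => _ //; rewrite -EFinB ltry.
Qed.

Lemma bounded_integrable_dom T (f : R -> R) (M : R) : measurable_fun (dom T) f ->
  (forall x, dom T x -> `|f x| <= M) -> mu.-integrable (dom T) (EFin \o f).
Proof.
move=> mf fM; apply: measurable_bounded_integrable => //.
- exact: measurable_dom.
- exact: measure_dom_lty.
- exists M; split; first exact: num_real.
  by move=> y My x xT /=; apply: le_trans (fM _ xT) (ltW My).
Qed.

Lemma integrable_tent T c r : mu.-integrable (dom T) (EFin \o tent c r).
Proof.
have i1 : mu.-integrable (dom T) (EFin \o cst 1).
  by apply: (@bounded_integrable_dom _ _ 1) => // x _; rewrite normr1.
have := integrableM_continuous (@continuous_tent _ c r) i1.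
by under eq_fun do rewrite /= mul1r.
Qed.

Lemma tent_average_dist T u b c r : mu.-integrable (dom T) (EFin \o u) ->
  0 < r -> 0 < c - r -> c + r < T ->
  (`|\int[mu]_(x in dom T) (u x * tent c r x) - b|%:E <=
   \int[mu]_(x in dom T) (`|u x - b| * tent c r x)%:E)%E.
Proof.
move=> iu r0 cr crT.
have mD := measurable_dom T.
have it := integrable_tent T c r.
have iut := integrableM_continuous (@continuous_tent _ c r) iu.
have ib : mu.-integrable (dom T) (fun x => (b * tent c r x)%:E).
  exact: (@integrableZl _ _ _ mu _ mD b _ it).
have hb : \int[mu]_(x in dom T) (b * tent c r x) = b.
  by rewrite RintegralZl// integral_tent// mulr1.
rewrite -{1}hb -RintegralB//.
have iD : mu.-integrable (dom T) (EFin \o (fun x => u x * tent c r x - b * tent c r x)).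
  exact: (@integrableB _ _ _ mu _ mD _ _ iut ib).
apply: (@le_trans _ _ (\int[mu]_(x in dom T) `|u x * tent c r x - b * tent c r x|%:E)%E).
  rewrite EFin_normr_Rintegral//; apply: le_abse_integral => //.
  exact: measurable_int iD.
rewrite le_eqVlt; apply/orP; left; apply/eqP; apply: eq_integral => x _.
by rewrite -mulrBl normrM (ger0_norm (tent_ge0 _ _ r0)).
Qed.

Lemma measurable_tent_dist T u b c r : measurable_fun (dom T) u ->
  measurable_fun (dom T) (fun x => (`|u x - b| * tent c r x)%:E).
Proof.
move=> mu_; apply/measurable_EFinP; apply: measurable_funM.
  by apply: measurableT_comp => //; exact: measurable_funB.
by apply: measurable_funTS; apply: continuous_measurable_fun; exact: continuous_tent.
Qed.

(** A tent of radius [r] is at most [r^-1] on a ball of measure [2 * r], so its average deviates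
    from [u t] by at most twice [davg]; hence the [e / 2] in the choice of [r]. *)
Lemma approximates_lebesgue_pt T u t : mu.-integrable (dom T) (EFin \o u) ->
  dom T t -> lebesgue_pt (u \_ (dom T)) t -> approximates T u t (u t).
Proof.
move=> iu Tt ut e e0; have mD := measurable_dom T.
have mu_ : measurable_fun (dom T) u by apply/measurable_EFinP; exact: measurable_int iu.
move: (Tt); rewrite /dom /= in_itv /= => /andP[t0 tT].
have : \forall r \near (0:R)^'+, [/\ 0 < r, r < t, r < T - t, r < e &
    (davg (u \_ (dom T)) t r <= (e / 2)%:E)%E].
  near=> r; split.
  - by near: r; exact: nbhs_right_gt.
  - by near: r; exact: nbhs_right_lt.
  - by near: r; apply: nbhs_right_lt; rewrite subr_gt0.
  - by near: r; exact: nbhs_right_lt.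
  - near: r; move/fine_cvgP : ut => [fr /cvgrPdist_le /(_ (e / 2))].
    rewrite divr_gt0// => /(_ isT) cv; near=> r.
    rewrite -[leLHS]fineK; last by near: r; exact: fr.
    have : `|0 - fine (davg (u \_ (dom T)) t r)| <= e / 2 by near: r; exact: cv.
    by rewrite sub0r normrN lee_fin; apply: le_trans; exact: ler_norm.
move=> /filter_ex [r [r0 rt rT re rd]].
exists t, r; split=> //; [split; lra|split; lra|].
rewrite -lee_fin; apply: le_trans (tent_average_dist _ iu r0 _ _) _; [lra..|].
have sub : ball t r `<=` dom T.
  move=> x; rewrite /ball /= /dom /= in_itv /= ltr_distlC => /andP[? ?].
  by apply/andP; split; lra.
have mB : measurable (ball t r) by exact: measurable_ball.
have -> : (\int[mu]_(x in dom T) (`|u x - u t| * tent t r x)%:E =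
   \int[mu]_(x in ball t r) (`|u x - u t| * tent t r x)%:E)%E.
  rewrite -[in RHS](setIidr sub) integral_mkcondr; apply: eq_integral => x _.
  rewrite patchE; case: ifPn => // /negP xB; rewrite tent_out ?mulr0//.
  have [h|h] := leP x (t - r); first by left.
  right; rewrite leNgt; apply/negP => h2; apply: xB.
  by rewrite inE /ball /= ltr_distlC; apply/andP.
move: rd; rewrite /davg /iavg.
have -> : (mu (ball t r))^-1%E = (2^-1 * r^-1)%:E.
  rewrite lebesgue_measure_ball ?(ltW r0)// inver gt_eqF ?mulrn_wgt0//.
  by rewrite -[r *+ 2]mulr_natl invfM.
rewrite -lee_pdivlMl ?mulr_gt0 ?invr_gt0// => rd.
apply: (@le_trans _ _ ((r^-1)%:E * \int[mu]_(y in ball t r)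
   `|((center ((u \_ (dom T)) t) \o u \_ (dom T)) y)%:E|)%E); last first.
  rewrite -lee_pdivlMl ?invr_gt0//; apply: le_trans rd _.
  by rewrite -!EFinM lee_fin !invrK !invfM !invrK; lra.
have mg : measurable_fun (ball t r) (fun y : R =>
    `|((center ((u \_ (dom T)) t) \o u \_ (dom T)) y)%:E|%E).
  apply: measurableT_comp => //; apply/measurable_EFinP.
  apply: measurable_funTS; apply: measurable_funD => //.
  by apply/(measurable_restrictT _ _).1.
have mkg : measurable_fun (ball t r) (fun y : R =>
    (r^-1)%:E * `|((center ((u \_ (dom T)) t) \o u \_ (dom T)) y)%:E|)%E.
  exact: measurable_funeM.
rewrite -ge0_integralZl//; last by rewrite lee_fin invr_ge0 ltW.
apply: ge0_le_integral => //.
- by move=> x _; rewrite lee_fin mulr_ge0 ?tent_ge0.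
- exact: measurable_funS (measurable_tent_dist _ _ _ mu_).
- move=> x Bx; rewrite /= -EFinM lee_fin mulrC.
  have -> : (u \_ (dom T)) x = u x by rewrite patchE mem_set//; exact: sub.
  have -> : (u \_ (dom T)) t = u t by rewrite patchE mem_set.
  by apply: ler_wpM2r => //; exact: tent_le.
Unshelve. all: by end_near. Qed.

Lemma approximates_right_lim T u uh t b : mu.-integrable (dom T) (EFin \o u) ->
  0 <= t < T -> {ae mu, forall x, dom T x -> uh x = u x} ->
  uh x @[x --> t^'+] --> b -> approximates T u t b.
Proof.
move=> iu /andP[t0 tT] uhu uhb e e0; have mD := measurable_dom T.
have mu_ : measurable_fun (dom T) u by apply/measurable_EFinP; exact: measurable_int iu.
have [d [d0 dT de hd]] : exists d, [/\ 0 < d, d <= T - t, d <= e &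
    forall x, t < x -> x < t + d -> `|uh x - b| <= e].
  have [d /= d0 hd] := cvgr_distC_le _ _ uhb _ e0.
  exists (Num.min d (Num.min (T - t) e)); split.
  - by rewrite !lt_min d0 subr_gt0 tT e0.
  - by rewrite !ge_min lexx !orbT.
  - by rewrite !ge_min lexx !orbT.
  - move=> x tx; rewrite -ltrBlDl !lt_min => /andP[xd _]; apply: hd => //=.
    by rewrite ltr0_norm ?opprB// subr_lt0.
(* The support, from [t + d / 4] to [t + 3 * d / 4], lies strictly to the right of [t], where [uh]
   is within [e] of [b]. *)
pose r := d / 4; pose c := t + d / 2.
have r0 : 0 < r by rewrite divr_gt0.
have h1 : t < c - r by rewrite /c /r; lra.
have h2 : c + r < t + d by rewrite /c /r; lra.
exists c, r; split=> //; [split; lra|split; lra|].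
rewrite -lee_fin; apply: le_trans (tent_average_dist _ iu r0 _ _) _; [lra..|].
have it := integrable_tent T c r.
have -> : e%:E = (\int[mu]_(x in dom T) (e%:E * (tent c r x)%:E))%E.
  rewrite (@integralZl _ _ _ mu _ mD _ it) -[X in (_ * X)%E]fineK.
    have := integral_tent r0 (_ : 0 < c - r) (_ : c + r < T).
    by rewrite /Rintegral => ->; [rewrite mule1|lra|lra].
  exact: (@integrable_fin_num _ _ _ mu _ mD _ it).
apply: ae_ge0_le_integral => //.
- by move=> x _; rewrite lee_fin mulr_ge0 ?tent_ge0.
- exact: measurable_tent_dist.
- by move=> x _; rewrite mule_ge0 ?lee_fin ?tent_ge0 ?ltW.
- by apply: measurable_funeM; exact: measurable_int it.
- apply: lebesgue_aeS uhu => x /= hx xT; rewrite -hx// -EFinM lee_fin.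
  have [/andP[l1 l2]|] := boolP ((c - r < x) && (x < c + r)).
    by apply: ler_wpM2r; [exact: tent_ge0|apply: hd; lra].
  by rewrite negb_and -!leNgt => /orP h; rewrite tent_out ?mulr0.
Qed.

End local_averages.

(** * Points whose value is at least the average *)

Section essential_values.
Context {R : realType}.
Implicit Types (T lo hi : R) (f : R -> R).
Local Notation mu := (@lebesgue_measure R).

Definition average lo hi f : R := (hi - lo)^-1 * \int[mu]_(t in `]lo, hi[) f t.

Lemma integrable_sub_dom T lo hi f : `]lo, hi[ `<=` dom T ->
  mu.-integrable (dom T) (EFin \o f) -> mu.-integrable `]lo, hi[ (EFin \o f).
Proof. by move=> sub; apply: integrableS => //; exact: measurable_dom. Qed.

Lemma lebesgue_measure_oo lo hi : lo < hi ->
  mu `]lo, hi[%classic = (hi - lo)%:E.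
Proof. by move=> lh; rewrite lebesgue_measure_itv /= lte_fin lh -EFinD. Qed.

Lemma ae_average_le lo hi f (m : R) : lo < hi ->
  mu.-integrable `]lo, hi[ (EFin \o f) ->
  {ae mu, forall t, `]lo, hi[%classic t -> f t <= m} -> average lo hi f <= m.
Proof.
move=> lh jf fm.
have mf : measurable_fun `]lo, hi[ f by apply/measurable_EFinP; exact: measurable_int jf.
have im : mu.-integrable `]lo, hi[ (EFin \o cst m).
  apply: measurable_bounded_integrable => //.
    by rewrite [X in (X < _)%E](lebesgue_measure_oo lh) ltry.
  exists `|m|; split; first exact: num_real.
  by move=> y my t _; exact: ltW.
rewrite /average ler_pdivrMl ?subr_gt0//.
have -> : (hi - lo) * m = \int[mu]_(t in `]lo, hi[) (cst m t).
  by rewrite Rintegral_cst// [X in fine X](lebesgue_measure_oo lh) mulrC.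
rewrite -subr_ge0 -RintegralB//.
(* Passing to the absolute value, which changes the integrand only on a null set, makes it
   nonnegative everywhere. *)
rewrite (_ : Rintegral _ _ _ = \int[mu]_(t in `]lo, hi[) `|m - f t|).
  by apply: Rintegral_ge0 => t _.
congr fine; apply: ae_eq_integral => //.
- by apply/measurable_EFinP; exact: measurable_funB.
- apply/measurable_EFinP; apply: measurableT_comp => //; exact: measurable_funB.
- by apply: lebesgue_aeS fm => t ft lt; rewrite /= ger0_norm// subr_ge0 ft.
Qed.

Lemma ae_exists_itv lo hi (G : R -> Prop) : lo < hi -> {ae mu, forall t, G t} ->
  exists t, `]lo, hi[%classic t /\ G t.
Proof.
move=> lh [N [mN N0 sub]]; apply: contrapT => /forallNP no.
have IN : `]lo, hi[%classic `<=` N.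
  by move=> t It; apply: sub => Gt; apply: (no t).
have : (mu `]lo, hi[ <= mu N)%E by apply: le_measure => //; rewrite inE.
rewrite N0 lebesgue_measure_oo// lee_fin.
lra.
Qed.

(** With only two values on the good points there is a dichotomy: either the larger value is taken
    at a good point and dominates the average, or [f] equals the smaller value almost everywhere and
    any good point will do. *)
Lemma exists_ge_average lo hi f (G : R -> Prop) (c d : R) : lo < hi -> c <= d ->
  mu.-integrable `]lo, hi[ (EFin \o f) -> {ae mu, forall t, G t} ->
  (forall t, `]lo, hi[%classic t -> G t -> f t = c \/ f t = d) ->
  exists t, [/\ `]lo, hi[%classic t, G t & average lo hi f <= f t].
Proof.
move=> lh cd jf aG Gf.
have [[t [It Gt fd]]|no] := pselect (exists t, [/\ `]lo, hi[%classic t, G t & f t = d]).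
  exists t; split=> //; rewrite fd; apply: ae_average_le => //.
  by apply: lebesgue_aeS aG => y Gy Iy; case: (Gf y Iy Gy) => ->.
have Gc y : `]lo, hi[%classic y -> G y -> f y = c.
  by move=> Iy Gy; case: (Gf y Iy Gy) => // fy; case: no; exists y.
have [t [It Gt]] := ae_exists_itv lh aG.
exists t; split=> //; rewrite Gc//; apply: ae_average_le => //.
by apply: lebesgue_aeS aG => y Gy Iy; rewrite Gc.
Qed.

End essential_values.

(** * The order of the items *)

Notation item x := 'I_((nint x + nfix x)%N).

Section order.
Context (x : instance).
Local Notation item := (item x).

Definition key (i : item) : rat :=
  match fintype.split i with inl k => lo x k | inr j => tau x j end.

Definition fixing (i : item) : bool := (nint x <= i)%N.

(** Intervals are sorted by their left ends. Among distinct items of a valid instance only a fixing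
    and an interval starting there can tie. The fixing goes first: interior points of the interval
    lie to its right, and the jump into the interval can be delayed. *)
Definition before (j i : item) : bool :=
  (key j < key i) || [&& key j == key i, fixing j & ~~ fixing i].

(** Counting predecessors replaces sorting; the program can recompute a rank by a loop without
    storing a permutation. *)
Definition rank (i : item) : nat := (\sum_j before j i)%N.

Lemma before_irr i : before i i = false.
Proof. by rewrite /before ltxx eqxx; case: fixing. Qed.

Lemma before_trans : transitive before.
Proof.
move=> j i k; rewrite /before => /orP[ij|/and3P[/eqP ij fi fj]] /orP[jk|/and3P[/eqP jk fj' fk]].
- by rewrite (lt_trans ij jk).
- by rewrite -jk ij.
- by rewrite ij jk.
- by rewrite fj' in fj.
Qed.

(** Isolated as a hypothesis so that the combinatorial sections do not mention the real field or
    [T]. *)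
Definition before_total := forall i j, i != j -> before i j || before j i.

Lemma before_rank i j : before i j -> (rank i < rank j)%N.
Proof.
move=> ij; rewrite /rank (bigD1 i) //= before_irr add0n [X in (_ < X)%N](bigD1 i)//= ij.
rewrite add1n ltnS; apply: leq_sum => k _.
by have [ki|//] := boolP (before k i); rewrite (before_trans ki ij).
Qed.

Context (total : before_total).

Lemma rankP i j : before i j = (rank i < rank j)%N.
Proof.
apply/idP/idP; first exact: before_rank.
apply: contraTT => nij; rewrite -leqNgt.
have [->//|/total] := eqVneq i j.
by rewrite (negPf nij)/= => /before_rank/ltnW.
Qed.

Lemma rank_inj : injective rank.
Proof.
by move=> i j r; apply/eqP; apply: contraT => /total; rewrite !rankP r ltnn.
Qed.

Lemma rank_lt i : (rank i < nint x + nfix x)%N.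
Proof.
rewrite /rank (bigD1 i) //= before_irr add0n.
apply: (@leq_ltn_trans (\sum_(j | j != i) 1)%N).
  by apply: leq_sum => j _; case: before.
rewrite sum1_card; have := cardC1 i; rewrite card_ord => ->.
by rewrite ltn_predL; exact: leq_ltn_trans (ltn_ord i).
Qed.

Definition nth_item (i0 : item) (p : nat) : item := odflt i0 [pick i | rank i == p].

Lemma rankK i0 i : nth_item i0 (rank i) = i.
Proof.
rewrite /nth_item; case: pickP => [j /eqP/rank_inj//|/(_ i)].
by rewrite eqxx.
Qed.

Lemma nth_itemK i0 p : (p < nint x + nfix x)%N -> rank (nth_item i0 p) = p.
Proof.
move=> pL; rewrite /nth_item; case: pickP => [i /eqP//|no] /=.
pose f (i : item) := Ordinal (rank_lt i).
have finj : injective f by move=> i j /(congr1 val)/rank_inj.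
have /codomP[i /(congr1 val)/= fi] : Ordinal pL \in codom f.
  by rewrite (injF_onto finj).
by have := no i; rewrite -fi eqxx.
Qed.

Lemma nth_item_before i0 p : (p.+1 < nint x + nfix x)%N ->
  before (nth_item i0 p) (nth_item i0 p.+1).
Proof. by move=> pL; rewrite rankP !nth_itemK// ltnW. Qed.

Lemma sum_nth_item (V : nmodType) (i0 : item) (F : item -> V) :
  \sum_i F i = \sum_(p < (nint x + nfix x)%N) F (nth_item i0 p).
Proof.
rewrite (reindex_onto (fun p : 'I_((nint x + nfix x)%N) => nth_item i0 p)
   (fun i => Ordinal (rank_lt i))) /=.
  by apply: eq_bigl => p; apply/eqP/val_inj => /=; rewrite nth_itemK.
by move=> i _; rewrite rankK.
Qed.

Lemma sum_nth_item_eq (V : nmodType) (n : nat) (i0 : item) (F : item -> V) :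
  (nint x + nfix x)%N = n -> \sum_i F i = \sum_(p < n) F (nth_item i0 p).
Proof. by move=> Ln; rewrite (sum_nth_item i0); case: _ / Ln. Qed.

(** Summing over pairs of consecutive ranks requires no default item, so that the definition also
    covers an instance without items. *)
Definition switches (z : item -> bool) : nat :=
  (\sum_i \sum_(k | rank k == (rank i).+1) (z i != z k))%N.

Lemma sum_consecutive (V : nmodType) (n : nat) (i0 : item) (F : item -> item -> V) :
  (nint x + nfix x)%N = n.+1 ->
  \sum_i \sum_(k | rank k == (rank i).+1) F i k =
  \sum_(p < n) F (nth_item i0 p) (nth_item i0 p.+1).
Proof.
move=> Ln; rewrite (sum_nth_item_eq i0 _ Ln) big_ord_recr /= [X in _ + X]big1 ?addr0; last first.
  move=> k; rewrite nth_itemK ?Ln// => /eqP rk.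
  by have := rank_lt k; rewrite rk Ln ltnn.
apply: eq_bigr => p _; rewrite (big_pred1 (nth_item i0 p.+1)) // => k /=.
rewrite nth_itemK ?Ln ?(leqW (ltn_ord p))//; apply/eqP/eqP => [<-|->].
  by rewrite rankK.
by rewrite nth_itemK// Ln ltnS.
Qed.

End order.

(** * Positions of the endpoints and fixings of a valid instance *)

Section validity.
Context {R : realType} (T : R) (x : instance) (vx : @valid R T x).

Lemma avg_intervalP (i : 'I_(nint x)) (t : R) :
  avg_interval x i t <-> ratr (lo x i) < t < ratr (hi x i).
Proof. by rewrite /avg_interval /= in_itv. Qed.

Lemma lo_lt_hi i : lo x i < hi x i.
Proof.
case: vx => _ [_ _ /(_ i)[[t /avg_intervalP/andP[lt th]] _] _ _].
by rewrite -(ltr_rat R); exact: lt_trans th.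
Qed.

(** Otherwise the midpoint of [lo x i] and the smaller of [hi x i] and 0 would be a negative point
    of the interval. [hi_leT] and [intervals_ordered] use midpoints in the same way. *)
Lemma lo_ge0 i : 0 <= ratr (lo x i) :> R.
Proof.
case: vx => _ [_ _ /(_ i)[_ sub] _ _]; have := lo_lt_hi i.
rewrite -(ltr_rat R) => lh; rewrite leNgt; apply/negP => l0.
pose m : R := Num.min (ratr (hi x i)) 0.
have lm : ratr (lo x i) < m by rewrite lt_min lh l0.
have mh : m <= ratr (hi x i) by rewrite ge_min lexx.
have m0 : m <= 0 by rewrite ge_min lexx orbT.
have : dom T ((ratr (lo x i) + m) / 2).
  by apply: sub; apply/avg_intervalP; apply/andP; split; lra.
rewrite /dom /= in_itv /= => /andP[+ _]; lra.
Qed.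

Lemma hi_leT i : ratr (hi x i) <= T.
Proof.
case: vx => _ [_ _ /(_ i)[_ sub] _ _]; have := lo_lt_hi i.
rewrite -(ltr_rat R) => lh; rewrite leNgt; apply/negP => l0.
pose m : R := Num.max (ratr (lo x i)) T.
have lm : m < ratr (hi x i) by rewrite gt_max lh l0.
have mh : ratr (lo x i) <= m by rewrite le_max lexx.
have m0 : T <= m by rewrite le_max lexx orbT.
have : dom T ((ratr (hi x i) + m) / 2).
  by apply: sub; apply/avg_intervalP; apply/andP; split; lra.
rewrite /dom /= in_itv /= => /andP[_]; lra.
Qed.

Lemma avg_interval_dom i : @avg_interval R x i `<=` dom T.
Proof. by case: vx => _ [_ _ /(_ i)[_ ?] _ _]. Qed.

Lemma intervals_ordered i k : i != k -> (hi x i <= lo x k) || (hi x k <= lo x i).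
Proof.
case: vx => _ [_ _ _ disj _] /disj dik; apply: contraT.
rewrite negb_or -!ltNge -!(ltr_rat R) => /andP[h1 h2].
have := lo_lt_hi i; have := lo_lt_hi k; rewrite -!(ltr_rat R) => h3 h4.
pose a : R := Num.max (ratr (lo x i)) (ratr (lo x k)).
pose b : R := Num.min (ratr (hi x i)) (ratr (hi x k)).
have ab : a < b by rewrite gt_max !lt_min h1 h2 h3 h4.
have [a1 a2] : ratr (lo x i) <= a /\ ratr (lo x k) <= a by rewrite !le_max !lexx orbT.
have [b1 b2] : b <= ratr (hi x i) /\ b <= ratr (hi x k) by rewrite !ge_min !lexx orbT.
have : (@avg_interval R x i `&` avg_interval x k) ((a + b) / 2).
  by split; apply/avg_intervalP; apply/andP; split; lra.
by rewrite dik.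
Qed.

Lemma fixing_outside i j : (tau x j <= lo x i) || (hi x i <= tau x j).
Proof.
case: vx => _ [_ _ _ _ /(_ i j)]; apply: contra_notT.
by rewrite negb_or -!ltNge => /andP[h1 h2]; apply/avg_intervalP; rewrite !ltr_rat h1 h2.
Qed.

Lemma tau_itv j : 0 <= (ratr (tau x j) : R) < T.
Proof. by case: vx => _ []. Qed.

Lemma tau_inj j k : tau x j = tau x k -> j = k.
Proof.
case: vx => _ [_ mono _ _ _] e; apply: val_inj; apply/eqP.
rewrite eqn_leq; apply/andP; split; rewrite leqNgt; apply/negP => /mono.
  by rewrite e ltxx.
by rewrite e ltxx.
Qed.

Lemma fixing_split (i : item x) :
  fixing i = if fintype.split i is inr _ then true else false.
Proof. by rewrite /fixing; case: splitP => [j ->|k ->]; [rewrite leqNgt ltn_ord|rewrite leq_addr]. Qed.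

Lemma before_total_valid : before_total x.
Proof.
move=> i j ij; rewrite /before !fixing_split /key.
have : fintype.split i != fintype.split j.
  by apply: contraNneq ij => /(congr1 unsplit); rewrite !splitK => ->.
case: (fintype.split i) => i'; case: (fintype.split j) => j' ne.
- have {}ne : i' != j' by apply: contraNneq ne => ->.
  have := lo_lt_hi i'; have := lo_lt_hi j'.
  by have /orP[h|h] := intervals_ordered ne => h1 h2;
    rewrite ?(le_lt_trans h h1) ?(lt_le_trans h1 h) ?(lt_le_trans h2 h) ?orbT.
- by case: ltgtP.
- by case: ltgtP.
- have {}ne : i' != j' by apply: contraNneq ne => ->.
  by case: ltgtP => // /tau_inj e; rewrite e eqxx in ne.
Qed.

End validity.

(** * Averages of functions in [D_SP] and of their limits *)

Definition max_switches (x : instance) : nat := `|(numq (sigma x) %/ denq (sigma x))%Z|%N.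

Definition admissible (x : instance) (z : item x -> bool) : Prop :=
  (forall j, z (rshift _ j) = fixval x j) /\ (switches z <= max_switches x)%N.

Lemma max_switchesP (x : instance) (n : nat) : 0 <= sigma x ->
  (n <= max_switches x)%N = (n%:R <= sigma x).
Proof.
move=> s0; have n0 : 0 <= numq (sigma x) by rewrite numq_ge0.
have q0 : (0 <= numq (sigma x) %/ denq (sigma x))%Z by rewrite divz_ge0 ?denq_gt0.
rewrite -[X in _ <= X]divq_num_den ler_pdivlMr ?ltr0z ?denq_gt0//.
rewrite -[n%:R]/(n%:~R) -rmorphM ler_int.
rewrite -lez_nat /max_switches gez0_abs//.
rewrite {2}(divz_eq (numq (sigma x)) (denq (sigma x))).
have m0 := modz_ge0 (numq (sigma x)) (denq_neq0 (sigma x)).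
have m1 := ltz_pmod (numq (sigma x)) (denq_gt0 (sigma x)).
have d0 := denq_gt0 (sigma x).
apply/idP/idP => h; first nia.
rewrite -ltzD1; move: h m0 m1 d0; nia.
Qed.

Section upper.
Context {R : realType}.
Local Notation mu := (@lebesgue_measure R).

(** The sequence [z] depends on the functional [a]: the point chosen in an interval is one where
    [a i * u], not [u], is at least its average. Comparing one functional at a time is enough for a
    convex hull. *)
Lemma D_SP_bound (T : R) (x : instance) (u : R -> R) (a : 'I_(nint x) -> R) :
  valid T x ->
  D_SP T (ratr (sigma x)) (fun j => ratr (tau x j)) (fixval x) u ->
  exists2 z : item x -> bool, admissible z &
    \sum_i a i * average (ratr (lo x i)) (ratr (hi x i)) u
      <= \sum_i a i * (z (lshift _ i))%:R.
Proof.
move=> vx [[[iu uoo] u01 us] fixu].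
have [s0 _] := vx.
have gp : {ae mu, forall t, lebesgue_pt (u \_ (dom T)) t /\
    (dom T t -> u t = 0 \/ u t = 1)}.
  apply: lebesgue_aeI => //; apply: lebesgue_differentiation.
  by apply: integrable_locally => //; exact: measurable_dom.
have /choice[t ht] (i : 'I_(nint x)) : exists t, [/\ avg_interval x i t,
    lebesgue_pt (u \_ (dom T)) t, u t = 0 \/ u t = 1 &
    a i * average (ratr (lo x i)) (ratr (hi x i)) u <= a i * u t].
  have lh : ratr (lo x i) < ratr (hi x i) :> R by rewrite ltr_rat (lo_lt_hi vx).
  have sub := avg_interval_dom vx (i := i).
  have jf := integrable_sub_dom sub iu.
  (* The two values of [a i * u] are 0 and [a i], in an order that depends on the sign of [a i]. *)
  have cd : Num.min 0 (a i) <= Num.max 0 (a i) by rewrite ge_min le_max lexx.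
  have ja : mu.-integrable `]ratr (lo x i), ratr (hi x i)[ (EFin \o (fun t => a i * u t)).
    exact: (@integrableZl _ _ _ mu _ _ (a i) _ jf).
  have [|t [It [lt ut] le]] := exists_ge_average lh cd ja gp.
  - move=> t It [_ ut]; case: (ut (sub _ It)) => ->.
      by rewrite mulr0; case: leP => _; [left|right].
    by rewrite mulr1; case: leP => _; [right|left].
  - exists t; split=> //; first by apply: ut; exact: sub.
    move: le; rewrite /average RintegralZl//.
    by rewrite mulrCA.
pose base (i : item x) : R := match fintype.split i with inl k => t k | inr j => ratr (tau x j) end.
pose z (i : item x) : bool := match fintype.split i with inl k => u (t k) == 1 | inr j => fixval x j end.
have zl k : z (lshift _ k) = (u (t k) == 1) by rewrite /z (unsplitK (inl _ k)).
have zr j : z (rshift _ j) = fixval x j by rewrite /z (unsplitK (inr _ j)).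
exists z; last first.
  apply: ler_sum => i _; have [_ _ ut le] := ht i.
  apply: le_trans le _; rewrite zl.
  by case: ut => ->; rewrite ?eqxx// eq_sym oner_eq0.
split; first exact: zr.
rewrite max_switchesP ?(ltW s0)// -(ler_rat R) ratr_nat.
case Ln : (nint x + nfix x)%N => [|n].
  rewrite /switches big1 ?ler0q ?(ltW s0)// => i.
  by move: (leq_ltn_trans (leq0n i) (ltn_ord i)) => L0; exfalso; move: L0; rewrite Ln.
have i0 : item x by rewrite Ln; exact: ord0.
rewrite /switches (sum_consecutive (before_total_valid vx) i0 _ Ln).
rewrite natr_sum.
apply: le_trans (@TV_bound R T (ratr (sigma x)) u n (fun p => base (nth_item i0 p))
  (fun p => (z (nth_item i0 p))%:R) iu us _ _).
- apply: ler_sum => p _; case: (z _); case: (z _) => /=;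
    by rewrite ?subrr ?subr0 ?sub0r ?normrN ?normr0 ?normr1.
- move=> p _; move: (nth_item i0 p) => i {p}; rewrite /base /z.
  case: (fintype.split i) => [k|j].
    have [It lt ut _] := ht k.
    have -> : (u (t k) == 1)%:R = u (t k).
      by case: ut => ->; rewrite ?eqxx// eq_sym oner_eq0.
    by apply: approximates_lebesgue_pt => //; exact: avg_interval_dom It.
  have [uh [[uhu uhr] uhv]] := fixu j; have tj := tau_itv vx j.
  apply: (approximates_right_lim iu tj uhu).
  (* At 0 the condition already is a right limit; elsewhere right continuity turns the value of the
     representative into one. *)
  move: uhv; case: ifPn => [/eqP -> //|tj0 <-]; apply: uhr.
  by rewrite /dom /= in_itv /= lt_neqAle eq_sym tj0.
(* The test points increase strictly with the rank: a chosen point is interior to its interval,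
   hence beyond a fixing at the left end and before a fixing at the right end. *)
- move=> p pn; have := nth_item_before (before_total_valid vx) i0 (p := p).
  rewrite Ln ltnS pn => /(_ isT).
  move: (nth_item i0 p) (nth_item i0 p.+1) => i k.
  rewrite /before !fixing_split /base /key.
  case: (fintype.split i) => i'; case: (fintype.split k) => k'.
  + rewrite andbF orbF => lolo.
    have ne : i' != k' by apply: contraTneq lolo => ->; rewrite ltxx.
    have lh := lo_lt_hi vx k'.
    have : hi x i' <= lo x k'.
      by have /orP[//|h] := intervals_ordered vx ne; lra.
    rewrite -(ler_rat R) => h.
    have [/avg_intervalP/andP[h1 h2] _ _ _] := ht i'.
    have [/avg_intervalP/andP[h3 h4] _ _ _] := ht k'.
    by apply: lt_le_trans h2 _; apply: le_trans h _; exact: ltW.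
  + rewrite andbF orbF => lt.
    have /orP[h|h] := fixing_outside vx i' k'; first by move: (le_lt_trans h lt); rewrite ltxx.
    have [/avg_intervalP/andP[h1 h2] _ _ _] := ht i'.
    by apply: lt_le_trans h2 _; rewrite ler_rat.
  + move=> lt; have [/avg_intervalP/andP[h1 h2] _ _ _] := ht k'.
    apply: le_lt_trans h1; rewrite ler_rat.
    by case/orP: lt => [/ltW//|/andP[/eqP ->]].
  + by rewrite andbF orbF ltr_rat.
Qed.

End upper.

(** * Smallness in L^p implies smallness in L^1 *)

Section Lp_facts.
Context {R : realType}.
Implicit Types (T p : R) (f : R -> R).
Local Notation mu := (@lebesgue_measure R).

Lemma Lp_norm_pow T p f : p != 0 ->
  (Lp_norm T p f `^ p)%E = (\int[mu]_(x in dom T) (`|f x| `^ p)%:E)%E.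
Proof.
move=> p0; rewrite /Lp_norm poweR_Lnorm// [RHS]integral_mkcond.
apply: eq_integral => x _; rewrite !patchE; case: ifP => _.
  by [].
by rewrite abse0 poweR0r.
Qed.

Lemma Lp_norm_ge0 T p f : (0 <= Lp_norm T p f)%E.
Proof. exact: Lnorm_ge0. Qed.

Lemma measurable_pow_norm T p f : measurable_fun (dom T) f ->
  measurable_fun (dom T) (fun x => (`|f x| `^ p)%:E).
Proof.
move=> mf; apply/measurable_EFinP.
apply: (measurableT_comp (measurable_powR p)).
by apply: measurableT_comp.
Qed.

(** In place of the Hoelder inequality, [|y| <= dl + c * |y| ^ p] holds pointwise with
    [c = dl ^ (1 - p)], because [|y| / dl] is at most its [p]-th power once it exceeds 1. Integrated
    over (0, T), each of the two terms contributes at most [e / 2]. *)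
Lemma Lp_small_L1_small T p : 0 < T -> 1 <= p -> forall e : R, 0 < e ->
  exists2 d : R, 0 < d & forall f, measurable_fun (dom T) f ->
    (Lp_norm T p f < d%:E)%E -> (\int[mu]_(x in dom T) `|f x|%:E <= e%:E)%E.
Proof.
move=> T0 p1 e e0; have p0 : 0 < p by lra.
pose dl := e / (2 * T).
have dl0 : 0 < dl by rewrite divr_gt0 ?mulr_gt0.
pose c := dl * (dl^-1) `^ p.
have c0 : 0 < c by rewrite mulr_gt0 ?powR_gt0 ?invr_gt0.
have key (y : R) : `|y| <= dl + c * `|y| `^ p.
  have [yd|yd] := leP `|y| dl.
    by apply: le_trans yd _; rewrite lerDl mulr_ge0 ?powR_ge0 ?ltW.
  apply: (@le_trans _ _ (c * `|y| `^ p)); last by rewrite lerDr ltW.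
  rewrite /c -mulrA -powRM ?invr_ge0 ?(ltW dl0)// mulrC.
  rewrite -ler_pdivrMr//; apply: (@le_trans _ _ (dl^-1 * `|y|)).
    by rewrite mulrC.
  by apply: le1r_powR => //; rewrite mulrC ler_pdivlMr// mul1r ltW.
exists ((e / (2 * c)) `^ p^-1).
  by rewrite powR_gt0// divr_gt0// mulr_gt0.
move=> f mf Nf.
have ec0 : 0 <= e / (2 * c) by rewrite ltW// divr_gt0// mulr_gt0.
have Nle : (\int[mu]_(x in dom T) (`|f x| `^ p)%:E <= (e / (2 * c))%:E)%E.
  rewrite -Lp_norm_pow ?gt_eqF//.
  have -> : (e / (2 * c))%:E = (((e / (2 * c)) `^ p^-1)%:E `^ p)%E.
    by rewrite poweR_EFin -powRrM mulVf ?gt_eqF// powRr1.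
  apply: gt0_ler_poweR; rewrite ?ltW//= ?in_itv/= ?leey ?andbT ?Lp_norm_ge0//.
  by rewrite lee_fin powR_ge0.
apply: (@le_trans _ _ (\int[mu]_(x in dom T) (dl%:E + c%:E * (`|f x| `^ p)%:E))%E).
  apply: ge0_le_integral => //.
  - exact: measurable_dom.
  - by apply/measurable_EFinP; apply: measurableT_comp.
  - apply: emeasurable_funD => //; apply: measurable_funeM; exact: measurable_pow_norm.
  - by move=> x _; rewrite -EFinM -EFinD lee_fin.
rewrite ge0_integralD//=.
- rewrite integral_cst; last exact: measurable_dom.
  rewrite ge0_integralZl//.
  + rewrite [X in (_ * X + _)%E](lebesgue_measure_oo T0) subr0.
    apply: (@le_trans _ _ ((e / 2)%:E + c%:E * (e / (2 * c))%:E)%E).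
      apply: leeD; last by apply: lee_wpmul2l => //; rewrite lee_fin ltW.
      rewrite -EFinM lee_fin /dl invfM -!mulrA mulVf ?gt_eqF// mulr1.
      by lra.
    rewrite -EFinM -EFinD lee_fin invfM mulrCA [c * _]mulrCA divff ?gt_eqF// mulr1.
    lra.
  + exact: measurable_dom.
  + exact: measurable_pow_norm.
  + by rewrite lee_fin ltW.
- exact: measurable_dom.
- by move=> x _; rewrite lee_fin ltW.
- by move=> x _; rewrite -EFinM lee_fin mulr_ge0 ?powR_ge0 ?ltW.
- apply: measurable_funeM; exact: measurable_pow_norm.
Qed.

End Lp_facts.

Section hull_bound.
Context {R : realType}.
Implicit Types (T p : R).
Local Notation mu := (@lebesgue_measure R).

Lemma averageD (lo hi : R) (f g : R -> R) :
  mu.-integrable `]lo, hi[ (EFin \o f) -> mu.-integrable `]lo, hi[ (EFin \o g) ->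
  average lo hi (f \+ g) = average lo hi f + average lo hi g.
Proof. by move=> jf ig; rewrite /average RintegralD// mulrDr. Qed.

Lemma norm_average_le T (lo hi e : R) (f : R -> R) : lo < hi -> `]lo, hi[ `<=` dom T ->
  mu.-integrable (dom T) (EFin \o f) ->
  (\int[mu]_(x in dom T) `|f x|%:E <= e%:E)%E -> `|average lo hi f| <= (hi - lo)^-1 * e.
Proof.
move=> lh sub jf fe; have jf' := integrable_sub_dom sub jf.
rewrite /average normrM gtr0_norm ?invr_gt0 ?subr_gt0// ler_pM2l ?invr_gt0 ?subr_gt0//.
rewrite -lee_fin EFin_normr_Rintegral//.
apply: le_trans (le_abse_integral mu _ (measurable_int _ jf')) _ => //.
apply: le_trans fe; apply: ge0_subset_integral => //.
- exact: measurable_dom.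
- exact: (measurable_int _ (integrable_norm jf)).
Qed.

(** The bound for D_SP survives the closure because averages are continuous in L^1, and survives
    convex combinations by linearity. *)
Lemma C_SP_bound T p (x : instance) (a : 'rV[R]_(nint x)) (b : R) :
  0 < T -> 1 <= p -> valid T x ->
  (forall z : item x -> bool, admissible z ->
     \sum_i a 0 i * (z (lshift _ i))%:R <= b) ->
  forall w, C_SP T p x w -> dot a w <= b.
Proof.
move=> T0 p1 vx ab w [n [l [y [l0 l1 ySP ->]]]].
have ylb i : dot a (y i) <= b.
  have [v [mv _ vcl] <-] := ySP i; rewrite /dot.
  rewrite (_ : \sum_j _ = \sum_j a 0 j * average (ratr (lo x j)) (ratr (hi x j)) v); last first.
    by apply: eq_bigr => j _; rewrite mxE.
  apply/ler_addgt0Pr => e e0.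
  (* A Lipschitz constant of the functional with respect to the L^1 norm; dividing by [S + 1] below
     avoids the case [S = 0]. *)
  pose S : R := \sum_i `|a 0 i| * (ratr (hi x i) - ratr (lo x i))^-1.
  have S0 : 0 <= S.
    apply: sumr_ge0 => j _; rewrite mulr_ge0// invr_ge0 subr_ge0 ler_rat ltW//.
    exact: (lo_lt_hi vx).
  have [|d d0 hd] := Lp_small_L1_small T0 p1 (e := e / (S + 1)).
    by rewrite divr_gt0// ltr_wpDl.
  have [u uD vud] := vcl _ d0.
  have [z za zle] := D_SP_bound (fun j => a 0 j) vx uD.
  have [[[iu _] _ _] _] := uD.
  have mu_ : measurable_fun (dom T) u by apply/measurable_EFinP; exact: measurable_int iu.
  have mf : measurable_fun (dom T) (v \- u) by exact: measurable_funB.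
  have fe := hd _ mf vud.
  have jf : mu.-integrable (dom T) (EFin \o (v \- u)).
    apply/integrableP; split; first exact/measurable_EFinP.
    by apply: le_lt_trans fe _; rewrite ltry.
  apply: le_trans (_ : (\sum_j a 0 j * average (ratr (lo x j)) (ratr (hi x j)) u) + e <= _); last first.
    by rewrite lerD2r; apply: le_trans zle _; exact: ab.
  apply: (@le_trans _ _ (\sum_j (a 0 j * average (ratr (lo x j)) (ratr (hi x j)) u
     + `|a 0 j| * ((ratr (hi x j) - ratr (lo x j))^-1 * (e / (S + 1)))))).
    apply: ler_sum => j _.
    have sub := avg_interval_dom vx (i := j).
    have lh : ratr (lo x j) < ratr (hi x j) :> R by rewrite ltr_rat (lo_lt_hi vx).
    have h := norm_average_le lh sub jf fe.
    have -> : average (ratr (lo x j)) (ratr (hi x j)) v =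
        average (ratr (lo x j)) (ratr (hi x j)) u
        + average (ratr (lo x j)) (ratr (hi x j)) (v \- u).
      rewrite -averageD.
      - by congr average; apply/funext => t /=; rewrite addrC subrK.
      - exact: (integrable_sub_dom sub iu).
      - exact: (integrable_sub_dom sub jf).
    rewrite mulrDr lerD2l; apply: le_trans (ler_norm _) _.
    by rewrite normrM; apply: ler_wpM2l.
  rewrite big_split/= lerD2l.
  under eq_bigr do rewrite mulrA.
  rewrite -mulr_suml -/S mulrA ler_pdivrMr ?ltr_wpDl//.
  by rewrite mulrC ler_pM2l// lerDl.
rewrite /dot.
under eq_bigr do rewrite summxE mulr_sumr.
rewrite exchange_big /=.
apply: (@le_trans _ _ (\sum_i l i * b)).
  apply: ler_sum => i _; under eq_bigr do rewrite mxE mulrCA.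
  by rewrite -mulr_sumr; apply: ler_wpM2l => //; exact: ylb.
by rewrite -mulr_suml l1 mul1r.
Qed.

End hull_bound.

(** * Step functions: values, variation and dependence on the jump points *)

Section step_functions.
Context {R : realType}.
Implicit Types (T p t : R) (kappa zz : nat -> R).
Local Notation mu := (@lebesgue_measure R).

(** The scan starts at the last jump point, so that of several equal jump points the last one
    prevails. [kappa 0] is never consulted: the value [zz 0] extends to the left without bound. *)
Fixpoint step kappa zz (n : nat) t : R :=
  if n is m.+1 then (if kappa n <= t then zz n else step kappa zz m t) else zz 0%N.

Lemma step_eq kappa zz n m t : (m <= n)%N -> ((0 < m)%N -> kappa m <= t) ->
  (forall q, (m < q)%N -> (q <= n)%N -> t < kappa q) -> step kappa zz n t = zz m.
Proof.
elim: n => [|n IH]; first by rewrite leqn0 => /eqP ->.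
rewrite leq_eqVlt => /predU1P[-> /(_ isT) /= -> //|]; rewrite ltnS => mn km h /=.
rewrite leNgt h//= ?ltnS//; apply: IH => // q mq qn; apply: h => //.
exact: leqW.
Qed.

Lemma step_values kappa zz n t : exists2 m, (m <= n)%N & step kappa zz n t = zz m.
Proof.
elim: n => [|n [m mn e]] /=; first by exists 0%N.
by case: ifP => _; [exists n.+1|exists m => //; exact: leqW].
Qed.

Lemma measurable_step kappa zz n (A : set R) : measurable_fun A (step kappa zz n).
Proof.
apply: measurable_funTS; elim: n => [|n IH] /=; first exact: measurable_cst.
apply: measurable_fun_ifT => //.
exact: measurable_fun_ler.
Qed.

Lemma step_right_continuous kappa zz n t :
  step kappa zz n x @[x --> t^'+] --> step kappa zz n t.
Proof.
apply: cvg_near_cst; elim: n => [|n IH] /=; first exact: nearW.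
case: (leP (kappa n.+1) t) => kt.
  near=> x; rewrite ifT//; apply: le_trans kt _; apply: ltW.
  by near: x; exact: nbhs_right_gt.
near=> x; rewrite ifF; first by near: x; exact: IH.
apply/negbTE; rewrite -ltNge; near: x; exact: nbhs_right_lt.
Unshelve. all: by end_near. Qed.

(** The two functions can only differ at points that some jump has passed in one of them but not yet
    in the other. *)
Lemma step_dist kappa kappa' zz n t : (forall q, (q <= n)%N -> zz q = 0 \/ zz q = 1) ->
  (forall q, (q <= n)%N -> kappa q <= kappa' q) ->
  `|step kappa zz n t - step kappa' zz n t| <=
    \sum_(q < n) \1_(`[kappa q.+1, kappa' q.+1[%classic) t.
Proof.
elim: n => [|n IH] z01 kk /=; first by rewrite big_ord0 subrr normr0.
have IH' := IH (fun q h => z01 q (leqW h)) (fun q h => kk q (leqW h)).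
have s1 : `|step kappa zz n.+1 t - step kappa' zz n.+1 t| <= 1.
  have [m mn ->] := step_values kappa zz n.+1 t.
  have [m' mn' ->] := step_values kappa' zz n.+1 t.
  by case: (z01 _ mn) => ->; case: (z01 _ mn') => ->;
    rewrite ?subrr ?subr0 ?sub0r ?normrN ?normr0 ?normr1.
have S0 : 0 <= \sum_(q < n) \1_(`[kappa q.+1, kappa' q.+1[%classic) t :> R.
  by apply: sumr_ge0.
rewrite big_ord_recr /=.
have [k1|k1] := leP (kappa n.+1) t; have [k2|k2] := leP (kappa' n.+1) t.
- by rewrite subrr normr0 addr_ge0.
- have k2' : (kappa' n.+1 <= t) = false by rewrite leNgt k2.
  move: s1; rewrite /= k1 k2' => s1; apply: le_trans s1 _.
  by rewrite indicE mem_set ?lerDr//= in_itv /= k1 k2.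
- by have := kk _ (leqnn n.+1); have := le_lt_trans k2 k1; rewrite ltNge => /negP.
- by apply: le_trans IH' _; rewrite lerDl.
Qed.

(** The distributional derivative of a unit jump at [k] is the Dirac mass at [k]; here it is the
    fundamental theorem of calculus on (k, T), with [phi T = 0]. *)
Lemma integral_test_fun T phi (k : R) : 0 < T -> test_function T phi -> 0 <= k < T ->
  \int[mu]_(x in dom T) ((k <= x)%R%:R * derive1 phi x) = - phi k.
Proof.
move=> T0 [dphi cphi [K [cK Ksub Kout]] phi1] /andP[k0 kT].
have outside y : ~ dom T y -> phi y = 0 by move=> h; apply: Kout => /Ksub.
have phiT : phi T = 0 by apply: outside; rewrite /dom /= in_itv /= ltxx andbF.
have ctphi : continuous phi.
  by move=> y; apply: differentiable_continuous; exact/derivable1_diffP.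
have FTC : (\int[mu]_(x in `]k, T[) (derive1 phi x)%:E = (- phi k)%:E)%E.
  have m : measurable_fun `]k, T[ (EFin \o derive1 phi).
    by apply/measurable_EFinP; apply: measurable_funTS; exact: continuous_measurable_fun.
  rewrite -[LHS](@integral_itv_bndoo _ _ _ _ true false m).
  rewrite (@continuous_FTC2 _ (derive1 phi) phi)// ?phiT.
  - by rewrite -EFinB sub0r.
  - exact: continuous_subspaceT.
  - split; first by move=> y _; exact: dphi.
      by apply: cvg_at_right_filter; exact: ctphi.
    by apply: cvg_at_left_filter; exact: ctphi.
rewrite /Rintegral (_ : (\int[mu]_(x in dom T) _)%E = (- phi k)%:E)//.
rewrite -FTC.
have sub : `]k, T[ `<=` dom T.
  move=> y; rewrite /dom /= !in_itv /= => /andP[ky ->]; rewrite andbT.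
  exact: le_lt_trans ky.
rewrite -[in RHS](setIidr sub) integral_mkcondr.
apply: ae_eq_integral => //.
- exact: measurable_dom.
- apply/measurable_EFinP; apply: measurable_funM.
    rewrite (_ : (fun x => _) = step (fun=> k) (fun q => q%:R) 1).
      exact: measurable_step.
    by apply/funext => y /=; case: leP.
  by apply: measurable_funTS; exact: continuous_measurable_fun.
- apply: measurable_funTS; apply/(measurable_restrictT _ _).1 => //.
  by apply/measurable_EFinP; apply: measurable_funTS; exact: continuous_measurable_fun.
exists [set k]; split => //; first exact: lebesgue_measure_set1.
move=> y /= /not_implyP[yT]; apply: contra_notP => yk.
rewrite patchE; case: ifPn.
  by rewrite inE /= in_itv /= => /andP[/ltW -> _]; rewrite mul1r.
move=> /negP; rewrite inE /= in_itv /=; move: yT; rewrite /dom /= in_itv /=.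
move=> /andP[_ ->]; rewrite andbT => /negP; rewrite -leNgt => yk'.
by rewrite leNgt lt_neqAle yk' andbT; move/eqP: yk => -> /=; rewrite mul0r.
Qed.

(** For ordered jump points the function is a constant plus jumps times unit steps, so its pairing
    is a combination of values of [phi], each at most 1 in absolute value. *)
Lemma step_BV_seminorm T kappa zz n : 0 < T ->
  (forall q, (0 < q)%N -> (q <= n)%N -> 0 <= kappa q < T) ->
  (forall q, (0 < q)%N -> (q < n)%N -> kappa q <= kappa q.+1) ->
  (BV_seminorm T (step kappa zz n) <= (\sum_(q < n) `|zz q.+1 - zz q|)%:E)%E.
Proof.
move=> T0 k0T mono; apply: ge_ereal_sup => _ [phi tphi <-].
have [dphi cphi [K [cK Ksub Kout]] phi1] := tphi.
have mD := measurable_dom T.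
have istep (z' : nat -> R) (k' : nat -> R) m :
    mu.-integrable (dom T) (fun x => (step k' z' m x * derive1 phi x)%:E).
  apply: integrableM_continuous => //.
  apply: (@bounded_integrable_dom _ _ _ (\sum_(q < m.+1) `|z' q|)).
    exact: measurable_step.
  move=> x _; have [q qm ->] := step_values k' z' m x.
  have qm' : (q < m.+1)%N by [].
  by rewrite (bigD1 (Ordinal qm')) //= lerDl sumr_ge0.
have E : \int[mu]_(x in dom T) (step kappa zz n x * derive1 phi x) =
    \sum_(q < n) (zz q.+1 - zz q) * - phi (kappa q.+1).
  elim: n k0T mono => [|n IH] k0T mono.
    rewrite big_ord0 /=.
    (* The constant contributes nothing: with the jump placed at 0 the formula gives [- phi 0], and
       [phi] vanishes there. *)
    have := integral_test_fun T0 tphi (_ : 0 <= 0 < T).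
    rewrite lexx T0 Kout; last by move=> /Ksub; rewrite /dom /= in_itv /= ltxx.
    rewrite oppr0 => /(_ isT) I0.
    rewrite (@RintegralZl _ _ _ mu _ _ _ mD).
      rewrite -[RHS](mulr0 (zz 0%N)) -I0; congr (_ * _).
      apply: eq_Rintegral => x; rewrite inE /dom /= in_itv /= => /andP[/ltW -> _].
      by rewrite mul1r.
    have := istep (fun=> 1) kappa 0%N.
    by under eq_fun do rewrite /= mul1r.
  rewrite big_ord_recr /= -IH.
  - have kn := k0T n.+1 isT (leqnn _).
    have i1 : mu.-integrable (dom T) (fun x => ((kappa n.+1 <= x)%R%:R * derive1 phi x)%:E).
      have := istep (fun q => q%:R) (fun=> kappa n.+1) 1%N.
      by congr (mu.-integrable _ _); apply/funext => y /=; case: leP.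
    have i2 : mu.-integrable (dom T)
        (fun x => ((zz n.+1 - zz n) * ((kappa n.+1 <= x)%R%:R * derive1 phi x))%:E).
      exact: (@integrableZl _ _ _ mu _ mD (zz n.+1 - zz n) _ i1).
    rewrite -(integral_test_fun T0 tphi kn) -(@RintegralZl _ _ _ mu _ _ _ mD i1).
    rewrite -(@RintegralD _ _ _ mu _ _ _ mD (istep zz kappa n) i2).
    apply: eq_Rintegral => x _; case: ifPn => [kx|_]; last by rewrite mul0r mulr0 addr0.
    rewrite mul1r -mulrDl; congr (_ * _).
    rewrite (@step_eq kappa zz n n)//; first by rewrite addrC subrK.
      by move=> n0; apply: le_trans kx; exact: mono.
    by move=> q nq qn; have := leq_trans nq qn; rewrite ltnn.
  - by move=> q q0 qn; apply: k0T => //; exact: leqW.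
  - by move=> q q0 qn; apply: mono => //; exact: leqW.
rewrite -[leLHS]fineK; last exact: (@integrable_fin_num _ _ _ mu _ mD _ (istep _ _ _)).
rewrite -/(Rintegral _ _ _) E lee_fin; apply: ler_sum => q _.
apply: le_trans (ler_norm _) _; rewrite normrM normrN.
by rewrite ler_piMr.
Qed.

End step_functions.

Section step_norms.
Context {R : realType}.
Implicit Types (T p t : R).
Local Notation mu := (@lebesgue_measure R).
Local Notation step := (@step R).

Lemma average_cst (lo hi : R) (f : R -> R) (c : R) : lo < hi ->
  (forall t, `]lo, hi[%classic t -> f t = c) -> average lo hi f = c.
Proof.
move=> lh fc; rewrite /average (_ : Rintegral _ _ _ = \int[mu]_(t in `]lo, hi[) (cst c t)).
  rewrite Rintegral_cst// [X in fine X](lebesgue_measure_oo lh) /= mulrCA mulVf ?mulr1//.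
  by rewrite subr_eq0 gt_eqF.
by apply: eq_Rintegral => t; rewrite inE => /fc.
Qed.

(** The difference has absolute value 0 or 1, so its [p]-th power is bounded by the same indicators
    as in [step_dist], whose integrals are at most [d] each. *)
Lemma step_Lp_dist T p (kappa kappa' zz : nat -> R) (n : nat) (d e : R) : 0 < p -> 0 < e ->
  (forall q, (q <= n)%N -> zz q = 0 \/ zz q = 1) ->
  (forall q, (q <= n)%N -> kappa q <= kappa' q <= kappa q + d) ->
  n%:R * d < e `^ p ->
  (Lp_norm T p (step kappa zz n \- step kappa' zz n)%R < e%:E)%E.
Proof.
move=> p0 e0 z01 kk nd; rewrite ltNge; apply/negP => eN.
have : ((e `^ p)%:E <= Lp_norm T p (step kappa zz n \- step kappa' zz n)%R `^ p)%E.
  rewrite -poweR_EFin; apply: gt0_ler_poweR => //=; first exact: ltW.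
    by rewrite in_itv /= leey lee_fin ltW.
  by rewrite in_itv /= leey Lp_norm_ge0.
rewrite Lp_norm_pow ?gt_eqF//; apply/negP; rewrite -ltNge.
have mD := measurable_dom T.
have mstep k : measurable_fun (dom T) (step k zz n) by exact: measurable_step.
apply: le_lt_trans (_ : (n%:R * d)%:E < _)%E; last by rewrite lte_fin.
apply: (@le_trans _ _ (\int[mu]_(x in dom T)
    \sum_(q < n) (\1_(`[kappa q.+1, kappa' q.+1[%classic) x)%:E)%E).
  apply: ge0_le_integral => //.
  - by apply: measurable_pow_norm; exact: measurable_funB.
  - by apply: emeasurable_sum => q; apply/measurable_EFinP.
  - move=> x _; rewrite sumEFin lee_fin /=.
    apply: le_trans (step_dist x z01 (fun q h => proj1 (andP (kk q h)))).
    have [m mn ->] := step_values kappa zz n x.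
    have [m' mn' ->] := step_values kappa' zz n x.
    by case: (z01 _ mn) => ->; case: (z01 _ mn') => ->;
      rewrite ?subrr ?subr0 ?sub0r ?normrN ?normr0 ?normr1 ?powR1 ?powR0 ?gt_eqF//.
rewrite (@ge0_integral_sum _ _ _ mu _ mD _ (fun (q : 'I_n) x =>
  (\1_(`[kappa q.+1, kappa' q.+1[%classic) x)%:E)); last 2 first.
- by move=> q; apply/measurable_EFinP.
- by move=> q x _; rewrite lee_fin.
apply: (@le_trans _ _ (\sum_(q < n) d%:E)%E).
  apply: lee_sum => q _; rewrite integral_indic//.
  have /andP[k1 k2] := kk q.+1 (ltn_ord q).
  apply: (@le_trans _ _ (mu `[kappa q.+1, kappa' q.+1[%classic)).
    by apply: le_measure; rewrite ?inE//; exact: measurableI.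
  rewrite lebesgue_measure_itv /= lte_fin; case: ifP => _.
    by rewrite -EFinD lee_fin; lra.
  by rewrite lee_fin; lra.
by rewrite sumEFin lee_fin sumr_const card_ord mulr_natl.
Qed.

Lemma bounded_Lp_finite T p (f : R -> R) : 0 < T -> 0 < p -> measurable_fun (dom T) f ->
  (forall t, f t = 0 \/ f t = 1) -> (Lp_norm T p f < +oo)%E.
Proof.
move=> T0 p0 mf f01; apply: (@lty_poweRy _ _ p); first by rewrite gt_eqF.
rewrite Lp_norm_pow ?gt_eqF//.
apply: le_lt_trans (_ : \int[mu]_(x in dom T) (cst 1%:E x) < _)%E.
  apply: ge0_le_integral => //.
  - exact: measurable_dom.
  - exact: measurable_pow_norm.
  - move=> x _; rewrite lee_fin; case: (f01 x) => ->.
      by rewrite normr0 powR0 ?gt_eqF.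
    by rewrite normr1 powR1.
rewrite integral_cst; last exact: measurable_dom.
by rewrite [X in (_ * X)%E](lebesgue_measure_oo T0) -EFinM ltry.
Qed.

End step_norms.

Section attained.
Context {R : realType}.
Implicit Types (T p t : R).
Local Notation mu := (@lebesgue_measure R).
Local Notation step := (@step R).

Lemma admissible_attained T p (x : instance) (z : item x -> bool) :
  0 < T -> 1 <= p -> valid T x -> admissible z ->
  exists2 u, Lp_closure T p
      (D_SP T (ratr (sigma x)) (fun j => ratr (tau x j)) (fixval x)) u &
    averages (fun i => ratr (lo x i)) (fun i => ratr (hi x i)) u
      = \row_k (z (lshift _ k))%:R.
Proof.
move=> T0 p1 vx [zfix zK]; have p0 : 0 < p by lra.
have tot := before_total_valid vx.
have [s0 _] := vx.
pose n := (nint x + nfix x).-1.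
(* At most one item has rank [q]; the sum selects it and gives 0 when there is none. *)
pose zz q : R := \sum_(i : item x | rank i == q) (z i)%:R.
pose kap (d : R) q : R :=
  \sum_(i : item x | rank i == q) (ratr (key i) + if fixing i then 0 else d).
have rankE (i : item x) : (fun j => rank j == rank i) =1 pred1 i.
  by move=> j /=; apply/eqP/eqP => [/(rank_inj tot)|->].
have zzE (i : item x) : zz (rank i) = (z i)%:R by rewrite /zz (big_pred1 _ (rankE i)).
have kapE d (i : item x) : kap d (rank i) = ratr (key i) + if fixing i then 0 else d.
  by rewrite /kap (big_pred1 _ (rankE i)).
have rank_n (i : item x) : (rank i <= n)%N by have := rank_lt i; rewrite /n; lia.
have zz01 q : zz q = 0 \/ zz q = 1.
  have [[i <-]|no] := pselect (exists i : item x, rank i = q).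
    by rewrite zzE; case: (z i); [right|left].
  left; rewrite /zz big_pred0// => i; apply/eqP => ri; apply: no; by exists i.
have pos q : (0 < q)%N -> (q <= n)%N -> exists i : item x, rank i = q.
  rewrite /n => q0 qn; have qL : (q < nint x + nfix x)%N by lia.
  by exists (nth_item (Ordinal qL) q); rewrite nth_itemK.
have posL q : (0 < nint x + nfix x)%N -> (q <= n)%N -> exists i : item x, rank i = q.
  rewrite /n => L0 qn; have qL : (q < nint x + nfix x)%N by lia.
  by exists (nth_item (Ordinal qL) q); rewrite nth_itemK.
(* A delay this small keeps distinct keys in order and the delayed jumps inside (0, T). *)
pose good (d : R) := [/\ forall i j : item x, key i < key j -> ratr (key i) + d <= ratr (key j) :> R,
  forall k : 'I_(nint x), ratr (lo x k) + d < T & 0 < d].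
have mono d q : good d -> (0 < q)%N -> (q < n)%N -> kap d q <= kap d q.+1.
  move=> [gd _ d0] q0 qn; have [i ri] := pos q q0 (ltnW qn).
  have [j rj] := pos q.+1 isT qn; rewrite -rj -ri !kapE.
  have : before i j by rewrite rankP// ri rj.
  rewrite /before => /orP[/gd h|/and3P[/eqP -> -> /negPf ->]]; last by lra.
  by case: (fixing i); case: (fixing j); lra.
have kapT d q : good d -> (0 < q)%N -> (q <= n)%N -> 0 <= kap d q < T.
  move=> [_ gT d0] q0 qn; have [i <-] := pos q q0 qn; rewrite kapE fixing_split /key.
  case: (fintype.split i) => [k|j]; last by rewrite addr0 (tau_itv vx).
  by rewrite gT andbT addr_ge0 ?(lo_ge0 vx)// ltW.
have switchesE : \sum_(q < n) `|zz q.+1 - zz q| = (switches z)%:R.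
  case Ln : (nint x + nfix x)%N => [|m].
    rewrite /n Ln big_ord0 /switches big1// => i.
    by move: (leq_ltn_trans (leq0n i) (ltn_ord i)) => L0; exfalso; move: L0; rewrite Ln.
  have i0 : item x by rewrite Ln; exact: ord0.
  rewrite /n /switches (sum_consecutive tot i0 _ Ln) natr_sum.
  rewrite [in LHS]Ln /=; apply: eq_bigr => q _.
  have zq r : (r < m.+1)%N -> zz r = (z (nth_item i0 r))%:R.
    by move=> rm; rewrite -zzE nth_itemK// Ln.
  rewrite (zq q) ?(zq q.+1) ?ltnS// ?(ltnW (ltn_ord q))//.
  by case: (z _); case: (z _) => /=;
    rewrite ?subrr ?subr0 ?sub0r ?normrN ?normr0 ?normr1.
have stepD d : good d -> D_SP T (ratr (sigma x)) (fun j => ratr (tau x j)) (fixval x)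
    (step (kap d) zz n).
  move=> gd; have bv : (BV_seminorm T (step (kap d) zz n) <= (ratr (sigma x))%:E)%E.
    apply: le_trans (step_BV_seminorm _ T0 _ _) _.
    - by move=> q; exact: kapT.
    - by move=> q; exact: mono.
    - by rewrite switchesE lee_fin -(ratr_nat R) ler_rat -max_switchesP// ltW.
  have s01 t : step (kap d) zz n t = 0 \/ step (kap d) zz n t = 1.
    by have [m _ ->] := step_values (kap d) zz n t.
  split; [split=> //|].
  - split; last by apply: le_lt_trans bv _; rewrite ltry.
    apply: (@bounded_integrable_dom _ _ _ 1); first exact: measurable_step.
    by move=> t _; case: (s01 t) => ->; rewrite ?normr0 ?normr1.
  - exact: aeW.
  - move=> j; exists (step (kap d) zz n); split.
      split; first exact: aeW.
      by move=> t _; exact: step_right_continuous.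
    pose i : item x := rshift (nint x) j.
    have ki : key i = tau x j by rewrite /key (unsplitK (inr _ j)).
    have fi : fixing i by rewrite fixing_split (unsplitK (inr _ j)).
    have v : step (kap d) zz n (ratr (tau x j)) = (fixval x j)%:R.
      rewrite (@step_eq _ (kap d) zz n (rank i))//.
      - by rewrite zzE zfix.
      - by rewrite kapE ki fi addr0.
      (* An item after the fixing has a larger key, or is an interval with the same key whose jump
         is delayed by [d > 0]; in both cases its jump lies strictly beyond the fixing. *)
      - move=> q iq qn; have [k rk] := pos q (leq_ltn_trans (leq0n _) iq) qn.
        have : before i k by rewrite rankP// rk.
        have [_ _ d0] := gd.
        rewrite -rk kapE /before ki => /orP[|/and3P[/eqP <- _ /negPf ->]].
          by rewrite -(ltr_rat R); case: fixing; lra.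
        by rewrite ltrDl.
    by case: ifPn => [/eqP e0|_//]; rewrite -v -e0; exact: step_right_continuous.
(* Without delay the averages are exact, but an interval that starts at a fixing overrides the fixed
   value, so in general only the closure contains [u0]. *)
pose u0 := step (kap 0) zz n.
have u0avg k t : avg_interval x k t -> u0 t = (z (lshift _ k))%:R.
  move=> /avg_intervalP/andP[lt th]; pose i : item x := lshift (nfix x) k.
  have ki : key i = lo x k by rewrite /key (unsplitK (inl _ k)).
  have fi : fixing i = false by rewrite fixing_split (unsplitK (inl _ k)).
  rewrite /u0 (@step_eq _ (kap 0) zz n (rank i))//.
  - by rewrite kapE ki fi addr0 ltW.
  - move=> q iq qn; have [j rj] := pos q (leq_ltn_trans (leq0n _) iq) qn.
    have : before i j by rewrite rankP// rj.
    rewrite -rj kapE if_same addr0 /before ki fi andbF orbF => lt'.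
    apply: lt_le_trans th _; rewrite ler_rat; move: lt'; rewrite /key.
    case: (fintype.split j) => [k'|j'] lt'.
      have ne : k != k' by apply: contraTneq lt' => ->; rewrite ltxx.
      have lh := lo_lt_hi vx k'.
      by have /orP[//|h] := intervals_ordered vx ne; move: (le_lt_trans h lt'); rewrite ltNge ltW.
    by have /orP[h|//] := fixing_outside vx k j'; move: (le_lt_trans h lt'); rewrite ltxx.
exists u0; last first.
  apply/rowP => k; rewrite !mxE; apply: average_cst.
    by rewrite ltr_rat (lo_lt_hi vx).
  by move=> t /u0avg.
split.
- exact: measurable_step.
- apply: bounded_Lp_finite => //; first exact: measurable_step.
  by move=> t; rewrite /u0; have [m _ ->] := step_values (kap 0) zz n t.
- move=> e e0.
  have [d' [gd' dn']] : exists d, good d /\ n%:R * d < e `^ p.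
    have n1 : 0 < n.+1%:R :> R by rewrite ltr0n.
    suff h : \forall d \near (0:R)^'+, good d /\ n%:R * d < e `^ p.
      exact: (@filter_ex _ _ (at_right_proper_filter (0:R)) _ h).
    have near1 : \forall d \near (0:R)^'+, forall i j : item x,
        key i < key j -> ratr (key i) + d <= ratr (key j) :> R.
      apply: filter_forall => i; apply: filter_forall => j.
      case: (boolP (key i < key j)) => [ij|_]; last exact: nearW.
      near=> d => _; rewrite -lerBrDl; near: d; apply: nbhs_right_le.
      by rewrite subr_gt0 ltr_rat.
    have near2 : \forall d \near (0:R)^'+, forall k : 'I_(nint x), ratr (lo x k) + d < T.
      apply: filter_forall => k; near=> d; rewrite -ltrBrDl; near: d.
      apply: nbhs_right_lt; rewrite subr_gt0; apply: lt_le_trans (hi_leT vx k).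
      by rewrite ltr_rat (lo_lt_hi vx).
    near=> d; split; first split.
    - by near: d.
    - by near: d.
    - by near: d; exact: nbhs_right_gt.
    - have : d < e `^ p / n.+1%:R.
        by near: d; apply: nbhs_right_lt; rewrite divr_gt0// powR_gt0.
      rewrite ltr_pdivlMr// mulrC; apply: le_lt_trans; apply: ler_wpM2r.
        by near: d; exact: nbhs_right_ge.
      by rewrite ler_nat.
  exists (step (kap d') zz n); first exact: stepD.
  have [_ _ d0] := gd'.
  apply: step_Lp_dist dn' => // q qn.
  have [[i <-]|no] := pselect (exists i : item x, rank i = q).
    by rewrite !kapE; case: fixing; rewrite ?addr0 lexx ?lerDl ltW.
  have e1 dd : kap dd q = 0.
    by rewrite /kap big_pred0// => i; apply/eqP => ri; apply: no; exists i.
  by rewrite !e1 lexx add0r ltW.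
Unshelve. all: by end_near. Qed.
End attained.

(** * Systematic sampling *)

Section sampling.
Local Open Scope nat_scope.

(** Hermite's identity for the floor function, by induction on [m]: the summands shift by one place
    and the one that wraps around gains 1. It makes the sampling unbiased. *)
Lemma sum_divn_shift (Q m : nat) : 0 < Q -> \sum_(k < Q) (m + k) %/ Q = m.
Proof.
case: Q => // Q _; elim: m => [|m IH].
  by rewrite big1// => k _; rewrite add0n divn_small.
rewrite -[in RHS]IH big_ord_recr big_ord_recl /= addn0.
have -> : (m.+1 + Q) %/ Q.+1 = (m %/ Q.+1).+1.
  by rewrite addSnnS addnC -{1}[Q.+1]mul1n divnMDl.
rewrite addnC addSn; congr (_ + _).+1; apply: eq_bigr => k _.
by rewrite /bump /= add1n addSnnS.
Qed.

(* X p / Q are the numbers to be rounded; their rounding number k has entries *)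
(* floor (A p + k / Q) - floor (B p + k / Q), where B is the total decrease   *)
(* of X / Q before p and A = X / Q + B increases with p.                      *)
Section systematic_sampling.
Context (Q n : nat) (X : nat -> nat).

(** Subtraction of natural numbers is truncated, so each term is the positive part of a decrease. *)
Definition downs p := \sum_(r < p) (X r - X r.+1).
Definition ups p := \sum_(r < p) (X r.+1 - X r).

Lemma ups_downs p : X 0 + ups p = X p + downs p.
Proof.
rewrite /ups /downs; elim: p => [|p IH]; first by rewrite !big_ord0.
rewrite !big_ord_recr /=; move: IH.
by set a := \sum_(r < p) _; set b := \sum_(r < p) _; lia.
Qed.

(** For [X p <= Q] the two floors differ by 0 or 1, so comparing them records their difference. *)
Definition sample k p : bool := (X p + downs p + k) %/ Q != (downs p + k) %/ Q.

Context (Q0 : 0 < Q) (XQ : forall p, X p <= Q).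

Lemma sampleE k p : (X p + downs p + k) %/ Q = (downs p + k) %/ Q + sample k p.
Proof.
rewrite /sample -addnA; set a := downs p + k.
have h1 : a %/ Q <= (X p + a) %/ Q by apply: leq_div2r; rewrite leq_addl.
have h2 : (X p + a) %/ Q <= (a %/ Q).+1.
  have -> : (a %/ Q).+1 = (Q + a) %/ Q by rewrite -[X in (X + a) %/ Q]mul1n divnMDl.
  by apply: leq_div2r; rewrite leq_add2r.
by case: eqP => [->|]; lia.
Qed.

Lemma sum_sample p : \sum_(k < Q) sample k p = X p.
Proof.
have := sum_divn_shift (X p + downs p) Q0.
under eq_bigr do rewrite sampleE.
by rewrite big_split/= sum_divn_shift//; lia.
Qed.

(** Both floors are nondecreasing in [p] and their difference is the sample, so every switch makes
    at least one of them increase. The switches are bounded by the total increase. *)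
Lemma sample_switches k :
  \sum_(p < n) (sample k p != sample k p.+1) + (X 0 + k) %/ Q + k %/ Q
    <= (X 0 + ups n + k) %/ Q + (downs n + k) %/ Q.
Proof.
elim: n => [|m IH]; first by rewrite /ups /downs !big_ord0 !addn0.
rewrite big_ord_recr /=; move: IH; set S := \sum_(p < m) _ => IH.
have mono p : (X 0 + ups p + k) %/ Q <= (X 0 + ups p.+1 + k) %/ Q.
  by apply: leq_div2r; rewrite /ups big_ord_recr /=; lia.
have mono' p : (downs p + k) %/ Q <= (downs p.+1 + k) %/ Q.
  by apply: leq_div2r; rewrite /downs big_ord_recr /=; lia.
have := mono m; have := mono' m; move: IH.
have := sampleE k m; have := sampleE k m.+1; rewrite -!ups_downs.
by case: (sample k m); case: (sample k m.+1) => /=; do ![move: (_ %/ _) => ?]; lia.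
Qed.

Lemma sample_switches_even k r : k < Q -> ups n <= r * Q -> downs n <= r * Q ->
  \sum_(p < n) (sample k p != sample k p.+1) <= r.*2.
Proof.
move=> kQ hu hd; have := sample_switches k; rewrite (divn_small kQ).
have : (X 0 + ups n + k) %/ Q <= r + (X 0 + k) %/ Q.
  by rewrite -divnMDl//; apply: leq_div2r; lia.
have : (downs n + k) %/ Q <= r + k %/ Q.
  by rewrite -divnMDl//; apply: leq_div2r; lia.
by rewrite (divn_small kQ); do ![move: (_ %/ _) => ?]; lia.
Qed.

(** As in the even case, except that the final value of each floor is compared with the initial
    value of the other one, as the reflected closing suggests. The increments [r.+1] and [r] add up
    to the odd bound. *)
Lemma sample_switches_odd k r : k < Q -> X 0 + ups n <= r.+1 * Q ->
  downs n <= r * Q + X 0 -> \sum_(p < n) (sample k p != sample k p.+1) <= r.*2.+1.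
Proof.
move=> kQ hu hd; have := sample_switches k; rewrite (divn_small kQ).
have : (X 0 + ups n + k) %/ Q <= r.+1 + k %/ Q.
  by rewrite -divnMDl//; apply: leq_div2r; lia.
have : (downs n + k) %/ Q <= r + (X 0 + k) %/ Q.
  by rewrite -divnMDl//; apply: leq_div2r; lia.
by rewrite (divn_small kQ); do ![move: (_ %/ _) => ?]; lia.
Qed.

End systematic_sampling.

Lemma odd_switches (n : nat) (z : nat -> bool) :
  odd (\sum_(p < n) (z p != z p.+1)) = (z 0 != z n).
Proof.
elim: n => [|n IH]; first by rewrite big_ord0 eqxx.
by rewrite big_ord_recr /= oddD IH; case: (z 0); case: (z n); case: (z n.+1).
Qed.

End sampling.

(** * The subgradient of the closed variation *)

Section coefficients.
Context (x : instance) (tot : before_total x).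
Local Notation item := (item x).
Local Notation K := (max_switches x).

Definition value (i : item) : rat :=
  match fintype.split i with inl k => query x 0 k | inr j => (fixval x j)%:R end.

(* The number of switches of a 0/1 sequence has the parity of the difference  *)
(* of its ends, so that closing the sequence up with the reflected first      *)
(* entry costs nothing exactly when there are K switches.                     *)
Definition reflect_value (a : rat) : rat := if odd K then 1 - a else a.

Definition compare (a b : rat) : int := (b < a)%R%:Z - (a < b)%R%:Z.

Definition rank_dist (i k : item) : nat := `|(rank i)%:Z - (rank k)%:Z|%N.

(* A subgradient, at the vector to be separated, of the variation of the      *)
(* sequence closed up by [reflect_value].                                     *)
Definition coef (i : item) : int :=
  \sum_k ((rank_dist i k == 1%N)%:Z * compare (value i) (value k)
    + (rank_dist i k == (nint x + nfix x).-1)%:Z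
       * compare (value i) (reflect_value (value k))).

Lemma compareE a b : (compare a b)%:~R = Num.sg (a - b) :> rat.
Proof.
rewrite /compare; case: (ltgtP a b) => [h|h|->]; last by rewrite !subrr sgr0.
  by rewrite ltr0_sg ?subr_lt0.
by rewrite gtr0_sg ?subr_gt0.
Qed.

Lemma adjacent_split (i k : item) : (rank_dist i k == 1%N)%:R =
  (rank k == (rank i).+1)%:R + (rank i == (rank k).+1)%:R :> rat.
Proof.
rewrite /rank_dist; move: (rank i) (rank k) => a b.
have -> : (`|a%:Z - b%:Z|%N == 1%N) = (b == a.+1) || (a == b.+1).
  by apply/eqP/orP => [h|[/eqP ->|/eqP ->]]; [have [?|?] : b = a.+1 \/ a = b.+1 by lia|lia|lia];
    [left|right]; apply/eqP.
by have [->|] := eqVneq b a.+1; [rewrite (_ : (a == a.+2) = false) ?addr0//; lia|rewrite add0r].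
Qed.

(** For [n = 0] the two events on the right coincide and would be counted twice; a single item is
    therefore treated apart, in [coef_sum1]. *)
Lemma wrap_split (n : nat) (i k : item) : (0 < n)%N -> (nint x + nfix x)%N = n.+1 ->
  (rank_dist i k == n)%:R =
  ((rank i == 0%N) && (rank k == n))%:R + ((rank i == n) && (rank k == 0%N))%:R :> rat.
Proof.
move=> n0 Ln; have := rank_lt i; have := rank_lt k; rewrite Ln /rank_dist.
move: (rank i) (rank k) => a b bn an.
have -> : (`|a%:Z - b%:Z|%N == n) = (a == 0%N) && (b == n) || (a == n) && (b == 0%N).
  apply/eqP/orP => [h|[/andP[/eqP -> /eqP ->]|/andP[/eqP -> /eqP ->]]]; [|lia|lia].
  have [[? ?]|[? ?]] : (a = 0%N /\ b = n) \/ (a = n /\ b = 0%N) by lia.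
    by left; apply/andP; split; apply/eqP.
  by right; apply/andP; split; apply/eqP.
have [->|a0] := eqVneq a 0%N; last by rewrite /= add0r.
by rewrite (_ : (0%N == n) = false) ?orbF ?addr0//; lia.
Qed.

Lemma sum_nat_of_bool (I : finType) (P : pred I) (F : I -> rat) :
  \sum_k (P k)%:R * F k = \sum_(k | P k) F k.
Proof.
by rewrite [RHS]big_mkcond; apply: eq_bigr => k _; case: (P k); rewrite ?mul1r ?mul0r.
Qed.

Lemma sum_corner (i0 : item) (a b : nat) (F : item -> item -> rat) :
  (a < nint x + nfix x)%N -> (b < nint x + nfix x)%N ->
  \sum_i \sum_k ((rank i == a) && (rank k == b))%:R * F i k =
  F (nth_item i0 a) (nth_item i0 b).
Proof.
move=> aL bL.
have E c (cL : (c < nint x + nfix x)%N) : (fun i : item => rank i == c) =1 pred1 (nth_item i0 c).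
  by move=> i; apply/eqP/eqP => [<-|->]; rewrite ?rankK ?nth_itemK.
rewrite (eq_bigr (fun i => (rank i == a)%:R * \sum_k (rank k == b)%:R * F i k)).
  by rewrite sum_nat_of_bool (big_pred1 _ (E _ aL)) sum_nat_of_bool (big_pred1 _ (E _ bL)).
move=> i _; rewrite mulr_sumr; apply: eq_bigr => k _.
by case: (rank i == a); case: (rank k == b); rewrite ?mul1r ?mul0r.
Qed.

(** Every pair of neighbours contributes to the coefficients of both its items. In terms of
    [2 * u i - 1] reflection is a change of sign, so the closing pair combines in the same way for
    either parity of [K]. *)
Lemma coef_sum (n : nat) (i0 : item) (u : item -> rat) :
  (0 < n)%N -> (nint x + nfix x)%N = n.+1 ->
  let w p := value (nth_item i0 p) in let U p := u (nth_item i0 p) in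
  \sum_i (coef i)%:~R * (2 * u i - 1) =
  2 * (\sum_(p < n) Num.sg (w p.+1 - w p) * (U p.+1 - U p)
       + Num.sg (reflect_value (w 0%N) - w n) * (reflect_value (U 0%N) - U n)).
Proof.
move=> n0 Ln w U.
pose Y i : rat := 2 * u i - 1.
pose F (i k : item) := Num.sg (value i - value k) * Y i.
pose G (i k : item) := Num.sg (value i - reflect_value (value k)) * Y i.
have -> : \sum_i (coef i)%:~R * (2 * u i - 1) =
    \sum_i \sum_k ((rank k == (rank i).+1)%:R * F i k)
    + \sum_k \sum_i ((rank i == (rank k).+1)%:R * F i k)
    + \sum_i \sum_k (((rank i == 0%N) && (rank k == n))%:R * G i k)
    + \sum_i \sum_k (((rank i == n) && (rank k == 0%N))%:R * G i k).
  rewrite [X in _ + X + _ + _]exchange_big -!big_split; apply: eq_bigr => i _ /=.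
  have Ln' : (nint x + nfix x).-1 = n by rewrite Ln.
  rewrite -!big_split /coef Ln' rmorph_sum mulr_suml; apply: eq_bigr => k _ /=.
  have natZ (m : nat) : m%:Z%:~R = m%:R :> rat by [].
  rewrite rmorphD !rmorphM /= !compareE !natZ adjacent_split (wrap_split _ _ n0 Ln).
  by rewrite /F /G /Y mulrDl -!mulrA mulrDl [X in _ + X]mulrDl !addrA.
rewrite (sum_corner i0); [|by rewrite Ln..].
rewrite (sum_corner i0); [|by rewrite Ln..].
have E (H : item -> item -> rat) : \sum_i \sum_k ((rank k == (rank i).+1)%:R * H i k)
    = \sum_(p < n) H (nth_item i0 p) (nth_item i0 p.+1).
  by under eq_bigr do rewrite sum_nat_of_bool; exact: sum_consecutive.
rewrite (E F) (E (fun k i => F i k)) -big_split /= mulrDr mulr_sumr -addrA.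
congr (_ + _).
  apply: eq_bigr => p _; rewrite /F /Y -/(w p.+1) -/(w p) -/(U p) -/(U p.+1).
  by rewrite -[w p - w p.+1]opprB sgrN; lra.
rewrite /G /Y /reflect_value -/(w 0%N) -/(w n) -/(U 0%N) -/(U n).
move: (w 0%N) (w n) (U 0%N) (U n) => a b c d; case: (odd K).
  have -> : a - (1 - b) = - (1 - a - b) by lra.
  have -> : b - (1 - a) = - (1 - a - b) by lra.
  by rewrite sgrN; lra.
by rewrite -[b - a]opprB sgrN; lra.
Qed.

(** The only pair is the item with its own reflection, counted once. It matters for odd [K] only,
    and then [K >= 1] leaves room for it. *)
Lemma coef_sum1 (u : item -> rat) : (nint x + nfix x)%N = 1%N ->
  (forall i, 0 <= u i <= 1) -> \sum_i (coef i)%:~R * (2 * u i - 1) <= (2 * K)%N%:R.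
Proof.
move=> L1 u01.
have i0 : item by rewrite L1; exact: ord0.
rewrite (sum_nth_item_eq tot i0 _ L1) big_ord1; move: (nth_item i0 ord0) => i.
have ir k : k = i.
  by apply: (rank_inj tot); have := rank_lt k; have := rank_lt i; rewrite L1; lia.
have -> : coef i = compare (value i) (reflect_value (value i)).
  have L0 : (nint x + nfix x).-1 = 0%N by rewrite L1.
  rewrite /coef L0 (eq_bigl (pred1 i)) ?big_pred1_eq.
    by rewrite /rank_dist subrr /= mul0r add0r mul1r.
  by move=> k; rewrite /= (ir k) eqxx.
rewrite compareE /reflect_value; case: (boolP (odd K)) => Ko; last first.
  by rewrite subrr sgr0 mul0r ler0n.
have K1 : (1 <= K)%N by case: K Ko.
have : 1 <= (2 * K)%N%:R :> rat by rewrite ler1n; lia.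
apply: le_trans; have /andP[h1 h2] := u01 i.
apply: le_trans (ler_norm _) _; rewrite normrM -[X in _ <= X]mulr1.
apply: ler_pM => //; first by rewrite normr_sg lern1 leq_b1.
by rewrite ler_norml; apply/andP; split; lra.
Qed.

Lemma coef_sum_admissible (z : item -> bool) : admissible z ->
  \sum_i (coef i)%:~R * (2 * (z i)%:R - 1) <= (2 * K)%N%:R :> rat.
Proof.
move=> [_ zK].
have [n Ln] : exists n, (nint x + nfix x)%N = n by eexists.
case: n Ln => [|[|n]] Ln.
  rewrite big1 ?ler0n// => i _.
  by have := leq_ltn_trans (leq0n i) (ltn_ord i); rewrite [X in (_ < X)%N]Ln.
  by apply: (@coef_sum1 (fun i => (z i)%:R)) => // i; case: (z i).
have i0 : item by rewrite Ln; exact: ord0.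
rewrite (@coef_sum n.+1 i0 (fun i => (z i)%:R))// natrM ler_pM2l//.
pose Z p := z (nth_item i0 p).
move: zK; rewrite /switches (sum_consecutive tot i0 _ Ln).
rewrite -/(Z _); set c := (\sum_(p < n.+1) _)%N => cK.
have cE : \sum_(p < n.+1) `|(Z p.+1)%:R - (Z p)%:R| = c%:R :> rat.
  rewrite /c natr_sum; apply: eq_bigr => p _; rewrite -/(Z p) -/(Z p.+1).
  by case: (Z p); case: (Z p.+1) => /=;
    rewrite ?subrr ?subr0 ?sub0r ?normrN ?normr0 ?normr1.
have sgle (a b : rat) : Num.sg a * b <= `|b|.
  apply: le_trans (ler_norm _) _; rewrite normrM ler_piMl//.
  by rewrite normr_sg lern1 leq_b1.
apply: (@le_trans _ _ (c%:R + `|reflect_value (Z 0%N)%:R - (Z n.+1)%:R|)).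
  by rewrite -cE; apply: lerD; [apply: ler_sum => p _|]; exact: sgle.
have := odd_switches n.+1 Z; rewrite -/c => codd.
have last1 : `|reflect_value (Z 0%N)%:R - (Z n.+1)%:R| <= 1.
  rewrite /reflect_value; case: (odd K); case: (Z 0%N); case: (Z n.+1) => /=;
    by rewrite ?subrr ?subr0 ?sub0r ?normrN ?normr0 ?normr1.
(* With fewer than [K] switches there is room for a closing term of at most 1; with exactly [K], the
   parity of [K] forces the closing term to vanish. *)
move: cK; rewrite leq_eqVlt => /predU1P[cK|cK]; last first.
  by move: cK; rewrite -(ler_nat rat) -natr1; lra.
rewrite (_ : `|_| = 0) ?addr0 ?cK//.
rewrite /reflect_value -cK codd; case: (Z 0%N); case: (Z n.+1) => /=;
  by rewrite ?subrr ?subr0 ?sub0r ?normrN ?normr0 ?normr1.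
Qed.

End coefficients.

Lemma common_denominator (I : finType) (f : I -> rat) : (forall i, 0 <= f i) ->
  exists2 Q : nat, (0 < Q)%N & exists X : I -> nat, forall i, f i * Q%:R = (X i)%:R.
Proof.
move=> f0.
pose d i := `|denq (f i)|%N.
have d0 i : (0 < d i)%N by rewrite absz_gt0 denq_neq0.
exists (\prod_i d i)%N; first by rewrite prodn_gt0.
exists (fun i => (`|numq (f i)| * \prod_(j | j != i) d j)%N) => i.
rewrite (bigD1 i)//= !natrM mulrA; congr (_ * _).
rewrite -[X in X * _ = _]divq_num_den !pmulrn !abszE.
rewrite !ger0_norm ?numq_ge0 ?denq_ge0//.
by rewrite divfK// intr_eq0 denq_neq0.
Qed.

(** * Convex decomposition of a query of small closed variation *)

Section decomposition.
Context (x : instance) (tot : before_total x).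
Local Notation item := (item x).
Local Notation K := (max_switches x).

(** At the query itself the subgradient form is tight, because a number times its sign is its
    absolute value. *)
Lemma variation_le (n : nat) (i0 : item) : (nint x + nfix x)%N = n.+1 ->
  (forall i : item, 0 <= value i <= 1) ->
  \sum_(i : item) (coef i)%:~R * (2 * value i - 1) <= (2 * K)%N%:R ->
  \sum_(p < n) `|value (nth_item i0 p.+1) - value (nth_item i0 p)|
    + `|reflect_value x (value (nth_item i0 0)) - value (nth_item i0 n)| <= K%:R.
Proof.
move=> Ln v01 vK; case: n Ln => [|n] Ln.
  rewrite big_ord0 add0r /reflect_value; case: ifP => Ko; last by rewrite subrr normr0.
  have K1 : (1 <= K)%N by case: K Ko.
  have : 1 <= K%:R :> rat by rewrite ler1n.
  apply: le_trans; have /andP[h1 h2] := v01 (nth_item i0 0).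
  by rewrite ler_norml; apply/andP; split; lra.
have sgE (a : rat) : Num.sg a * a = `|a| by rewrite normrEsg.
move: vK; rewrite (@coef_sum _ tot n.+1 i0 (@value x))// natrM ler_pM2l//.
by rewrite !sgE; under eq_bigr do rewrite sgE.
Qed.

Lemma decomposition : (forall i : item, 0 <= value i <= 1) ->
  \sum_(i : item) (coef i)%:~R * (2 * value i - 1) <= (2 * K)%N%:R ->
  exists2 Q : nat, (0 < Q)%N & exists2 z : 'I_Q -> item -> bool,
    (forall k, admissible (z k)) &
    forall i, value i * Q%:R = \sum_k (z k i)%:R.
Proof.
move=> v01 vK.
have [Ln|[n Ln]] : (nint x + nfix x)%N = 0%N \/ exists n, (nint x + nfix x)%N = n.+1.
- by case: (_ + _)%N => [|m]; [left|right; exists m].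
- exists 1%N => //; exists (fun _ _ => false).
    move=> _; split=> [j|]; first by have := ltn_ord j; lia.
    by rewrite /switches big1// => i _; rewrite big1.
  by move=> i; move: (leq_ltn_trans (leq0n i) (ltn_ord i)) => L0; exfalso; move: L0; rewrite Ln.
have i0 : item by rewrite Ln; exact: ord0.
have [Q Q0 [Xi XiE]] := common_denominator (fun i => proj1 (andP (v01 i))).
have Qr : 0 < Q%:R :> rat by rewrite ltr0n.
pose X p := Xi (nth_item i0 p).
have XQ p : (X p <= Q)%N.
  rewrite -(ler_nat rat) -XiE -[leRHS]mul1r ler_pM2r//.
  by case/andP: (v01 (nth_item i0 p)).
exists Q => //; exists (fun k i => sample Q X k (rank i)); last first.
  by move=> i; rewrite -natr_sum sum_sample// /X rankK// -XiE.
have := variation_le i0 Ln v01 vK.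
pose w p := value (nth_item i0 p); rewrite -/(w 0%N) -/(w n) => var.
have wX p : w p * Q%:R = (X p)%:R by rewrite XiE.
have ud := ups_downs X n.
have udE : (ups X n + downs X n)%N%:R = (\sum_(p < n) `|w p.+1 - w p|) * Q%:R :> rat.
  rewrite /ups /downs -big_split natr_sum mulr_suml; apply: eq_bigr => p _ /=.
  rewrite -[Q%:R in RHS]ger0_norm ?ler0n// -normrM mulrBl !wX.
  case: (leqP (X p) (X p.+1)) => h.
    have -> : (X p - X p.+1 = 0)%N by apply/eqP.
    by rewrite addn0 natrB// ger0_norm// subr_ge0 ler_nat.
  have -> : (X p.+1 - X p = 0)%N by apply/eqP; exact: ltnW.
  by rewrite add0n natrB ?(ltnW h)// ltr0_norm ?opprB// subr_lt0 ltr_nat.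
have varQ : (ups X n + downs X n)%N%:R + `|reflect_value x (w 0%N) - w n| * Q%:R
    <= K%:R * Q%:R :> rat.
  by rewrite udE -mulrDl ler_pM2r.
move=> k; split.
  move=> j; set i : item := rshift _ j.
  have vi : value i = (fixval x j)%:R by rewrite /value (unsplitK (inr _ j)).
  have XE : X (rank i) = (fixval x j * Q)%N.
    by apply/eqP; rewrite -(eqr_nat rat) /X rankK// -XiE vi natrM.
  (* An entry 0 or [Q] is rounded to 0 or 1 for every [k]: adding a multiple of [Q] shifts the floor
     exactly. *)
  rewrite /sample XE; case: (fixval x j); last by rewrite mul0n add0n eqxx.
  by rewrite -addnA divnMDl// -[X in _ != X]add0n eqn_add2r.
rewrite /switches (sum_consecutive tot i0 _ Ln).
rewrite (eq_bigr (fun p : 'I_n => (sample Q X k p != sample Q X k p.+1) : nat)); last first.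
  by move=> p _; rewrite !nth_itemK ?Ln ?ltnS ?(ltnW (ltn_ord p))//.
have Keq := odd_double_half K; move: varQ; rewrite /reflect_value.
(* The end values determine the difference of [ups] and [downs]; together with the bound on their
   sum this bounds each of them, as the sampling lemmas require. *)
have udr : (X 0%N)%:R + (ups X n)%:R = (X n)%:R + (downs X n)%:R :> rat.
  by rewrite -!natrD ud.
case: (boolP (odd K)) Keq => Ko /=.
  rewrite add1n => Keq varQ; rewrite -Keq.
  have Kr : K%:R = 2 * (K./2)%:R + 1 :> rat by rewrite -{1}Keq -natr1 -muln2 natrM mulrC.
  have nrm : - ((1 - w 0%N - w n) * Q%:R) <= `|1 - w 0%N - w n| * Q%:R.
    by rewrite -mulNr ler_pM2r// -normrN ler_norm.
  have nrm' : (1 - w 0%N - w n) * Q%:R <= `|1 - w 0%N - w n| * Q%:R.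
    by rewrite ler_pM2r// ler_norm.
  move: nrm nrm'; rewrite !mulrBl !wX mul1r => nrm nrm'.
  move: varQ; rewrite Kr natrD mulrDl mul1r -mulrA => varQ.
  by apply: sample_switches_odd => //; rewrite -(ler_nat rat) !natrD ?natrM -?natr1 ?mulrDl; lra.
rewrite add0n => Keq varQ; rewrite -Keq.
have Kr : K%:R = 2 * (K./2)%:R :> rat by rewrite -{1}Keq -muln2 natrM mulrC.
have nrm : - ((w 0%N - w n) * Q%:R) <= `|w 0%N - w n| * Q%:R.
  by rewrite -mulNr ler_pM2r// -normrN ler_norm.
have nrm' : (w 0%N - w n) * Q%:R <= `|w 0%N - w n| * Q%:R.
  by rewrite ler_pM2r// ler_norm.
move: nrm nrm'; rewrite !mulrBl !wX => nrm nrm'.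
move: varQ; rewrite Kr natrD -mulrA => varQ.
by apply: sample_switches_even => //; rewrite -(ler_nat rat) natrM; lra.
Qed.

End decomposition.

(** * Bit lengths and running times *)

Lemma bitlen_le (z : int) (n : nat) : (0 < n)%N -> (bitlen z <= n)%N = (`|z| < 2 ^ n)%N.
Proof.
move=> n0; rewrite /bitlen; have [->|z0] := posnP `|z|%N.
  by rewrite trunc_log0 expn_gt0 n0.
apply/idP/idP => h.
  by apply: leq_trans (trunc_log_ltn _ (isT : 1 < 2)%N) _; rewrite leq_exp2l.
by rewrite -(ltn_exp2l _ _ (ltnSn 1)); apply: leq_ltn_trans (trunc_logP _ _) h.
Qed.

Lemma bitlen_lt z : (`|z| < 2 ^ bitlen z)%N.
Proof. by rewrite -bitlen_le. Qed.

Lemma bitlen_mono y z : (`|y| <= `|z|)%N -> (bitlen y <= bitlen z)%N.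
Proof. by move=> yz; rewrite bitlen_le//; apply: leq_ltn_trans yz (bitlen_lt z). Qed.

Lemma bitlenD y z : (bitlen (y + z) <= (maxn (bitlen y) (bitlen z)).+1)%N.
Proof.
rewrite bitlen_le// expnS mul2n -addnn.
have hy : (`|y| < 2 ^ maxn (bitlen y) (bitlen z))%N.
  by rewrite -bitlen_le ?leq_maxl// leq_max.
have hz : (`|z| < 2 ^ maxn (bitlen y) (bitlen z))%N.
  by rewrite -bitlen_le ?leq_maxr// leq_max.
by move: hy hz; set a := (2 ^ _)%N; lia.
Qed.

Lemma bitlenN z : bitlen (- z) = bitlen z.
Proof. by rewrite /bitlen abszN. Qed.

Lemma bitlenM y z : (bitlen (y * z) <= bitlen y + bitlen z)%N.
Proof.
rewrite bitlen_le ?addn_gt0// abszM expnD.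
have hy := bitlen_lt y; have hz := bitlen_lt z.
by apply: ltn_mul.
Qed.

Lemma bitlen_divz y z : (bitlen (y %/ z)%Z <= bitlen y)%N.
Proof.
by apply: bitlen_mono; exact: lez_div.
Qed.

(** The program keeps its variables at negative addresses, so that the input at nonnegative
    addresses is never overwritten. *)
Definition memory_of (inp l : seq int) : memory :=
  fun a => match a with Posz k => nth 0 inp k | Negz k => nth 0 l k end.

Definition var (k : nat) : expr := Reg (Cst (Negz k)).
Definition set_var (k : nat) (e : expr) : cmd := Assign (Cst (Negz k)) e.

Lemma load_memory_of inp n : load inp = memory_of inp (nseq n 0).
Proof. by apply/funext => -[k|k] //=; rewrite nth_nseq if_same. Qed.

Lemma update_memory_of inp l k z :
  update (memory_of inp l) (Negz k) z = memory_of inp (set_nth 0 l k z).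
Proof.
apply/funext => -[j|j]; rewrite /update /=; first by [].
by rewrite nth_set_nth /= -[Negz j == Negz k]/(j == k).
Qed.

(** The bit length of a value in multiples of the register bound: a register counts once, and every
    operation at most adds the lengths of its operands. *)
Fixpoint expr_width (e : expr) : nat :=
  match e with
  | Cst z => bitlen z
  | Reg _ => 1
  | Bin _ e1 e2 => expr_width e1 + expr_width e2
  end%N.

Fixpoint expr_weight (e : expr) : nat :=
  match e with
  | Cst z => bitlen z
  | Reg e1 => expr_weight e1 + expr_width e1 + 1
  | Bin _ e1 e2 => expr_weight e1 + expr_weight e2 + expr_width e1 + expr_width e2
  end%N.

Definition test_weight (e : expr) : nat := (expr_weight e + expr_width e)%N.

(* If all registers stay below bit length B and every loop runs at most n     *)
(* times, then the cost of c is at most B * cmd_weight n c.                   *)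
Fixpoint cmd_weight (n : nat) (c : cmd) : nat :=
  match c with
  | Skip => 1
  | Assign e1 e2 => test_weight e1 + test_weight e2
  | Write e => test_weight e
  | Seq c1 c2 => cmd_weight n c1 + cmd_weight n c2
  | IfPos e c1 c2 => test_weight e + cmd_weight n c1 + cmd_weight n c2
  | WhilePos e c => n.+1 * test_weight e + n * cmd_weight n c
  end%N.

Definition bounded (B : nat) (m : memory) : Prop := forall a, (bitlen (m a) <= B)%N.

Lemma expr_width_gt0 e : (0 < expr_width e)%N.
Proof. by elim: e => //= o e1 h1 e2 h2; rewrite addn_gt0 h1. Qed.

Section cost.
Context (B n : nat).
Context (B0 : (0 < B)%N).

Lemma expr_val_bitlen m e : bounded B m -> (bitlen (expr_val m e) <= B * expr_width e)%N.
Proof.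
move=> bm; elim: e => [z|e _|o e1 h1 e2 h2] /=; [exact: leq_pmull|by rewrite muln1|].
have w1 : (0 < B * expr_width e1)%N by rewrite muln_gt0 B0 expr_width_gt0.
have w2 : (0 < B * expr_width e2)%N by rewrite muln_gt0 B0 expr_width_gt0.
rewrite mulnDr; move: h1 h2 w1 w2.
set y := expr_val m e1; set z := expr_val m e2.
set a := (B * _)%N; set b := (B * _)%N => hy hz a0 b0.
case: o => /=.
- by have := bitlenD y z; lia.
- by have := bitlenD y (- z); rewrite bitlenN; lia.
- by have := bitlenM y z; lia.
- by have := bitlen_divz y z; lia.
Qed.

Lemma expr_cost_weight m e : bounded B m -> (expr_cost m e <= B * expr_weight e)%N.
Proof.
move=> bm; elim: e => [z|e h|o e1 h1 e2 h2] /=; first exact: leq_pmull.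
  have := expr_val_bitlen e bm; have := bm (expr_val m e); nia.
by have := expr_val_bitlen e1 bm; have := expr_val_bitlen e2 bm; nia.
Qed.

Lemma test_cost_weight m e : bounded B m -> (test_cost m e <= B * test_weight e)%N.
Proof.
by move=> bm; rewrite /test_cost mulnDr leq_add ?expr_cost_weight ?expr_val_bitlen.
Qed.

(** Total correctness with a cost bound read off the syntax. Since the postcondition may itself be a
    [runs] statement, programs are verified by symbolic execution without counting steps. *)
Definition runs (c : cmd) (m : memory) (s : seq int)
    (Q : memory -> seq int -> Prop) : Prop :=
  exists m' s' t, [/\ exec c m s m' s' t, (t <= B * cmd_weight n c)%N & Q m' s'].

Lemma runs_imp c m s (Q Q' : memory -> seq int -> Prop) :
  (forall m' s', Q m' s' -> Q' m' s') -> runs c m s Q -> runs c m s Q'.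
Proof. by move=> QQ [m' [s' [t [? ? ?]]]]; exists m', s', t; split=> //; exact: QQ. Qed.

Lemma runs_skip m s (Q : memory -> seq int -> Prop) : Q m s -> runs Skip m s Q.
Proof. by move=> Qm; exists m, s, 1%N; split=> //; [exact: exec_skip|rewrite muln1]. Qed.

Lemma runs_assign e1 e2 m s (Q : memory -> seq int -> Prop) : bounded B m ->
  Q (update m (expr_val m e1) (expr_val m e2)) s -> runs (Assign e1 e2) m s Q.
Proof.
move=> bm Qm; do 3 eexists; split; [exact: exec_assign| |exact: Qm].
by rewrite /= mulnDr leq_add ?test_cost_weight.
Qed.

Lemma runs_write e m s (Q : memory -> seq int -> Prop) : bounded B m ->
  Q m (rcons s (expr_val m e)) -> runs (Write e) m s Q.
Proof.
by move=> bm Qm; do 3 eexists; split; [exact: exec_write|exact: test_cost_weight|exact: Qm].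
Qed.

Lemma runs_seq c1 c2 m s Q : runs c1 m s (fun m' s' => runs c2 m' s' Q) ->
  runs (Seq c1 c2) m s Q.
Proof.
move=> [m1 [s1 [t1 [e1 h1 [m2 [s2 [t2 [e2 h2 Qm]]]]]]]].
exists m2, s2, (t1 + t2)%N; split=> //; first exact: exec_seq e1 e2.
by rewrite /= mulnDr leq_add.
Qed.

Lemma runs_if e c1 c2 m s Q : bounded B m ->
  (0 < expr_val m e -> runs c1 m s Q) -> (expr_val m e <= 0 -> runs c2 m s Q) ->
  runs (IfPos e c1 c2) m s Q.
Proof.
move=> bm h1 h2; have tc := test_cost_weight e bm.
have [e0|e0] := ltP 0 (expr_val m e).
  have [m' [s' [t [ex ht Qm]]]] := h1 e0.
  exists m', s', (test_cost m e + t)%N; split=> //; first exact: exec_if_pos.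
  by move: tc ht; rewrite /= !mulnDr; lia.
have [m' [s' [t [ex ht Qm]]]] := h2 e0.
exists m', s', (test_cost m e + t)%N; split=> //; first exact: exec_if_npos.
by move: tc ht; rewrite /= !mulnDr; lia.
Qed.

(** The invariant is indexed by the number of completed rounds, so the same induction yields
    termination and the cost. *)
Lemma runs_while (cnt : nat) (I : nat -> memory -> seq int -> Prop) e c m s
    (Q : memory -> seq int -> Prop) :
  (cnt <= n)%N ->
  (forall k m' s', (k <= cnt)%N -> I k m' s' -> bounded B m') ->
  (forall k m' s', (k < cnt)%N -> I k m' s' ->
     0 < expr_val m' e /\ runs c m' s' (I k.+1)) ->
  (forall m' s', I cnt m' s' -> expr_val m' e <= 0 /\ Q m' s') ->
  I 0%N m s -> runs (WhilePos e c) m s Q.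
Proof.
move=> cn Ib Ic Iend I0.
have gen d : forall k m1 s1, I k m1 s1 -> (k + d)%N = cnt ->
    exists m' s' t, [/\ exec (WhilePos e c) m1 s1 m' s' t,
      (t <= B * (d.+1 * test_weight e + d * cmd_weight n c))%N & Q m' s'].
  elim: d => [|d IH] k m1 s1 Ik kd.
    rewrite addn0 in kd; rewrite kd in Ik.
    have [e0 Qm] := Iend _ _ Ik.
    exists m1, s1, (test_cost m1 e); split=> //; first exact: exec_while_npos.
    by rewrite mul1n mul0n addn0; apply: test_cost_weight; exact: Ib Ik.
  have kc : (k < cnt)%N by rewrite -kd -[X in (X < _)%N]addn0 ltn_add2l.
  have [e0 [m2 [s2 [t1 [ex1 h1 Ik1]]]]] := Ic _ _ _ kc Ik.
  have [|m3 [s3 [t2 [ex2 h2 Qm]]]] := IH _ _ _ Ik1; first by rewrite addSnnS.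
  exists m3, s3, (test_cost m1 e + t1 + t2)%N; split=> //; first exact: exec_while_pos ex1 ex2.
  have tc := test_cost_weight e (Ib _ _ _ (ltnW kc) Ik).
  rewrite [(d.+2 * _)%N]mulSn [(d.+1 * cmd_weight _ _)%N]mulSn.
  by move: tc h1 h2; rewrite !mulnDr; lia.
have [m' [s' [t [ex ht Qm]]]] := gen cnt 0%N m s I0 (erefl _).
exists m', s', t; split=> //; apply: leq_trans ht _ => /=.
rewrite leq_mul2l; apply/orP; right.
by apply: leq_add; rewrite leq_mul2r ?ltnS cn orbT.
Qed.

End cost.

(** * The separation program *)

Definition Add := Bin OpAdd.
Definition Sub := Bin OpSub.
Definition Mul := Bin OpMul.
Definition Div := Bin OpDiv.

Definition n_intervals : expr := Reg (Cst 0).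
Definition n_items : expr := Add (Reg (Cst 0)) (Reg (Cst 1)).

(* Euclidean division turns (e - M) / (M + N) into -1 for e < M, 0 otherwise. *)
Definition is_fixing (e : expr) : expr := Add (Cst 1) (Div (Sub e n_intervals) n_items).

(* Registers 0 to 3 hold M, N and sigma; the entries of the query start at    *)
(* register 4, the intervals at 4 + 2 M and the fixings at 4 + 6 M, with 2, 4 *)
(* and 3 registers each.                                                      *)
Definition key_address (e : expr) : expr :=
  Add (Add (Cst 4) (Mul (Cst 2) n_intervals))
    (Add (Mul (Cst 4) e) (Mul (is_fixing e) (Sub n_intervals e))).
Definition key_num e : expr := Reg (key_address e).
Definition key_den e : expr := Reg (Add (key_address e) (Cst 1)).

(** The flag [is_fixing] selects the address without a branch: for [e = M + j] the sum is
    [4 + 6 * M + 3 * j + 2], the last register of fixing [j]. *)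
Definition value_num e : expr :=
  Reg (Add (Add (Cst 4) (Mul (Cst 2) e))
    (Mul (is_fixing e) (Add (Add (Cst 2) (Mul (Cst 3) n_intervals)) e))).
Definition value_den e : expr :=
  Add (is_fixing e) (Mul (Sub (Cst 1) (is_fixing e)) (Reg (Add (Cst 5) (Mul (Cst 2) e)))).

Definition switch_bound : expr := Div (Reg (Cst 2)) (Reg (Cst 3)).
Definition switch_parity : expr :=
  Sub switch_bound (Mul (Cst 2) (Div switch_bound (Cst 2))).
Definition reflected_num e : expr :=
  Add (Mul switch_parity (value_den e))
    (Mul (Sub (Cst 1) (Mul (Cst 2) switch_parity)) (value_num e)).

Lemma nth_flatten_const (c : nat) (ss : seq (seq int)) (rest : seq int) i r :
  (forall y, y \in ss -> size y = c) -> (i < size ss)%N -> (r < c)%N ->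
  nth 0 (flatten ss ++ rest) (c * i + r) = nth 0 (nth [::] ss i) r.
Proof.
elim: ss i => // y ss IH i sc; rewrite /= -catA nth_cat (sc y) ?mem_head//.
case: i => [|i] /= si rc; first by rewrite muln0 add0n rc.
rewrite mulnS -addnA ltnNge leq_addr /= addKn IH// => y' y's.
by apply: sc; rewrite inE y's orbT.
Qed.

Lemma nth_flatten_ord (n c : nat) (F : 'I_n -> seq int) (rest : seq int) (i : 'I_n) r :
  (forall j, size (F j) = c) -> (r < c)%N ->
  nth 0 (flatten [seq F j | j <- enum 'I_n] ++ rest) (c * i + r) = nth 0 (F i) r.
Proof.
move=> Fc rc; rewrite (@nth_flatten_const c)//.
- by rewrite (nth_map i) ?nth_ord_enum// size_enum_ord.
- by move=> y /mapP[j _ ->].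
- by rewrite size_map size_enum_ord.
Qed.

Lemma size_flatten_ord (n c : nat) (F : 'I_n -> seq int) :
  (forall j, size (F j) = c) -> size (flatten [seq F j | j <- enum 'I_n]) = (c * n)%N.
Proof.
move=> Fc; rewrite -[X in (_ * X)%N]size_enum_ord.
by elim: (enum _) => [|j s IH] /=; rewrite ?muln0// size_cat IH Fc mulnS.
Qed.

(** * Reading the encoded instance *)

Section layout.
Context (x : instance).
Local Notation M := (nint x).
Local Notation N := (nfix x).
Local Notation inp := (enc_instance x).

Let queries := flatten [seq enc_rat (query x 0 i) | i <- enum 'I_M].
Let bounds := flatten [seq enc_rat (lo x i) ++ enc_rat (hi x i) | i <- enum 'I_M].
Let fixings := flatten [seq enc_rat (tau x j) ++ [:: (fixval x j : nat)%:Z] | j <- enum 'I_N].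

Let nth_body r : nth 0 inp (4 + r)%N = nth 0 (queries ++ bounds ++ fixings) r.
Proof. by rewrite -nth_drop /enc_instance /= drop0. Qed.

Let size_queries : size queries = (2 * M)%N.
Proof. exact: size_flatten_ord. Qed.

Let size_bounds : size bounds = (4 * M)%N.
Proof. exact: size_flatten_ord. Qed.

Lemma nth_query (i : 'I_M) r : (r < 2)%N ->
  nth 0 inp (4 + 2 * i + r)%N = nth 0 (enc_rat (query x 0 i)) r.
Proof. move=> r2; rewrite (_ : _ + r = 4 + (2 * i + r))%N; last by lia.
by rewrite nth_body nth_flatten_ord. Qed.

Lemma nth_bounds (i : 'I_M) r : (r < 4)%N ->
  nth 0 inp (4 + 2 * M + 4 * i + r)%N = nth 0 (enc_rat (lo x i) ++ enc_rat (hi x i)) r.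
Proof.
move=> r4; rewrite (_ : _ + r = 4 + (2 * M + (4 * i + r)))%N ?nth_body; last by lia.
rewrite nth_cat size_queries.
by rewrite ltnNge leq_addr addKn nth_flatten_ord.
Qed.

Lemma nth_fixing (j : 'I_N) r : (r < 3)%N ->
  nth 0 inp (4 + 6 * M + 3 * j + r)%N =
  nth 0 (enc_rat (tau x j) ++ [:: (fixval x j : nat)%:Z]) r.
Proof.
move=> r3; rewrite (_ : _ + r = 4 + (2 * M + (4 * M + (3 * j + r))))%N ?nth_body; last by lia.
rewrite nth_cat size_queries.
rewrite ltnNge leq_addr addKn nth_cat size_bounds ltnNge leq_addr addKn.
by rewrite -[fixings]cats0 nth_flatten_ord.
Qed.

Definition vnum (i : item x) : int :=
  match fintype.split i with inl k => numq (query x 0 k) | inr j => (fixval x j : nat)%:Z end.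
Definition vden (i : item x) : int :=
  match fintype.split i with inl k => denq (query x 0 k) | inr j => 1 end.

Lemma vden_gt0 i : 0 < vden i.
Proof. by rewrite /vden; case: fintype.split. Qed.

Lemma valueE i : value i = (vnum i)%:~R / (vden i)%:~R.
Proof.
rewrite /value /vnum /vden; case: fintype.split => [k|j]; first by rewrite divq_num_den.
by rewrite divr1.
Qed.

Definition rnum (i : item x) : int :=
  (odd (max_switches x) : nat)%:Z * vden i
  + (1 - 2 * (odd (max_switches x) : nat)%:Z) * vnum i.

Lemma reflect_valueE (i : item x) :
  reflect_value x (value i) = (rnum i)%:~R / (vden i)%:~R.
Proof.
rewrite /rnum /reflect_value valueE.
have dn0 : (vden i)%:~R != 0 :> rat by rewrite intr_eq0 gt_eqF// vden_gt0.
case: (odd _) => /=; last by rewrite mul0r add0r mulr0 subr0 mul1r.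
by rewrite mul1r mulr1 (_ : 1 - 2 = -1 :> int)// mulN1r rmorphB /= mulrBl divff.
Qed.

Section eval.
Context (l : seq int).
Local Notation m := (memory_of inp l).

Lemma expr_val_fixing (i : item x) (e : expr) : expr_val m e = (i : nat)%:Z ->
  expr_val m (is_fixing e) = (fixing i : nat)%:Z.
Proof.
move=> ei; rewrite /= ei /= /fixing.
have iL := ltn_ord i; have [iM|Mi] := ltnP i M.
  have -> : (i : nat)%:Z - M%:Z = - 1 * (M + N)%N%:Z + (N + i)%N%:Z by lia.
  rewrite -PoszD divzMDl ?divz_small//; lia.
by rewrite divz_small//; lia.
Qed.

Lemma expr_val_key (i : item x) (e : expr) : expr_val m e = (i : nat)%:Z ->
  expr_val m (key_num e) = numq (key i) /\ expr_val m (key_den e) = denq (key i).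
Proof.
move=> ei; have fi := expr_val_fixing ei; rewrite fixing_split in fi.
have aE : expr_val m (key_address e) =
    (4 + 2 * M + 4 * i)%N%:Z + expr_val m (is_fixing e) * (M%:Z - i%:Z).
  by rewrite /key_address /= ei; lia.
have nE : expr_val m (key_num e) = m (expr_val m (key_address e)) by [].
have dE : expr_val m (key_den e) = m (expr_val m (key_address e) + 1) by [].
rewrite nE dE aE fi /key; move: (ltn_ord i); case: splitP => [k ik|j ij] _.
  have -> : (4 + 2 * M + 4 * i)%N%:Z + (false : nat)%:Z * (M%:Z - i%:Z) = (4 + 2 * M + 4 * k + 0)%N%:Z.
    by rewrite ik; lia.
  have -> : (4 + 2 * M + 4 * k + 0)%N%:Z + 1 = (4 + 2 * M + 4 * k + 1)%N%:Z by lia.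
  by rewrite /memory_of !nth_bounds.
have -> : (4 + 2 * M + 4 * i)%N%:Z + (true : nat)%:Z * (M%:Z - i%:Z) = (4 + 6 * M + 3 * j + 0)%N%:Z.
  by rewrite ij; lia.
have -> : (4 + 6 * M + 3 * j + 0)%N%:Z + 1 = (4 + 6 * M + 3 * j + 1)%N%:Z by lia.
by rewrite /memory_of !nth_fixing.
Qed.

Lemma expr_val_value (i : item x) (e : expr) : expr_val m e = (i : nat)%:Z ->
  expr_val m (value_num e) = vnum i /\ expr_val m (value_den e) = vden i.
Proof.
move=> ei; have fi := expr_val_fixing ei; rewrite fixing_split in fi.
have nE : expr_val m (value_num e) = m ((4 + 2 * i)%N%:Z
    + expr_val m (is_fixing e) * (2 + 3 * M + i)%N%:Z).
  have -> : (4 + 2 * i)%N%:Z = 4 + 2 * expr_val m e by rewrite ei; lia.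
  have -> : (2 + 3 * M + i)%N%:Z = 2 + 3 * M%:Z + expr_val m e by rewrite ei; lia.
  by [].
have dE : expr_val m (value_den e) = expr_val m (is_fixing e)
    + (1 - expr_val m (is_fixing e)) * m (4 + 2 * i + 1)%N%:Z.
  have -> : (4 + 2 * i + 1)%N%:Z = 5 + 2 * expr_val m e by rewrite ei; lia.
  by [].
rewrite nE dE fi /vnum /vden; move: (ltn_ord i); case: splitP => [k ik|j ij] _.
  have -> : (4 + 2 * i)%N%:Z + (false : nat)%:Z * (2 + 3 * M + i)%N%:Z = (4 + 2 * k + 0)%N%:Z.
    by rewrite ik; lia.
  by rewrite ik /memory_of !nth_query//= subr0 mul1r add0r.
have -> : (4 + 2 * i)%N%:Z + (true : nat)%:Z * (2 + 3 * M + i)%N%:Z = (4 + 6 * M + 3 * j + 2)%N%:Z.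
  by rewrite ij; lia.
by rewrite /memory_of nth_fixing//= subrr mul0r addr0.
Qed.

Lemma expr_val_switch_bound : 0 <= sigma x ->
  expr_val m switch_bound = (max_switches x)%:Z.
Proof.
move=> s0; rewrite /max_switches gez0_abs// divz_ge0 ?denq_gt0//.
by rewrite numq_ge0.
Qed.

Lemma expr_val_parity : 0 <= sigma x ->
  expr_val m switch_parity = (odd (max_switches x) : nat)%:Z.
Proof.
move=> s0; have kE := expr_val_switch_bound s0.
have -> : expr_val m switch_parity = expr_val m switch_bound
   - 2 * (expr_val m switch_bound %/ 2)%Z by [].
rewrite kE divz_nat divn2.
by have := odd_double_half (max_switches x); lia.
Qed.

Lemma expr_val_reflected (i : item x) (e : expr) : 0 <= sigma x ->
  expr_val m e = (i : nat)%:Z -> expr_val m (reflected_num e) = rnum i.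
Proof.
move=> s0 ei; have [n_E d_E] := expr_val_value ei.
have -> : expr_val m (reflected_num e) = expr_val m switch_parity * expr_val m (value_den e)
  + (1 - 2 * expr_val m switch_parity) * expr_val m (value_num e) by [].
by rewrite expr_val_parity// n_E d_E.
Qed.

End eval.
End layout.

Opaque is_fixing key_num key_den value_num value_den switch_bound reflected_num.

Lemma sum_ltS (V : nmodType) (n : nat) (F : 'I_n -> V) (t : 'I_n) :
  \sum_(j < n | (j < t.+1)%N) F j = \sum_(j < n | (j < t)%N) F j + F t.
Proof.
rewrite (bigD1 t)//= addrC; congr (_ + _); apply: eq_bigl => j.
by rewrite ltnS andbC ltn_neqAle.
Qed.

Lemma sum_lt_all (V : nmodType) (n : nat) (F : 'I_n -> V) : \sum_(j < n | (j < n)%N) F j = \sum_j F j.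
Proof. by apply: eq_bigl => j; rewrite ltn_ord. Qed.

Lemma absz_sum_le (n c : nat) (F : 'I_n -> int) (P : pred 'I_n) :
  (forall j, (`|F j| <= c)%N) -> (`|(\sum_(j < n | P j) F j)%R| <= c * n)%N.
Proof.
move=> Fc; rewrite -lez_nat abszE; apply: le_trans (ler_norm_sum _ _ _) _.
apply: (@le_trans _ _ (\sum_(j < n) c%:Z)).
  rewrite big_mkcond; apply: ler_sum => j _; case: (P j) => //.
  by rewrite -abszE lez_nat.
by rewrite sumr_const card_ord -mulr_natr -natz -natrM natz.
Qed.

Lemma bitlen_small z m : (`|z| <= m)%N -> (bitlen z <= m.+1)%N.
Proof. by move=> zm; rewrite bitlen_le//; apply: leq_ltn_trans zm (ltnW (ltn_expl _ _)). Qed.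

(** The machine only tests positivity; over the integers [1 - z * z] is positive exactly at 0. *)
Lemma zero_test_gt0 (z : int) : (0 < 1 - z * z) = (z == 0).
Proof. by apply/idP/eqP => [h|->//]; nia. Qed.

(** Comparing squares avoids computing the absolute value of a rank difference. *)
Lemma square_eq0 (d : int) (r : nat) : (d * d - r%:Z * r%:Z == 0) = (absz d == r).
Proof. by rewrite subr_eq0 -!expr2 eqf_sqr; lia. Qed.

Notation reg_i := 0%N (only parsing).
Notation reg_k := 1%N (only parsing).
Notation reg_j := 2%N (only parsing).
Notation reg_a := 3%N (only parsing).
Notation reg_d := 4%N (only parsing).

(* Keys are compared through their numerators and denominators; the factor 2  *)
(* lets the test for a fixing only break ties.                                *)
Definition before_test (j i : expr) : expr :=
  Add (Mul (Cst 2) (Sub (Mul (key_num i) (key_den j)) (Mul (key_num j) (key_den i))))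
    (Sub (is_fixing j) (is_fixing i)).

Definition increment k := set_var k (Add (var k) (Cst 1)).
Definition decrement k := set_var k (Sub (var k) (Cst 1)).
Definition zero_test (e : expr) : expr := Sub (Cst 1) (Mul e e).

Definition add_comparison (n1 d1 n2 d2 : expr) : cmd :=
  Seq (IfPos (Sub (Mul n1 d2) (Mul n2 d1)) (increment reg_a) Skip)
      (IfPos (Sub (Mul n2 d1) (Mul n1 d2)) (decrement reg_a) Skip).

(** One pass over the items accumulates both counts with opposite signs. It is repeated for every
    pair, which costs time but spares an array of ranks. *)
Definition rank_difference : cmd :=
  Seq (set_var reg_d (Cst 0)) (Seq (set_var reg_j (Cst 0))
    (WhilePos (Sub n_items (var reg_j))
      (Seq (IfPos (before_test (var reg_j) (var reg_i)) (increment reg_d) Skip)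
      (Seq (IfPos (before_test (var reg_j) (var reg_k)) (decrement reg_d) Skip)
           (increment reg_j))))).

Definition coefficient : cmd :=
  Seq (set_var reg_a (Cst 0)) (Seq (set_var reg_k (Cst 0))
    (WhilePos (Sub n_items (var reg_k))
      (Seq rank_difference
      (Seq (IfPos (zero_test (Sub (Mul (var reg_d) (var reg_d)) (Cst 1)))
             (add_comparison (value_num (var reg_i)) (value_den (var reg_i))
                             (value_num (var reg_k)) (value_den (var reg_k))) Skip)
      (Seq (IfPos (zero_test (Sub (Mul (var reg_d) (var reg_d))
                      (Mul (Sub n_items (Cst 1)) (Sub n_items (Cst 1)))))
             (add_comparison (value_num (var reg_i)) (value_den (var reg_i))
                             (reflected_num (var reg_k)) (value_den (var reg_k))) Skip)
           (increment reg_k)))))).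

Section runs.
Context (x : instance).
Local Notation inp := (enc_instance x).
Local Notation L := (nint x + nfix x)%N.
Local Notation st := (memory_of inp).

(** Bounds the bit lengths of the unreduced fraction after [k] rounds of [total]: a round adds those
    of one coefficient, a value and a denominator, generously estimated. At [k] equal to the input
    size it serves as the register bound of the whole run. *)
Definition bit_bound (k : nat) : nat :=
  (k * (5 * input_size inp + 10) + 5 * input_size inp + 10)%N.
Local Notation B := (bit_bound (input_size inp)).
Local Notation small z := (absz z%R <= 2 * input_size inp + 4)%N.
Local Notation run := (runs B (input_size inp)).

Lemma bit_bound_gt0 : (0 < B)%N.
Proof. by rewrite /bit_bound addn_gt0 orbT. Qed.

Lemma input_bitlen z : z \in inp -> (bitlen z <= input_size inp)%N.
Proof. by move=> zi; rewrite /input_size (big_rem z)//= leq_addr. Qed.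

Lemma size_inp : size inp = (4 + 6 * nint x + 3 * nfix x)%N.
Proof.
rewrite /enc_instance !size_cat (@size_flatten_ord _ 2)// (@size_flatten_ord _ 4)//.
by rewrite (@size_flatten_ord _ 3)//=; lia.
Qed.

(** Every input register counts at least one bit; hence the input size is a legitimate bound for the
    rounds of all loops. *)
Lemma items_le_size : (L <= input_size inp)%N.
Proof.
apply: (@leq_trans (size inp)); first by rewrite size_inp; lia.
by rewrite -sum1_size; apply: leq_sum => z _.
Qed.

Lemma small_bitlen z : small z -> (bitlen z <= B)%N.
Proof.
move=> /bitlen_small h; apply: leq_trans h _; rewrite /bit_bound.
by move: (input_size inp) => s; lia.
Qed.

Lemma bounded_state l : all (fun z => (bitlen z <= B)%N) l -> bounded B (st l).
Proof.
move=> /allP h [k|k] /=.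
  have [ks|ks] := ltnP k (size inp); last by rewrite nth_default// bit_bound_gt0.
  apply: leq_trans (input_bitlen (mem_nth 0 ks)) _; rewrite /bit_bound.
  by move: (input_size inp) => s; lia.
have [ks|ks] := ltnP k (size l); last by rewrite nth_default// bit_bound_gt0.
exact: h (mem_nth 0 ks).
Qed.

Lemma run_set_var k e l s Q : all (fun z => (bitlen z <= B)%N) l ->
  Q (st (set_nth 0 l k (expr_val (st l) e))) s -> run (set_var k e) (st l) s Q.
Proof.
move=> hl Qm; apply: runs_assign; first exact: bit_bound_gt0.
  exact: bounded_state.
by rewrite update_memory_of.
Qed.

Lemma before_testP l (j i : item x) (ej ei : expr) :
  expr_val (st l) ej = (j : nat)%:Z -> expr_val (st l) ei = (i : nat)%:Z ->
  (0 < expr_val (st l) (before_test ej ei)) = before j i.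
Proof.
move=> hj hi; have [jn jd] := expr_val_key hj; have [in_ id_] := expr_val_key hi.
have -> : expr_val (st l) (before_test ej ei) =
  2 * (expr_val (st l) (key_num ei) * expr_val (st l) (key_den ej)
       - expr_val (st l) (key_num ej) * expr_val (st l) (key_den ei))
  + (expr_val (st l) (is_fixing ej) - expr_val (st l) (is_fixing ei)) by [].
rewrite jn jd in_ id_ (expr_val_fixing hj) (expr_val_fixing hi) /before.
have dj := denq_gt0 (key j); have di := denq_gt0 (key i).
have lt_E : (key j < key i) = (numq (key j) * denq (key i) < numq (key i) * denq (key j)).
  rewrite -{1}(divq_num_den (key j)) -{1}(divq_num_den (key i)).
  by rewrite ltr_pdivrMr ?ltr0z// mulrAC ltr_pdivlMr ?ltr0z// -!intrM ltr_int.
have eq_E : (key j == key i) = (numq (key j) * denq (key i) == numq (key i) * denq (key j)).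
  rewrite -{1}(divq_num_den (key j)) -{1}(divq_num_den (key i)).
  have dj' : (denq (key j))%:~R != 0 :> rat by rewrite intr_eq0 gt_eqF.
  have di' : (denq (key i))%:~R != 0 :> rat by rewrite intr_eq0 gt_eqF.
  by rewrite (eqr_div _ _ dj' di') -!intrM eqr_int.
rewrite lt_E eq_E; move: (numq (key j) * _) (numq (key i) * _) => a b.
by case: (fixing j); case: (fixing i); case: ltgtP => ? /=; lia.
Qed.

Lemma bitlen_index (t : nat) : (t <= L)%N -> (bitlen t%:Z <= B)%N.
Proof. by move=> tL; apply: small_bitlen => /=; have := items_le_size; lia. Qed.

Lemma bitlen_item (i : item x) : (bitlen (i : nat)%:Z <= B)%N.
Proof. exact/bitlen_index/ltnW. Qed.

Lemma run_rank_difference (i k : item x) j a d rest s Q :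
  all (fun z => (bitlen z <= B)%N) [:: j, a, d & rest] ->
  Q (st [:: (i : nat)%:Z, (k : nat)%:Z, L%:Z, a, (rank i)%:Z - (rank k)%:Z & rest]) s ->
  run rank_difference (st [:: (i : nat)%:Z, (k : nat)%:Z, j, a, d & rest]) s Q.
Proof.
move=> /and4P[hj ha hd hrest] HQ.
have hi := bitlen_item i; have hk := bitlen_item k.
pose F (q : item x) : int := (before q i : nat)%:Z - (before q k : nat)%:Z.
pose D t : int := \sum_(q : item x | (q < t)%N) F q.
have smallD t : small (D t).
  have h : (`|D t| <= 1 * L)%N.
    by apply: absz_sum_le => q; rewrite /F; case: before; case: before.
  by apply: leq_trans h _; have := items_le_size; lia.
have hD t : (bitlen (D t) <= B)%N by exact: small_bitlen.
have h0 : (bitlen 0 <= B)%N by rewrite small_bitlen.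
apply: runs_seq; apply: run_set_var; first by rewrite /= hi hk hj ha hd.
apply: runs_seq; apply: run_set_var; first by rewrite /= hi hk hj ha h0.
apply: (@runs_while _ _ bit_bound_gt0 L (fun t m' s' =>
   m' = st [:: (i : nat)%:Z, (k : nat)%:Z, t%:Z, a, D t & rest] /\ s' = s)).
- exact: items_le_size.
- move=> t m' s' tL [-> _]; apply: bounded_state.
  by rewrite /= hi hk ha hD bitlen_index.
- move=> t m' s' tL [-> ->]; split; first by rewrite /= subr_gt0 ltz_nat.
  have ht : (bitlen t%:Z <= B)%N by rewrite bitlen_index// ltnW.
  pose q : item x := Ordinal tL.
  have small1 (b : bool) : (bitlen (D t + (b : nat)%:Z) <= B)%N.
    by apply: small_bitlen; have h : (`|D t| <= 1 * L)%N;
      [apply: absz_sum_le => r; rewrite /F; case: before; case: before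
      |have := items_le_size; case: b; lia].
  apply: runs_seq; apply: (runs_imp (Q := fun m1 s1 =>
    m1 = st [:: (i : nat)%:Z, (k : nat)%:Z, t%:Z, a, D t + (before q i : nat)%:Z & rest] /\ s1 = s)).
    move=> m1 s1 [-> ->].
    apply: runs_seq; apply: (runs_imp (Q := fun m1 s1 =>
      m1 = st [:: (i : nat)%:Z, (k : nat)%:Z, t%:Z, a, D t.+1 & rest] /\ s1 = s)).
      move=> m2 s2 [-> ->].
      apply: run_set_var; first by rewrite /= hi hk ha hD ht.
      by rewrite /=; split => //; congr (st [:: _, _, _, _, _ & _]); lia.
    have DS : D t.+1 = D t + (before q i : nat)%:Z - (before q k : nat)%:Z.
      by rewrite /D (sum_ltS F q) /F addrA.
    have ok2 : all (fun z => (bitlen z <= B)%N)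
        [:: (i : nat)%:Z, (k : nat)%:Z, t%:Z, a, D t + (before q i : nat)%:Z & rest].
      by rewrite /= hi hk ha ht small1.
    apply: runs_if; [exact: bit_bound_gt0|exact: bounded_state| |].
    + rewrite (@before_testP _ q k) // => bqk.
      apply: run_set_var => //.
      by rewrite /= DS bqk.
    + rewrite leNgt (@before_testP _ q k) // => /negPf bqk.
      by apply: runs_skip; [exact: bit_bound_gt0|rewrite DS bqk subr0].
  have ok1 : all (fun z => (bitlen z <= B)%N)
      [:: (i : nat)%:Z, (k : nat)%:Z, t%:Z, a, D t & rest].
    by rewrite /= hi hk ha ht hD.
  apply: runs_if; [exact: bit_bound_gt0|exact: bounded_state| |].
  + by rewrite (@before_testP _ q i) // => bqi; apply: run_set_var => //=; rewrite bqi.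
  + rewrite leNgt (@before_testP _ q i) // => /negPf bqi.
    by apply: runs_skip; [exact: bit_bound_gt0|rewrite bqi addr0].
- move=> m' s' [-> ->]; split; first by rewrite /= subrr.
  have -> : D L = (rank i)%:Z - (rank k)%:Z; last exact: HQ.
  by rewrite /D sum_lt_all sumrB /rank !(big_morph Posz PoszD (erefl (0%N : int))).
- split=> //; rewrite /= /D big_pred0//.
Qed.

Lemma run_add_comparison i k j a d rest n1 d1 n2 d2 (u1 w1 u2 w2 : int) s Q :
  (forall a', let m := st [:: i, k, j, a', d & rest] in
     [/\ expr_val m n1 = u1, expr_val m d1 = w1, expr_val m n2 = u2 & expr_val m d2 = w2]) ->
  0 < w1 -> 0 < w2 -> small a -> small (a + 1) -> small (a - 1) ->
  all (fun z => (bitlen z <= B)%N) [:: i, k, j, d & rest] ->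
  Q (st [:: i, k, j, a + compare (u1%:~R / w1%:~R) (u2%:~R / w2%:~R), d & rest]) s ->
  run (add_comparison n1 d1 n2 d2) (st [:: i, k, j, a, d & rest]) s Q.
Proof.
move=> ev w10 w20 sa sa1 sa2 /and5P[hi hk hj hd hrest].
have lt_E (p1 q1 p2 q2 : int) : 0 < q1 -> 0 < q2 ->
    (p1%:~R / q1%:~R < p2%:~R / q2%:~R :> rat) = (0 < p2 * q1 - p1 * q2).
  move=> q10 q20; rewrite ltr_pdivrMr ?ltr0z// mulrAC ltr_pdivlMr ?ltr0z//.
  by rewrite -!intrM ltr_int subr_gt0.
rewrite /compare !lt_E//; set c1 := _ < _; set c2 := _ < _ => HQ.
have ok a' : small a' -> all (fun z => (bitlen z <= B)%N) [:: i, k, j, a', d & rest].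
  by move=> /small_bitlen ha'; rewrite /= hi hk hj hd ha'.
apply: runs_seq; apply: (runs_imp (Q := fun m1 s1 =>
    m1 = st [:: i, k, j, a + (c1 : nat)%:Z, d & rest] /\ s1 = s)).
  move=> m1 s1 [-> ->].
  have sc : small (a + (c1 : nat)%:Z) by case: (c1); rewrite ?addr0.
  have [e1 e2 e3 e4] := ev (a + (c1 : nat)%:Z).
  apply: runs_if; [exact: bit_bound_gt0|apply/bounded_state/ok|..] => //.
    rewrite /= e1 e2 e3 e4 -/c2 => c2t; apply: run_set_var; first exact: ok.
    by move: HQ; rewrite c2t /= addrA.
  rewrite /= e1 e2 e3 e4 leNgt -/c2 => /negPf c2f.
  by apply: runs_skip; [exact: bit_bound_gt0|move: HQ; rewrite c2f subr0].
have [e1 e2 e3 e4] := ev a.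
apply: runs_if; [exact: bit_bound_gt0|apply/bounded_state/ok|..] => //.
  rewrite /= e1 e2 e3 e4 -/c1 => c1t; apply: run_set_var; first exact: ok.
  by rewrite c1t.
rewrite /= e1 e2 e3 e4 leNgt -/c1 => /negPf c1f.
by apply: runs_skip; [exact: bit_bound_gt0|rewrite c1f addr0].
Qed.

Context (sigma0 : 0 <= sigma x).

Lemma run_coefficient (i : item x) k j a d rest s Q :
  all (fun z => (bitlen z <= B)%N) [:: k, j, a, d & rest] ->
  (forall d', (bitlen d' <= B)%N ->
     Q (st [:: (i : nat)%:Z, L%:Z, L%:Z, coef i, d' & rest]) s) ->
  run coefficient (st [:: (i : nat)%:Z, k, j, a, d & rest]) s Q.
Proof.
move=> /and5P[hk hj ha hd hrest] HQ.
have hi := bitlen_item i.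
pose F (q : item x) : int := (rank_dist i q == 1%N)%:Z * compare (value i) (value q).
pose G (q : item x) : int := (rank_dist i q == L.-1)%:Z
       * compare (value i) (reflect_value x (value q)).
pose A t : int := \sum_(q : item x | (q < t)%N) (F q + G q).
have cmp1 (b : nat) u v : (absz (b%:Z * compare u v)%R <= b)%N.
  by rewrite /compare; case: ltgtP; lia.
have smallF q : (`|F q| <= 1)%N.
  by apply: leq_trans (cmp1 _ _ _) _; case: eqP.
have smallG q : (`|G q| <= 1)%N.
  by apply: leq_trans (cmp1 _ _ _) _; case: eqP.
have leA t : (`|A t| <= 2 * L)%N.
  by apply: absz_sum_le => q; have := smallF q; have := smallG q; lia.
have Ls := items_le_size.
have hA t : (bitlen (A t) <= B)%N by apply: small_bitlen; have := leA t; lia.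
have h0 : (bitlen 0 <= B)%N by rewrite small_bitlen.
apply: runs_seq; apply: run_set_var; first by rewrite /= hi hk hj ha hd.
apply: runs_seq; apply: run_set_var; first by rewrite /= hi hk hj h0 hd.
(* The last clause records that [reg_j] ends at [L], which is true only after a first round; the
   alternative [L = 0] is excluded at the end by the existence of [i]. *)
apply: (@runs_while _ _ bit_bound_gt0 L (fun t m' s' => exists j' d',
   [/\ m' = st [:: (i : nat)%:Z, t%:Z, j', A t, d' & rest], s' = s,
     (bitlen j' <= B)%N, (bitlen d' <= B)%N & (t = L -> j' = L%:Z \/ L = 0%N)])).
- exact: items_le_size.
- move=> t m' s' tL [j' [d' [-> _ hj' hd' _]]]; apply: bounded_state.
  by rewrite /= hi hj' hd' hA bitlen_index.
- move=> t m' s' tL [j' [d' [-> -> hj' hd' _]]]; split; first by rewrite /= subr_gt0 ltz_nat.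
  have ht : (bitlen t%:Z <= B)%N by rewrite bitlen_index// ltnW.
  pose q : item x := Ordinal tL.
  have hL : (bitlen L%:Z <= B)%N by exact: bitlen_index.
  have AS : A t.+1 = A t + F q + G q by rewrite /A (sum_ltS _ q) addrA.
  apply: runs_seq; apply: (@run_rank_difference i q); first by rewrite /= hj' hA hd'.
  set dl := (rank i)%:Z - (rank q)%:Z.
  have hdl : (bitlen dl <= B)%N.
    apply: small_bitlen; have := rank_lt i; have := rank_lt q; rewrite /dl.
    by move: Ls; lia.
  have hall a' : small a' -> all (fun z => (bitlen z <= B)%N)
      [:: (i : nat)%:Z, t%:Z, L%:Z, a', dl & rest].
    by move=> /small_bitlen ha'; rewrite /= hi ht hL ha' hdl.
  have ev a' := @expr_val_value x [:: (i : nat)%:Z, t%:Z, L%:Z, a', dl & rest].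
  have wi := vden_gt0 i; have wq := vden_gt0 q.
  have adjE : (1 - (dl * dl - 1) * (dl * dl - 1) > 0) = (rank_dist i q == 1%N).
    by rewrite zero_test_gt0 (square_eq0 dl 1).
  have wrapE : (1 - (dl * dl - (L%:Z - 1) * (L%:Z - 1)) * (dl * dl - (L%:Z - 1) * (L%:Z - 1)) > 0)
      = (rank_dist i q == L.-1).
    have L0 : (0 < L)%N by apply: (leq_ltn_trans (leq0n t) (tL)).
    have -> : L%:Z - 1 = (L.-1)%:Z by lia.
    by rewrite zero_test_gt0 square_eq0.
  apply: runs_seq; apply: (runs_imp (Q := fun m1 s1 =>
      m1 = st [:: (i : nat)%:Z, t%:Z, L%:Z, A t + F q, dl & rest] /\ s1 = s)).
    move=> m1 s1 [-> ->].
    have sF : small (A t + F q) by have := leA t; have := smallF q; lia.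
    apply: runs_seq; apply: (runs_imp (Q := fun m1 s1 =>
        m1 = st [:: (i : nat)%:Z, t%:Z, L%:Z, A t.+1, dl & rest] /\ s1 = s)).
      move=> m2 s2 [-> ->]; apply: run_set_var.
        by apply: hall; have := leA t.+1; lia.
      exists L%:Z, dl; split=> //=; last by left.
      by congr (st [:: _, _, _, _, _ & _]); lia.
    apply: runs_if; [exact: bit_bound_gt0|exact/bounded_state/hall| |].
      rewrite [X in 0 < X](_ : _ = 1 - (dl * dl - (L%:Z - 1) * (L%:Z - 1))
         * (dl * dl - (L%:Z - 1) * (L%:Z - 1)))// wrapE => wr.
      apply: (@run_add_comparison _ _ _ _ _ _ _ _ _ _ (vnum i) (vden i)
         (rnum q) (vden q)) => //.
      - move=> a' m0; rewrite {}/m0; have [-> ->] := ev a' i (var reg_i) erefl.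
        have [_ ->] := ev a' q (var reg_k) erefl; split=> //.
        exact: expr_val_reflected.
      - by have := leA t; have := smallF q; lia.
      - by have := leA t; have := smallF q; lia.
      - by rewrite /= hi ht hL hdl.
      - split=> //; rewrite -valueE -reflect_valueE AS.
        by rewrite /G wr mul1r.
    rewrite leNgt [X in 0 < X](_ : _ = 1 - (dl * dl - (L%:Z - 1) * (L%:Z - 1))
       * (dl * dl - (L%:Z - 1) * (L%:Z - 1)))// wrapE => /negPf wr.
    by apply: runs_skip; [exact: bit_bound_gt0|rewrite AS /G wr mul0r addr0].
  have sA : small (A t) by have := leA t; lia.
  apply: runs_if; [exact: bit_bound_gt0|exact/bounded_state/hall| |].
    rewrite [X in 0 < X](_ : _ = 1 - (dl * dl - 1) * (dl * dl - 1))// adjE => ad.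
    apply: (@run_add_comparison _ _ _ _ _ _ _ _ _ _ (vnum i) (vden i) (vnum q) (vden q)) => //.
    - move=> a' m0; rewrite {}/m0; have [-> ->] := ev a' i (var reg_i) erefl.
      by have [-> ->] := ev a' q (var reg_k) erefl.
    - by have := leA t; lia.
    - by have := leA t; lia.
    - by rewrite /= hi ht hL hdl.
    - by split=> //; rewrite -!valueE /F ad mul1r.
  rewrite leNgt [X in 0 < X](_ : _ = 1 - (dl * dl - 1) * (dl * dl - 1))// adjE => /negPf ad.
  by apply: runs_skip; [exact: bit_bound_gt0|rewrite /F ad mul0r addr0].
- move=> m' s' [j' [d' [-> -> hj' hd' jL]]]; split; first by rewrite /= subrr.
  have -> : A L = coef i by rewrite /A sum_lt_all.
  have [->|L0] := jL erefl; first exact: HQ.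
  by exfalso; move: (leq_ltn_trans (leq0n i) (ltn_ord i)); rewrite L0.
- exists j, d; split=> //.
    by rewrite /A big_pred0.
  by move=> L0; right.
Qed.

End runs.

Notation reg_sum_num := 5%N (only parsing).
Notation reg_sum_den := 6%N (only parsing).
Notation reg_bound := 7%N (only parsing).
Notation reg_outside := 8%N (only parsing).

(* [reg_outside] is set to - (i + 1) if entry i of the query is negative, to  *)
(* i + 1 if it exceeds 1, and remains 0 if the query is in the unit box.      *)
Definition box_check : cmd :=
  Seq (set_var reg_outside (Cst 0)) (Seq (set_var reg_i (Cst 0))
    (WhilePos (Sub n_intervals (var reg_i))
      (Seq (IfPos (Sub (Cst 0) (value_num (var reg_i)))
             (set_var reg_outside (Sub (Cst 0) (Add (var reg_i) (Cst 1)))) Skip)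
      (Seq (IfPos (Sub (value_num (var reg_i)) (value_den (var reg_i)))
             (set_var reg_outside (Add (var reg_i) (Cst 1))) Skip)
           (increment reg_i))))).

(** The cut is a signed unit vector: [- w_k <= 0] or [w_k <= 1], according to the sign of
    [reg_outside]. *)
Definition box_output : cmd :=
  Seq (Write (Cst 0)) (Seq (set_var reg_i (Cst 0))
  (Seq (WhilePos (Sub n_intervals (var reg_i))
      (Seq (set_var reg_a (Cst 0))
      (Seq (IfPos (zero_test (Sub (var reg_outside) (Add (var reg_i) (Cst 1))))
             (set_var reg_a (Cst 1)) Skip)
      (Seq (IfPos (zero_test (Add (var reg_outside) (Add (var reg_i) (Cst 1))))
             (set_var reg_a (Cst (-1))) Skip)
      (Seq (Write (var reg_a)) (Seq (Write (Cst 1)) (increment reg_i)))))))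
  (Seq (set_var reg_a (Cst 0))
  (Seq (IfPos (var reg_outside) (set_var reg_a (Cst 1)) Skip)
  (Seq (Write (var reg_a)) (Write (Cst 1))))))).

(** The sum is kept as an unreduced fraction. Its denominator is a product over the items, but bit
    lengths only add up, so it stays of polynomial size. *)
Definition total : cmd :=
  Seq (set_var reg_sum_num (Cst 0)) (Seq (set_var reg_sum_den (Cst 1))
  (Seq (set_var reg_bound (Mul (Cst 2) switch_bound)) (Seq (set_var reg_i (Cst 0))
    (WhilePos (Sub n_items (var reg_i))
      (Seq coefficient
      (Seq (set_var reg_sum_num
             (Add (Mul (var reg_sum_num) (value_den (var reg_i)))
                  (Mul (Mul (var reg_a) (Sub (Mul (Cst 2) (value_num (var reg_i)))
                                             (value_den (var reg_i))))
                       (var reg_sum_den))))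
      (Seq (set_var reg_sum_den (Mul (var reg_sum_den) (value_den (var reg_i))))
      (Seq (set_var reg_bound (Add (var reg_bound) (Mul (var reg_a)
             (Sub (Cst 1) (Mul (Mul (Cst 2) (is_fixing (var reg_i)))
                               (value_num (var reg_i)))))))
           (increment reg_i))))))))).

Definition cut_output : cmd :=
  Seq (Write (Cst 0)) (Seq (set_var reg_i (Cst 0))
  (Seq (WhilePos (Sub n_intervals (var reg_i))
      (Seq coefficient
      (Seq (Write (Mul (Cst 2) (var reg_a))) (Seq (Write (Cst 1)) (increment reg_i)))))
  (Seq (Write (var reg_bound)) (Write (Cst 1))))).

(** Squaring [reg_outside] detects either sign. The variation is tested only inside the unit box,
    where the sampling argument applies. *)
Definition separation : cmd :=
  Seq box_check
  (IfPos (Mul (var reg_outside) (var reg_outside)) box_output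
    (Seq total
    (IfPos (Sub (var reg_sum_num) (Mul (Mul (Cst 2) switch_bound) (var reg_sum_den)))
       cut_output (Write (Cst 1))))).

Lemma take_enum_ordS (n : nat) (t : 'I_n) :
  take t.+1 (enum 'I_n) = rcons (take t (enum 'I_n)) t.
Proof. by rewrite (take_nth t) ?size_enum_ord// nth_ord_enum. Qed.

Section run_separation.
Context (x : instance).
Local Notation inp := (enc_instance x).
Local Notation M := (nint x).
Local Notation L := (nint x + nfix x)%N.
Local Notation st := (memory_of inp).
Local Notation B := (bit_bound x (input_size inp)).
Local Notation run := (runs B (input_size inp)).
Local Notation okz := (fun z => (bitlen z <= B)%N).
Local Notation small z := (absz z%R <= 2 * input_size inp + 4)%N.

(** Stating the result as a conditional memory keeps the two branches together, so the rest of the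
    program is verified once. *)
Lemma run_if_set e k e' l s Q : all okz l ->
  Q (st (if 0 < expr_val (st l) e then set_nth 0 l k (expr_val (st l) e') else l)) s ->
  run (IfPos e (set_var k e') Skip) (st l) s Q.
Proof.
move=> hl HQ; apply: runs_if; [exact: bit_bound_gt0|exact: bounded_state| |] => h.
  by rewrite h in HQ; exact: run_set_var.
by rewrite ltNge h in HQ; apply: runs_skip; first exact: bit_bound_gt0.
Qed.

Lemma run_write e l s Q : all okz l -> Q (st l) (rcons s (expr_val (st l) e)) ->
  run (Write e) (st l) s Q.
Proof.
by move=> hl; apply: runs_write; [exact: bit_bound_gt0|exact: bounded_state].
Qed.

Definition outside_spec (t : nat) (b : int) : Prop :=
  (b = 0 /\ forall k : 'I_M, (k < t)%N -> 0 <= query x 0 k <= 1) \/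
  (exists2 k : 'I_M, b = - (k.+1)%:Z & query x 0 k < 0) \/
  (exists2 k : 'I_M, b = (k.+1)%:Z & 1 < query x 0 k).

Lemma value_lshift (k : 'I_M) : value (lshift (nfix x) k) = query x 0 k.
Proof. by rewrite /value (unsplitK (inl _ k)). Qed.

Lemma run_box_check i k j a d e f g b s Q : all okz [:: i; k; j; a; d; e; f; g; b] ->
  (forall b', outside_spec M b' -> small b' ->
     Q (st [:: M%:Z; k; j; a; d; e; f; g; b']) s) ->
  run box_check (st [:: i; k; j; a; d; e; f; g; b]) s Q.
Proof.
move=> /= /and5P[hi hk hj ha /and5P[hd he hf hg hb]] HQ.
have Ms : (M <= input_size inp)%N by apply: leq_trans (leq_addr _ _) (items_le_size x).
have hidx t : (t <= M)%N -> (bitlen t%:Z <= B)%N by move=> tM; apply: small_bitlen => /=; lia.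
have h0 : (bitlen 0 <= B)%N by rewrite small_bitlen.
apply: runs_seq; apply: run_set_var; first by rewrite /= hi hk hj ha hd he hf hg.
apply: runs_seq; apply: run_set_var; first by rewrite /= hi hk hj ha hd he hf hg h0.
apply: (@runs_while _ _ (bit_bound_gt0 x) M (fun t m' s' => exists b',
   [/\ m' = st [:: t%:Z; k; j; a; d; e; f; g; b'], s' = s, outside_spec t b' & small b'])).
- exact: Ms.
- move=> t m' s' tM [b' [-> _ _ sb]]; apply: bounded_state.
  by rewrite /= hidx// hk hj ha hd he hf hg small_bitlen.
- move=> t m' s' tM [b' [-> -> ob sb]]; split; first by rewrite /= subr_gt0 ltz_nat.
  pose q : 'I_M := Ordinal tM; pose i' : item x := lshift (nfix x) q.
  have ok b1 : small b1 -> all okz [:: t%:Z; k; j; a; d; e; f; g; b1].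
    by move=> sb1; rewrite /= hidx ?(ltnW tM)// hk hj ha hd he hf hg small_bitlen.
  have ev b1 := @expr_val_value x [:: t%:Z; k; j; a; d; e; f; g; b1] i' (var reg_i) erefl.
  have w0 := vden_gt0 i'.
  have vE : query x 0 q = (vnum i')%:~R / (vden i')%:~R by rewrite -valueE value_lshift.
  have lt0 : (query x 0 q < 0) = (vnum i' < 0).
    by rewrite vE ltr_pdivrMr ?ltr0z// mul0r ltrz0.
  have gt1 : (1 < query x 0 q) = (vden i' < vnum i').
    by rewrite vE ltr_pdivlMr ?ltr0z// mul1r ltr_int.
  set b1 := if vnum i' < 0 then - (t.+1)%:Z else b'.
  have sb1 : small b1 by rewrite /b1; case: ifP => _ //; lia.
  set b2 := if vden i' < vnum i' then (t.+1)%:Z else b1.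
  have sb2 : small b2 by rewrite /b2; case: ifP => _ //; lia.
  apply: runs_seq; apply: run_if_set; first exact: ok.
  have -> : (if 0 < expr_val (st [:: t%:Z; k; j; a; d; e; f; g; b'])
              (Sub (Cst 0) (value_num (var reg_i)))
     then set_nth 0 [:: t%:Z; k; j; a; d; e; f; g; b'] reg_outside
        (expr_val (st [:: t%:Z; k; j; a; d; e; f; g; b'])
          (Sub (Cst 0) (Add (var reg_i) (Cst 1))))
     else [:: t%:Z; k; j; a; d; e; f; g; b']) = [:: t%:Z; k; j; a; d; e; f; g; b1].
    rewrite /= (ev b').1 sub0r oppr_gt0 /b1; case: ifP => _ //.
    by congr [:: _; _; _; _; _; _; _; _; _]; lia.
  apply: runs_seq; apply: run_if_set; first exact: ok.
  have -> : (if 0 < expr_val (st [:: t%:Z; k; j; a; d; e; f; g; b1])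
              (Sub (value_num (var reg_i)) (value_den (var reg_i)))
     then set_nth 0 [:: t%:Z; k; j; a; d; e; f; g; b1] reg_outside
        (expr_val (st [:: t%:Z; k; j; a; d; e; f; g; b1]) (Add (var reg_i) (Cst 1)))
     else [:: t%:Z; k; j; a; d; e; f; g; b1]) = [:: t%:Z; k; j; a; d; e; f; g; b2].
    rewrite /= (ev b1).1 (ev b1).2 subr_gt0 /b2; case: ifP => _ //.
    by congr [:: _; _; _; _; _; _; _; _; _]; lia.
  apply: run_set_var; first exact: ok.
  exists b2; split=> //=.
    by congr (st [:: _; _; _; _; _; _; _; _; _]); lia.
  (* A violation at entry [t] overwrites the record. Otherwise the record persists, and a zero
     record now covers entry [t] too. *)
  rewrite /b2 -gt1 /b1 -lt0; case: ifP => [h|h1]; first by right; right; exists q.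
  case: ifP => [h|h2]; first by right; left; exists q.
  case: ob => [[-> hb']|[[k' -> h]|[k' -> h]]].
  + left; split=> // k'; rewrite ltnS leq_eqVlt => /predU1P[kt|]; last exact: hb'.
    have -> : k' = q by apply: val_inj.
    by rewrite !leNgt h1 h2.
  + by right; left; exists k'.
  + by right; right; exists k'.
- move=> m' s' [b' [-> -> ob sb]]; split; first by rewrite /= subrr.
  exact: HQ.
- exists 0; split=> //; left; split=> //.
Qed.

Lemma run_box_output i k j a d e f g b s Q : all okz [:: i; k; j; a; d; e; f; g; b] ->
  small b ->
  (forall m, Q m (s ++ 0 :: flatten [seq [:: (b == (r.+1)%:Z : nat)%:Z - (b == - (r.+1)%:Z : nat)%:Z; 1]
      | r : 'I_M <- enum 'I_M] ++ [:: ((0 < b)%R : nat)%:Z; 1])) ->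
  run box_output (st [:: i; k; j; a; d; e; f; g; b]) s Q.
Proof.
move=> /= /and5P[hi hk hj ha /and5P[hd he hf hg /andP[hb _]]] sb HQ.
have Ms : (M <= input_size inp)%N by apply: leq_trans (leq_addr _ _) (items_le_size x).
have hidx t : (t <= M)%N -> (bitlen t%:Z <= B)%N by move=> tM; apply: small_bitlen => /=; lia.
have h0 : (bitlen 0 <= B)%N by rewrite small_bitlen.
have ok t a1 : (t <= M)%N -> small a1 -> all okz [:: t%:Z; k; j; a1; d; e; f; g; b].
  by move=> tM sa1; rewrite /= hidx// hk hj hd he hf hg hb small_bitlen.
pose c (r : nat) : int := (b == (r.+1)%:Z : nat)%:Z - (b == - (r.+1)%:Z : nat)%:Z.
have sc r : small (c r) by rewrite /c; case: eqP; case: eqP; lia.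
pose out t := rcons s 0 ++ flatten [seq [:: c (r : nat); 1] | r : 'I_M <- take t (enum 'I_M)].
apply: runs_seq; apply: run_write; first by rewrite /= hi hk hj ha hd he hf hg hb.
apply: runs_seq; apply: run_set_var; first by rewrite /= hi hk hj ha hd he hf hg hb.
apply: runs_seq; apply: (@runs_while _ _ (bit_bound_gt0 x) M (fun t m' s' => exists a',
   [/\ m' = st [:: t%:Z; k; j; a'; d; e; f; g; b], s' = out t & (bitlen a' <= B)%N])).
- exact: Ms.
- move=> t m' s' tM [a' [-> _ ha']]; apply: bounded_state.
  by rewrite /= hidx// hk hj ha' hd he hf hg hb.
- move=> t m' s' tM [a' [-> -> ha']]; split; first by rewrite /= subr_gt0 ltz_nat.
  pose q : 'I_M := Ordinal tM.
  apply: runs_seq; apply: run_set_var.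
    by rewrite /= hidx ?(ltnW tM)// hk hj ha' hd he hf hg hb.
  apply: runs_seq; apply: run_if_set; first by apply: ok => //; exact: ltnW.
  have -> : (if 0 < expr_val (st [:: t%:Z; k; j; 0; d; e; f; g; b])
              (zero_test (Sub (var reg_outside) (Add (var reg_i) (Cst 1))))
     then set_nth 0 [:: t%:Z; k; j; 0; d; e; f; g; b] reg_a
        (expr_val (st [:: t%:Z; k; j; 0; d; e; f; g; b]) (Cst 1))
     else [:: t%:Z; k; j; 0; d; e; f; g; b]) =
     [:: t%:Z; k; j; (b == (t.+1)%:Z : nat)%:Z; d; e; f; g; b].
    rewrite /= zero_test_gt0 subr_eq0 (_ : t%:Z + 1 = (t.+1)%:Z); last by lia.
    by case: ifP.
  have s1 : small (b == (t.+1)%:Z : nat)%:Z by case: eqP; lia.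
  apply: runs_seq; apply: run_if_set; first by apply: ok => //; exact: ltnW.
  have -> : (if 0 < expr_val (st [:: t%:Z; k; j; (b == (t.+1)%:Z : nat)%:Z; d; e; f; g; b])
              (zero_test (Add (var reg_outside) (Add (var reg_i) (Cst 1))))
     then set_nth 0 [:: t%:Z; k; j; (b == (t.+1)%:Z : nat)%:Z; d; e; f; g; b] reg_a
        (expr_val (st [:: t%:Z; k; j; (b == (t.+1)%:Z : nat)%:Z; d; e; f; g; b]) (Cst (-1)))
     else [:: t%:Z; k; j; (b == (t.+1)%:Z : nat)%:Z; d; e; f; g; b]) =
     [:: t%:Z; k; j; c t; d; e; f; g; b].
    rewrite /= zero_test_gt0 addr_eq0 (_ : t%:Z + 1 = (t.+1)%:Z); last by lia.
    rewrite /c; case: eqP => h; last by rewrite subr0.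
    by rewrite h (_ : (- (t.+1)%:Z == (t.+1)%:Z) = false).
  apply: runs_seq; apply: run_write; first by apply: ok => //; exact: ltnW.
  apply: runs_seq; apply: run_write; first by apply: ok => //; exact: ltnW.
  apply: run_set_var; first by apply: ok => //; exact: ltnW.
  exists (c t); split=> //=.
  + by congr (st [:: _; _; _; _; _; _; _; _; _]); lia.
  + rewrite /out (take_enum_ordS q) map_rcons flatten_rcons /= -!cats1 -!catA.
    by [].
  + exact: small_bitlen.
- move=> m' s' [a' [-> -> ha']]; split; first by rewrite /= subrr.
  apply: runs_seq; apply: run_set_var.
    by rewrite /= hidx// hk hj ha' hd he hf hg hb.
  apply: runs_seq; apply: run_if_set; first by apply: ok.
  have -> : (if 0 < expr_val (st [:: M%:Z; k; j; 0; d; e; f; g; b]) (var reg_outside)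
     then set_nth 0 [:: M%:Z; k; j; 0; d; e; f; g; b] reg_a
        (expr_val (st [:: M%:Z; k; j; 0; d; e; f; g; b]) (Cst 1))
     else [:: M%:Z; k; j; 0; d; e; f; g; b]) =
     [:: M%:Z; k; j; ((0 < b)%R : nat)%:Z; d; e; f; g; b] by rewrite /=; case: ifP.
  have okb : all okz [:: M%:Z; k; j; ((0 < b)%R : nat)%:Z; d; e; f; g; b].
    by apply: ok => //; case: (0 < b)%R; lia.
  apply: runs_seq; apply: run_write => //; apply: run_write => //=.
  have := HQ (st [:: M%:Z; k; j; ((0 < b)%R : nat)%:Z; d; e; f; g; b]).
  by rewrite /out take_oversize ?size_enum_ord// -!cats1 -!catA.
- by exists a; rewrite /out take0 /= cats0.
Qed.

Lemma input_size_gt0 : (0 < input_size inp)%N.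
Proof.
apply: (@leq_trans (size inp)); first by rewrite size_inp.
by rewrite -sum1_size; apply: leq_sum => z _.
Qed.

Lemma nth_bitlen n : (bitlen (nth 0%R inp n) <= input_size inp)%N.
Proof.
have [ns|ns] := ltnP n (size inp); first exact/input_bitlen/mem_nth.
by rewrite nth_default// input_size_gt0.
Qed.

Lemma vnum_bitlen (i : item x) : (bitlen (vnum i) <= input_size inp)%N.
Proof.
rewrite /vnum; case: fintype.split => [k|j].
  by have := nth_bitlen (4 + 2 * k + 0)%N; rewrite nth_query.
by have := nth_bitlen (4 + 6 * M + 3 * j + 2)%N; rewrite nth_fixing.
Qed.

Lemma vden_bitlen (i : item x) : (bitlen (vden i) <= input_size inp)%N.
Proof.
rewrite /vden; case: fintype.split => [k|j]; last exact: input_size_gt0.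
by have := nth_bitlen (4 + 2 * k + 1)%N; rewrite nth_query.
Qed.

Lemma coef_le (i : item x) : (`|coef i| <= 2 * L)%N.
Proof.
rewrite /coef (eq_bigl (fun q : item x => true))//; apply: absz_sum_le => q.
have cmp1 (b : bool) u v : (absz ((b : nat)%:Z * compare u v)%R <= b)%N.
  by rewrite /compare; case: ltgtP; case: b; lia.
have := cmp1 (rank_dist i q == 1%N) (value i) (value q).
have := cmp1 (rank_dist i q == L.-1) (value i) (reflect_value x (value q)).
by case: (_ == 1%N); case: (_ == L.-1); lia.
Qed.

Lemma coef_bitlen (i : item x) : (bitlen (coef i) <= 2 * input_size inp + 1)%N.
Proof.
rewrite addn1; apply: bitlen_small; apply: leq_trans (coef_le i) _.
by rewrite leq_mul2l items_le_size.
Qed.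

Context (sigma0 : 0 <= sigma x).

(** The constant part of [coef i * (2 * u i - 1)], moved to the right-hand side: [coef i] for an
    interval, and the whole term with opposite sign for a fixing. *)
Definition bound_term (i : item x) : int :=
  coef i * (1 - 2 * (fixing i : nat)%:Z * vnum i).

Definition cut_bound (t : nat) : int :=
  2 * (max_switches x)%:Z + \sum_(q : item x | (q < t)%N) bound_term q.

Definition partial_total (t : nat) : rat :=
  \sum_(q : item x | (q < t)%N) (coef q)%:~R * (2 * value q - 1).

Lemma bit_bound_mono t : (t <= input_size inp)%N -> (bit_bound x t <= B)%N.
Proof. by move=> ts; rewrite /bit_bound !leq_add2r leq_mul2r ts orbT. Qed.

Lemma max_switches_bitlen : (bitlen (max_switches x)%:Z <= input_size inp)%N.
Proof.
rewrite -(@expr_val_switch_bound x [::])//.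
apply: leq_trans (bitlen_divz _ _) _.
exact: (nth_bitlen 2).
Qed.

Lemma run_total i k j a d e f g b s Q : all okz [:: i; k; j; a; d; e; f; g; b] ->
  (forall k' j' a' d' (e' f' : int), 0 < f' ->
     e'%:~R / f'%:~R = \sum_(q : item x) (coef q)%:~R * (2 * value q - 1) :> rat ->
     all okz [:: L%:Z; k'; j'; a'; d'; e'; f'; cut_bound L; b] ->
     Q (st [:: L%:Z; k'; j'; a'; d'; e'; f'; cut_bound L; b]) s) ->
  run total (st [:: i; k; j; a; d; e; f; g; b]) s Q.
Proof.
move=> /= /and5P[hi hk hj ha /and5P[hd he hf hg /andP[hb _]]] HQ.
have Ls := items_le_size x.
have hidx t : (t <= L)%N -> (bitlen t%:Z <= B)%N by move=> tL; exact: bitlen_index.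
have h0 : (bitlen 0 <= B)%N by rewrite small_bitlen.
have h1 : (bitlen 1%R <= B)%N by apply: small_bitlen; lia.
have hB t u : (t <= L)%N -> (u <= bit_bound x t)%N -> (u <= B)%N.
  by move=> tL /leq_trans; apply; apply: bit_bound_mono; exact: leq_trans Ls.
have hK : (bitlen (2 * (max_switches x)%:Z) <= bit_bound x 0)%N.
  apply: leq_trans (bitlenM _ _) _; have := max_switches_bitlen.
  rewrite (_ : bitlen 2 = 2)%N// /bit_bound.
  by move: (input_size inp) => S; lia.
apply: runs_seq; apply: run_set_var; first by rewrite /= hi hk hj ha hd he hf hg hb.
apply: runs_seq; apply: run_set_var; first by rewrite /= hi hk hj ha hd h0 hf hg hb.
apply: runs_seq; apply: run_set_var; first by rewrite /= hi hk hj ha hd h0 hg hb !andbT.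
have -> : expr_val (st (set_nth 0 (set_nth 0 [:: i; k; j; a; d; e; f; g; b] reg_sum_num
     (expr_val (st [:: i; k; j; a; d; e; f; g; b]) (Cst 0))) reg_sum_den 1))
   (Mul (Cst 2) switch_bound) = 2 * (max_switches x)%:Z.
  by rewrite -(@expr_val_switch_bound x
    (set_nth 0 (set_nth 0 [:: i; k; j; a; d; e; f; g; b] reg_sum_num 0) reg_sum_den 1)).
apply: runs_seq; apply: run_set_var;
  first by rewrite /= hi hk hj ha hd h0 (hB 0%N (bitlen _) _ hK)// hb !andbT.
(* The accumulators are held to the round-dependent [bit_bound x t], since the uniform register
   bound would not be preserved by a round. *)
apply: (@runs_while _ _ (bit_bound_gt0 x) L (fun t m' s' => exists k' j' a' d' (e' f' : int),
   [/\ m' = st [:: t%:Z; k'; j'; a'; d'; e'; f'; cut_bound t; b] /\ s' = s,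
       all okz [:: k'; j'; a'; d'],
       [/\ (bitlen e' <= bit_bound x t)%N, (bitlen f' <= bit_bound x t)%N &
           (bitlen (cut_bound t) <= bit_bound x t)%N],
       0 < f' & e'%:~R / f'%:~R = partial_total t])).
- exact: Ls.
- move=> t m' s' tL [k' [j' [a' [d' [e' [f' [[-> _] /and5P[hk' hj' ha' hd' _] [he' hf' hg'] _ _]]]]]]].
  apply: bounded_state.
  by rewrite /= hidx// hk' hj' ha' hd' (hB t (bitlen e'))// (hB t (bitlen f'))// (hB t)// hb.
- move=> t m' s' tL [k' [j' [a' [d' [e' [f' [[-> ->] /and5P[hk' hj' ha' hd' _] [he' hf' hg'] f0 ef]]]]]]].
  split; first by rewrite /= subr_gt0 ltz_nat.
  have tL' := ltnW tL.
  pose q : item x := Ordinal tL.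
  have ht := hidx _ tL'.
  apply: runs_seq; apply: (@run_coefficient x sigma0 q).
    by rewrite /= hk' hj' ha' hd' (hB t (bitlen e'))// (hB t (bitlen f'))// (hB t)// hb.
  move=> d2 hd2.
  have hc : (bitlen (coef q) <= B)%N.
    by apply: small_bitlen; apply: leq_trans (coef_le q) _; lia.
  have hL : (bitlen L%:Z <= B)%N by exact: hidx.
  have ok u v w : (bitlen u <= bit_bound x t.+1)%N -> (bitlen v <= bit_bound x t.+1)%N ->
      (bitlen w <= bit_bound x t.+1)%N ->
      all okz [:: t%:Z; L%:Z; L%:Z; coef q; d2; u; v; w; b].
    move=> hu hv hw.
    by rewrite /= ht hL hc hd2 (hB t.+1 (bitlen u))// (hB t.+1 (bitlen v))// (hB t.+1 (bitlen w))// hb.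
  have up u : (u <= bit_bound x t)%N -> (u <= bit_bound x t.+1)%N.
    move=> /leq_trans; apply; rewrite /bit_bound [(t.+1 * _)%N]mulSn.
    by move: (input_size inp) => S; move: (t * _)%N => Y; lia.
  have ev u v w := @expr_val_value x [:: t%:Z; L%:Z; L%:Z; coef q; d2; u; v; w; b] q (var reg_i) erefl.
  have evf u v w := @expr_val_fixing x [:: t%:Z; L%:Z; L%:Z; coef q; d2; u; v; w; b] q (var reg_i) erefl.
  set e2 := e' * vden q + coef q * (2 * vnum q - vden q) * f'.
  set f2 := f' * vden q.
  have hn := vnum_bitlen q; have hv := vden_bitlen q; have hcq := coef_bitlen q.
  have he2 : (bitlen e2 <= bit_bound x t.+1)%N.
    have b1 := bitlenD (e' * vden q) (coef q * (2 * vnum q - vden q) * f').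
    have b2 := bitlenM e' (vden q).
    have b3 := bitlenM (coef q * (2 * vnum q - vden q)) f'.
    have b4 := bitlenM (coef q) (2 * vnum q - vden q).
    have b5 := bitlenD (2 * vnum q) (- vden q); rewrite bitlenN in b5.
    have b6 := bitlenM 2 (vnum q); rewrite (_ : bitlen 2 = 2)%N// in b6.
    apply: leq_trans b1 _; move: b2 b3 b4 b5 b6 he' hf' hn hv hcq; rewrite /bit_bound [(t.+1 * _)%N]mulSn.
    move: (input_size inp) => S; move: (t * _)%N => Y; do ![move: (bitlen _) => ?].
    by clear; lia.
  have hf2 : (bitlen f2 <= bit_bound x t.+1)%N.
    apply: leq_trans (bitlenM _ _) _; move: hf' hv; rewrite /bit_bound [(t.+1 * _)%N]mulSn.
    by move: (input_size inp) => S; move: (t * _)%N => Y; lia.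
  have cS : cut_bound t.+1 = cut_bound t + bound_term q.
    by rewrite /cut_bound (sum_ltS _ q) addrA.
  have hg2 : (bitlen (cut_bound t.+1) <= bit_bound x t.+1)%N.
    have bt : (bitlen (bound_term q) <= 2 * input_size inp + 1)%N.
      rewrite addn1; apply: bitlen_small.
      (* The second factor of [bound_term] is 1 or -1, because fixed values are 0 or 1. *)
      have : (`|bound_term q| <= `|coef q|)%N.
        rewrite /bound_term abszM -[leqRHS]muln1 leq_mul2l; apply/orP; right.
        rewrite /vnum fixing_split; case: fintype.split => [?|jj] /=; first by rewrite mulr0 mul0r subr0.
        by case: (fixval x jj).
      by move=> /leq_trans; apply; apply: leq_trans (coef_le q) _; lia.
    rewrite cS; apply: leq_trans (bitlenD _ _) _; move: hg' bt; rewrite /bit_bound [(t.+1 * _)%N]mulSn.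
    by move: (input_size inp) => S; move: (t * _)%N => Y; lia.
  apply: runs_seq; apply: run_set_var; first by apply: ok; exact: up.
  rewrite [X in set_nth _ _ _ X](_ : _ = e2); last first.
    by rewrite /= (ev _ _ _).1 (ev _ _ _).2.
  apply: runs_seq; apply: run_set_var; first by apply: ok => //; exact: up.
  rewrite [X in set_nth _ _ _ X](_ : _ = f2); last by rewrite /= (ev _ _ _).2.
  apply: runs_seq; apply: run_set_var; first by apply: ok => //; exact: up.
  rewrite [X in set_nth _ _ _ X](_ : _ = cut_bound t.+1); last first.
    by rewrite /= (ev _ _ _).1 (evf _ _ _) cS.
  apply: run_set_var; first exact: ok.
  exists L%:Z, L%:Z, (coef q), d2, e2, f2; split=> //.
  + split=> //=; congr (st [:: _; _; _; _; _; _; _; _; _]); lia.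
  + by rewrite /= hL hc hd2.
  + by rewrite mulr_gt0// vden_gt0.
  + rewrite /partial_total (sum_ltS _ q) -/(partial_total t) -ef valueE.
    have f0' : f'%:~R != 0 :> rat by rewrite intr_eq0 gt_eqF.
    have v0' : (vden q)%:~R != 0 :> rat by rewrite intr_eq0 gt_eqF// vden_gt0.
    rewrite /e2 /f2 rmorphD !rmorphM rmorphB rmorphM /=.
    rewrite mulrDl -mulf_div divff// mulr1; congr (_ + _).
    rewrite invfM mulrA mulfK// -mulrA; congr (_ * _).
    by rewrite mulrBl divff// mulrA.
- move=> m' s' [k' [j' [a' [d' [e' [f' [[-> ->] /and5P[hk' hj' ha' hd' _] [he' hf' hg'] f0 ef]]]]]]].
  split; first by rewrite /= subrr.
  apply: HQ => //.
    by rewrite ef /partial_total; apply: eq_bigl => q; rewrite ltn_ord.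
  by rewrite /= hidx// hk' hj' ha' hd' (hB L (bitlen e'))// (hB L (bitlen f'))// (hB L)// hb.
- exists k, j, a, d, 0, 1; split=> //.
  + split=> //=; congr (st [:: _; _; _; _; _; _; _; _; _]).
    by rewrite /cut_bound big_pred0 ?addr0.
  + by rewrite /= hk hj ha hd.
  + have b0 : (0 < bit_bound x 0)%N by rewrite /bit_bound addn_gt0 orbT.
    split=> //.
    by rewrite /cut_bound big_pred0 ?addr0.
  + by rewrite mul0r /partial_total big_pred0.
Qed.

Lemma run_cut_output i k j a d e f g b s Q : all okz [:: i; k; j; a; d; e; f; g; b] ->
  (forall m, Q m (s ++ 0 :: flatten [seq [:: 2 * coef (lshift (nfix x) r); 1]
      | r : 'I_M <- enum 'I_M] ++ [:: g; 1])) ->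
  run cut_output (st [:: i; k; j; a; d; e; f; g; b]) s Q.
Proof.
move=> /= /and5P[hi hk hj ha /and5P[hd he hf hg /andP[hb _]]] HQ.
have Ls := items_le_size x; have ML : (M <= L)%N := leq_addr _ _.
have hidx t : (t <= M)%N -> (bitlen t%:Z <= B)%N.
  by move=> tM; apply: bitlen_index; exact: leq_trans ML.
pose out t := rcons s 0 ++
  flatten [seq [:: 2 * coef (lshift (nfix x) r); 1] | r : 'I_M <- take t (enum 'I_M)].
apply: runs_seq; apply: run_write; first by rewrite /= hi hk hj ha hd he hf hg hb.
apply: runs_seq; apply: run_set_var; first by rewrite /= hi hk hj ha hd he hf hg hb.
apply: runs_seq; apply: (@runs_while _ _ (bit_bound_gt0 x) M (fun t m' s' => exists k' j' a' d',
   [/\ m' = st [:: t%:Z; k'; j'; a'; d'; e; f; g; b], s' = out t & all okz [:: k'; j'; a'; d']])).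
- exact: leq_trans Ls.
- move=> t m' s' tM [k' [j' [a' [d' [-> _ /and5P[hk' hj' ha' hd' _]]]]]].
  by apply: bounded_state; rewrite /= hidx// hk' hj' ha' hd' he hf hg hb.
- move=> t m' s' tM [k' [j' [a' [d' [-> -> /and5P[hk' hj' ha' hd' _]]]]]].
  split; first by rewrite /= subr_gt0 ltz_nat.
  pose q : 'I_M := Ordinal tM; pose q' : item x := lshift (nfix x) q.
  have ht := hidx _ (ltnW tM).
  apply: runs_seq; apply: (@run_coefficient x sigma0 q').
    by rewrite /= hk' hj' ha' hd' he hf hg hb.
  move=> d2 hd2.
  have hc : (bitlen (coef q') <= B)%N.
    by apply: small_bitlen; apply: leq_trans (coef_le q') _; lia.
  have hL : (bitlen L%:Z <= B)%N by exact: bitlen_index.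
  have ok : all okz [:: t%:Z; L%:Z; L%:Z; coef q'; d2; e; f; g; b].
    by rewrite /= ht hL hc hd2 he hf hg hb.
  apply: runs_seq; apply: run_write => //.
  apply: runs_seq; apply: run_write => //.
  apply: run_set_var => //.
  exists L%:Z, L%:Z, (coef q'), d2; split=> //.
  + by rewrite /=; congr (st [:: _; _; _; _; _; _; _; _; _]); lia.
  + by rewrite /out (take_enum_ordS q) map_rcons flatten_rcons /= -!cats1 -!catA.
  + by rewrite /= hL hc hd2.
- move=> m' s' [k' [j' [a' [d' [-> -> /and5P[hk' hj' ha' hd' _]]]]]].
  split; first by rewrite /= subrr.
  have ok : all okz [:: M%:Z; k'; j'; a'; d'; e; f; g; b].
    by rewrite /= hidx// hk' hj' ha' hd' he hf hg hb.
  apply: runs_seq; apply: run_write => //; apply: run_write => //=.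
  have := HQ (st [:: M%:Z; k'; j'; a'; d'; e; f; g; b]).
  by rewrite /out take_oversize ?size_enum_ord// -!cats1 -!catA.
- exists k, j, a, d; split=> //; first by rewrite /out take0 /= cats0.
  by rewrite /= hk hj ha hd.
Qed.

(** The interface between the program and the geometry: it describes the output arithmetically and
    mentions neither the machine nor C. *)
Definition separation_spec (out : seq int) : Prop :=
  [\/ exists2 k : 'I_M, query x 0 k < 0 &
       out = 0 :: flatten [seq [:: - (r == k : nat)%:Z; 1] | r <- enum 'I_M] ++ [:: 0; 1],
     exists2 k : 'I_M, 1 < query x 0 k &
       out = 0 :: flatten [seq [:: (r == k : nat)%:Z; 1] | r <- enum 'I_M] ++ [:: 1; 1] |
     (forall k : 'I_M, 0 <= query x 0 k <= 1) /\
     let total := \sum_(q : item x) (coef q)%:~R * (2 * value q - 1) in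
     (total <= (2 * max_switches x)%N%:R /\ out = [:: 1]) \/
     ((2 * max_switches x)%N%:R < total /\
      out = 0 :: flatten [seq [:: 2 * coef (lshift (nfix x) r); 1] | r : 'I_M <- enum 'I_M]
              ++ [:: cut_bound L; 1])].

Lemma run_separation : run separation (load inp) [::] (fun _ out => separation_spec out).
Proof.
rewrite (load_memory_of inp 9) /=.
have h0 : (bitlen 0 <= B)%N by rewrite small_bitlen.
apply: runs_seq; apply: run_box_check; first by rewrite /= h0.
move=> b ob sb; have hb := small_bitlen sb.
have hM : (bitlen M%:Z <= B)%N by apply: bitlen_index; exact: leq_addr.
have ok : all okz [:: M%:Z; 0; 0; 0; 0; 0; 0; 0; b] by rewrite /= hM h0 hb.
apply: runs_if; [exact: bit_bound_gt0|exact: bounded_state| |] => bb.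
  apply: run_box_output => // _.
  case: ob => [[b0 _]|[[k bE vk]|[k bE vk]]]; first by move: bb; rewrite /= b0.
    constructor 1; exists k => //; rewrite bE cat0s (_ : (0 < - (k.+1)%:Z) = false)//.
    congr (_ :: flatten _ ++ _); apply: eq_map => r; congr [:: _; _].
    rewrite (_ : (- (k.+1)%:Z == (r.+1)%:Z) = false) ?sub0r; last by lia.
    by rewrite eqr_opp eq_sym; congr (- (_ : nat)%:Z).
  constructor 2; exists k => //; rewrite bE cat0s; congr (_ :: flatten _ ++ _).
  apply: eq_map => r; congr [:: _; _].
  rewrite (_ : ((k.+1)%:Z == - (r.+1)%:Z) = false) ?subr0; last by lia.
  by rewrite eq_sym; congr ((_ : nat)%:Z).
have {bb}b0 : b = 0 by move: bb; rewrite /=; nia.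
have in01 k : 0 <= query x 0 k <= 1.
  case: ob => [[_ h]|[[r bE _]|[r bE _]]]; first exact: h.
    by move: bE; rewrite b0; lia.
  by move: bE; rewrite b0; lia.
apply: runs_seq; apply: run_total => // k j a d e f f0 ef ok2.
have testE : (0 < expr_val (st [:: L%:Z; k; j; a; d; e; f; cut_bound L; b])
    (Sub (var reg_sum_num) (Mul (Mul (Cst 2) switch_bound) (var reg_sum_den)))) =
  ((2 * max_switches x)%N%:R < \sum_(q : item x) (coef q)%:~R * (2 * value q - 1)).
  rewrite -ef ltr_pdivlMr ?ltr0z//
    (_ : (2 * max_switches x)%N%:R = (2 * max_switches x)%N%:Z%:~R)// -intrM ltr_int.
  rewrite -[RHS]subr_gt0 PoszM -(@expr_val_switch_bound x [:: L%:Z; k; j; a; d; e; f; cut_bound L; b])//.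
apply: runs_if; [exact: bit_bound_gt0|exact: bounded_state| |].
  rewrite testE => lt; apply: run_cut_output => // _.
  by constructor 3; split=> //; right.
rewrite leNgt testE -leNgt => le; apply: run_write => //.
by constructor 3; split=> //; left.
Qed.

End run_separation.

(** * Correctness *)

Fixpoint weight_poly (c : cmd) : {poly nat} :=
  match c with
  | Skip => 1%:P
  | Assign e1 e2 => (test_weight e1 + test_weight e2)%N%:P
  | Write e => (test_weight e)%:P
  | Seq c1 c2 => weight_poly c1 + weight_poly c2
  | IfPos e c1 c2 => (test_weight e)%:P + weight_poly c1 + weight_poly c2
  | WhilePos e c => ('X + 1%:P) * (test_weight e)%:P + 'X * weight_poly c
  end.

Lemma weight_polyE c n : (weight_poly c).[n] = cmd_weight n c.
Proof.
elim: c => [|e1 e2|e|c1 h1 c2 h2|e c1 h1 c2 h2|e c h] /=;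
  rewrite ?hornerD ?hornerM ?hornerD ?hornerX ?hornerC ?h1 ?h2 ?h //.
by rewrite -[(n + 1)%R]/(n + 1)%N addn1.
Qed.

Definition time_poly : {poly nat} :=
  ('X * (5%:P * 'X + 10%:P) + 5%:P * 'X + 10%:P) * weight_poly separation.

Lemma time_polyE x : time_poly.[input_size (enc_instance x)] =
  (bit_bound x (input_size (enc_instance x)) * cmd_weight (input_size (enc_instance x)) separation)%N.
Proof.
by rewrite /time_poly hornerM weight_polyE !hornerD !hornerM !hornerD !hornerM !hornerX !hornerC.
Qed.

Section answer.
Context {R : realType} (T p : R) (hT : 0 < T) (hp : 1 <= p).
Context (x : instance) (vx : valid T x).
Local Notation M := (nint x).
Local Notation v := (map_mx (@ratr R) (query x)).

Lemma ratr_sum_mul (I : finType) (f : I -> int) (g : I -> rat) :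
  ratr (\sum_i (f i)%:~R * g i) = \sum_i (f i)%:~R * ratr (g i) :> R.
Proof. by rewrite rmorph_sum; apply: eq_bigr => i _; rewrite rmorphM /= ratr_int. Qed.

(** Integer data suffice: validity is checked on the finitely many [admissible] sequences over the
    rationals and carried over to C by [C_SP_bound]; the violation also proves that the query is not
    in C. *)
Lemma separating (an : 'I_M -> int) (bn : int) :
  (forall z : item x -> bool, admissible z ->
     \sum_r (an r)%:~R * (z (lshift _ r))%:R <= bn%:~R :> rat) ->
  bn%:~R < \sum_r (an r)%:~R * query x 0 r ->
  separation_answer (C_SP T p x) v
    (0 :: flatten [seq [:: an r; 1] | r <- enum 'I_M] ++ [:: bn; 1]).
Proof.
move=> adm lt.
have bound w : C_SP T p x w -> dot (\row_i ((an i)%:~R / 1%:~R)) w <= bn%:~R / 1%:~R.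
  move: w; apply: (C_SP_bound hT hp vx) => z za.
  have := adm z za; rewrite -(ler_rat R) ratr_sum_mul ratr_int divr1.
  congr (_ <= _); apply: eq_bigr => i _.
  by rewrite mxE divr1 ratr_nat.
have viol : bn%:~R / 1%:~R < dot (\row_i ((an i)%:~R / 1%:~R)) v.
  move: lt; rewrite -(ltr_rat R) ratr_sum_mul ratr_int divr1.
  congr (_ < _); apply: eq_bigr => i _.
  by rewrite !mxE divr1.
right; split; first by move=> /bound; rewrite leNgt viol.
by exists an, (fun=> 1), bn, 1; split.
Qed.

(** Over the fixings the two sums on the right cancel, and over the intervals the constants do.
    Applied to [admissible] sequences and to the query, it turns the inequality over all items into
    the cut over the intervals. *)
Lemma sum_cut (u : item x -> rat) : (forall j, u (rshift _ j) = (fixval x j)%:R) ->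
  \sum_(r : 'I_M) (2 * coef (lshift (nfix x) r))%:~R * u (lshift _ r) =
  \sum_(i : item x) (coef i)%:~R * (2 * u i - 1) + (\sum_(i : item x) bound_term i)%:~R.
Proof.
move=> uf; rewrite rmorph_sum -big_split big_split_ord /= [X in _ + X]big1 ?addr0.
  apply: eq_bigr => r _; rewrite /bound_term fixing_split (unsplitK (inl _ r)).
  by rewrite mulr0 mul0r subr0 mulr1 intrM mulrBr mulr1 subrK mulrA [_ * 2]mulrC.
move=> j _; rewrite uf /bound_term fixing_split /vnum (unsplitK (inr _ j)) /= mulr1.
by rewrite intrM -mulrDr intrB intrM addrA subrK subrr mulr0.
Qed.

Lemma separation_correct out : separation_spec x out ->
  separation_answer (C_SP T p x) v out.
Proof.
have tot := before_total_valid vx.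
case=> [[k vk ->]|[k vk ->]|[v01 [[le ->]|[lt ->]]]].
- apply: (@separating (fun r => - (r == k : nat)%:Z) 0).
    move=> z _; apply: sumr_le0 => r _.
    by rewrite rmorphN mulNr oppr_le0 mulr_ge0// ?ler0n.
  rewrite (bigD1 k)//= eqxx big1 ?addr0 ?mulN1r ?oppr_gt0//.
  by move=> r /negPf ->; rewrite oppr0 mul0r.
- apply: (@separating (fun r => (r == k : nat)%:Z) 1).
    move=> z _; rewrite (bigD1 k)//= eqxx big1 ?addr0 ?mul1r.
      by case: (z _).
    by move=> r /negPf ->; rewrite mul0r.
  rewrite (bigD1 k)//= eqxx big1 ?addr0 ?mul1r//.
  by move=> r /negPf ->; rewrite mul0r.
- left; split=> //.
  have val01 (i : item x) : 0 <= value i <= 1.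
    rewrite /value; case: fintype.split => [k|j]; first exact: v01.
    by case: (fixval x j).
  have [Q Q0 [z zadm zE]] := decomposition tot val01 le.
  have Qr : (Q%:R != 0 :> R) by rewrite pnatr_eq0 -lt0n.
  (* The query is the uniform average of its [Q] systematic samples. *)
  exists Q, (fun=> Q%:R^-1), (fun k => \row_r (z k (lshift _ r))%:R); split.
  + by move=> k; rewrite invr_ge0 ler0n.
  + by rewrite sumr_const card_ord -[LHS]mulr_natl mulfV.
  + by move=> k; have [u uc ue] := admissible_attained hT hp vx (zadm k); exists u.
  + apply/rowP => r; rewrite mxE summxE.
    have := zE (lshift (nfix x) r); rewrite value_lshift => /(congr1 (@ratr R)).
    rewrite rmorphM rmorph_sum /= ratr_nat => h.
    rewrite -[LHS](mulfK Qr) h mulr_suml; apply: eq_bigr => k _.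
    by rewrite !mxE ratr_nat mulrC.
- apply: separating => [z za|].
    have -> : cut_bound x (nint x + nfix x) =
        (2 * max_switches x)%N%:Z + \sum_(i : item x) bound_term i.
      by rewrite /cut_bound PoszM sum_lt_all.
    rewrite (sum_cut (u := fun i => (z i)%:R)); last by move=> j; rewrite za.1.
    by rewrite rmorphD lerD2r; exact: coef_sum_admissible.
  have -> : cut_bound x (nint x + nfix x) =
      (2 * max_switches x)%N%:Z + \sum_(i : item x) bound_term i.
    by rewrite /cut_bound PoszM sum_lt_all.
  rewrite (eq_bigr (fun r => (2 * coef (lshift (nfix x) r))%:~R * value (lshift (nfix x) r))); last first.
    by move=> r _; rewrite value_lshift.
  rewrite sum_cut; last by move=> j; rewrite /value (unsplitK (inr _ j)).
  by rewrite rmorphD ltrD2r.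
Qed.

End answer.

Theorem theorem4p3 (R : realType) (T p : R) (hT : 0 < T) (hp : 1 <= p) :
  solvable_in_polynomial_time (@valid R T) enc_instance
    (fun x : instance =>
       separation_answer (C_SP T p x) (map_mx (@ratr R) (query x))).
Proof.
exists separation, time_poly => x vx.
have [s0 _] := vx.
have [m [out [t [ex ht spec]]]] := run_separation (ltW s0).
exists m, out, t; split=> //; first by rewrite time_polyE.
exact: separation_correct.
Qed.
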